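(* Let $T>0$, $s\in\mathbb{R}$, and let $q=\nu'$ with $\nu\in L^2(0,1)$. Assume that $q\in L^\infty(0,1)$, $q\ge 0$, $a\in L^\infty[0,T]$ and $a(t)\ge a_0>0$ for all $t\in[0,T]$. Let $\mathcal{L}=-\frac{d^2}{dx^2}+q(x)$ on $(0,1)$ with Dirichlet boundary conditions. For any $k\in\mathbb{R}$, if $u_0\in W^k_{\mathcal{L}}$, then the Schrödinger initial/boundary value problem $$\begin{cases} i\partial_t u(t,x)+a(t)\mathcal{L}^s u(t,x)=0, & (t,x)\in[0,T]\times(0,1),\\ u(0,x)=u_0(x), & x\in(0,1),\\ u(t,0)=0=u(t,1), & t\in[0,T],\end{cases}$$ has a unique solution $u\in C([0,T],W^k_{\mathcal{L}})$. Moreover, the following estimates hold: $$\|u(t,\cdot)\|_{L^2}\lesssim\|u_0\|_{L^2},$$ $$\|\partial_t u(t,\cdot)\|_{L^2}\lesssim\|a\|_{L^\infty[0,T]}\,\|u_0\|_{W^{2s}_{\mathcal{L}}}.$$ When $s=1$, one also has $$\|\partial_x u(t,\cdot)\|_{L^2}\lesssim\|u_0\|_{W^1_{\mathcal{L}}}\left(1+\|\nu\|_{L^2}\right)+\|u_0\|_{L^2}\|\nu\|_{L^\infty},$$ $$\|\partial_x^2u(t,\cdot)\|_{L^2}\lesssim\|q\|_{L^\infty}\|u_0\|_{L^2}+\|u_0\|_{W^2_{\mathcal{L}}},$$ $$\|u(t,\cdot)\|_{W^k_{\mathcal{L}}}\lesssim\|u_0\|_{W^k_{\mathcal{L}}}.$$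 The constants in these inequalities are independent of $u_0$, $\nu$, $q$ and $a$.
   Context: The operator $\mathcal{L}y=-y''+q(x)y$ on $(0,1)$ is taken with boundary conditions $y(0)=y(1)=0$. It is a positive operator with real eigenvalues $\lambda_n$ ($n=1,2,\dots$) and a corresponding orthonormal basis of real eigenfunctions $\phi_n$ of $L^2(0,1)$. The power $\mathcal{L}^s$ ($s\in\mathbb{R}$) is defined spectrally, $\mathcal{L}^s\phi_n=\lambda_n^s\phi_n$. Test functions: $\mathrm{Dom}(\mathcal{L}^m)=\{f\in L^2(0,1):\mathcal{L}^jf\in\mathrm{Dom}(\mathcal{L}),\ j=0,\dots,m-1\}$ and $C^\infty_{\mathcal{L}}(0,1)=\bigcap_{m\ge1}\mathrm{Dom}(\mathcal{L}^m)$, with the Fréchet topology given by the norms $\|\phi\|_{C^m_{\mathcal{L}}}=\max_{j\le m}\|\mathcal{L}^j\phi\|_{L^2(0,1)}$, $m\in\mathbb{N}_0$. The space $\mathcal{D}'_{\mathcal{L}}(0,1)$ of $\mathcal{L}$-distributions is the space of continuous linear functionals on $C^\infty_{\mathcal{L}}(0,1)$; a function $\psi$ is identified with $\phi\mapsto\int_0^1\psi\phi\,dx$, and $\mathcal{L}^s$ acts on $\mathcal{D}'_{\mathcal{L}}(0,1)$ by duality. Sobolev spaces: for $k\in\mathbb{R}$, $W^k_{\mathcal{L}}=\{f\in\mathcal{D}'_{\mathcal{L}}(0,1):\mathcal{L}^{k/2}f\in L^2(0,1)\}$ with $\|f\|_{W^k_{\mathcal{L}}}=\|\mathcal{L}^{k/2}f\|_{L^2}$;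 in particular $W^0_{\mathcal{L}}=L^2(0,1)$. Conventions: the equation is understood in $\mathcal{D}'_{\mathcal{L}}(0,1)$ for almost every $t$, with the boundary conditions encoded in the Dirichlet operator $\mathcal{L}$. $A\lesssim B$ means $A\le CB$ with a constant $C>0$ having the stated independence. Each estimate is for $t\in[0,T]$ (for a.e. $t$ when it involves $\partial_t u$) and is meaningful when its right-hand side is finite. *)

(* Defs.v *)
From HB Require Import structures.
From mathcomp Require Import all_boot all_order all_algebra.
From mathcomp Require Import all_classical all_reals all_analysis.
From mathcomp Require Import complex.

Set Implicit Arguments.
Unset Strict Implicit.
Unset Printing Implicit Defensive.

Import Order.TTheory GRing.Theory Num.Theory.
Import numFieldNormedType.Exports.

#[global] Open Scope classical_set_scope.
#[global] Open Scope ring_scope.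
#[global] Open Scope complex_scope.

(* Functions on a measurable D are functions on R of which only the values on D
   matter; [f \_ D] is the extension by zero of the restriction of f to D. *)
Section lebesgue_spaces.
Context {R : realType}.
Implicit Types (D : set R) (p : \bar R).

Definition leb := @lebesgue_measure R.

Definition inLp D p (f : R -> R) : Prop := f \_ D \in Lfun leb p.

Definition Lpnorm D p (f : R -> R) : \bar R :=
  Lnorm leb p (EFin \o (f \_ D)).

Definition I01 : set R := `]0, 1[.

Definition I0T (T : R) : set R := `[0, T].

Definition cmod (z : R[i]) : R := ComplexField.Normc.normc z.

Definition cfun (f : R -> R) : R -> R[i] := fun x => (f x)%:C.

Definition cintegral D (f : R -> R[i]) : R[i] :=
  (\int[leb]_(x in D) complex.Re (f x)) +i* (\int[leb]_(x in D) complex.Im (f x)).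

Definition inL2 (f : R -> R[i]) : Prop :=
  inLp I01 2%:E (fun x => complex.Re (f x)) /\ inLp I01 2%:E (fun x => complex.Im (f x)).

Definition L2norm (f : R -> R[i]) : \bar R :=
  Lpnorm I01 2%:E (fun x => cmod (f x)).

(* The bilinear pairing, without conjugation. *)
Definition pairing (f g : R -> R[i]) : R[i] :=
  cintegral I01 (fun x => f x * g x).

End lebesgue_spaces.

Section derivatives.
Context {R : realType}.

(* C^oo_c(0,1); real test functions suffice, by linearity. *)
Definition Ccinfty (w : R -> R) : Prop :=
  (forall n x, derivable (derive1n n w) x 1) /\
  exists a b : R, [/\ 0 < a, b < 1 & forall x, w x != 0 -> a <= x <= b].

(* g is the n-th distributional derivative of f on (0,1). *)
Definition distr_deriv (n : nat) (f g : R -> R[i]) : Prop :=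
  forall w, Ccinfty w ->
    pairing f (cfun (derive1n n w)) = (-1) ^+ n * pairing g (cfun w).

(* f is absolutely continuous on [a,b] with derivative g almost everywhere,
   i.e. f is an indefinite integral of the integrable function g. *)
Definition AC_deriv (a b : R) (f g : R -> R[i]) : Prop :=
  [/\ inLp `[a, b] 1%:E (fun x => complex.Re (g x)),
      inLp `[a, b] 1%:E (fun x => complex.Im (g x)) &
      forall x, x \in `[a, b] -> f x = f a + cintegral `[a, x] g].

End derivatives.

Section operator.
Context {R : realType} (q : R -> R).

(* f is in Dom(L) and g = Lf: up to a null set f is a function y such that
   y and y' are absolutely continuous on [0,1] and y(0) = y(1) = 0, and
   g = - y'' + q y is in L^2(0,1). *)
Definition isL (f g : R -> R[i]) : Prop :=
  [/\ inL2 f, inL2 g &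
    exists y y1 y2 : R -> R[i],
      [/\ f = y %[ae leb in I01],
          AC_deriv 0 1 y y1 /\ AC_deriv 0 1 y1 y2,
          y 0 = 0 /\ y 1 = 0 &
          g = (fun x => - y2 x + (q x)%:C * y x) %[ae leb in I01]]].

Definition DomL (f : R -> R[i]) : Prop := exists g, isL f g.

(* A representative of the class of Lf, and 0 if f is not in Dom(L). *)
Definition opL (f : R -> R[i]) : R -> R[i] := xget (cst 0) [set g | isL f g].

Definition DomLpow (m : nat) (f : R -> R[i]) : Prop :=
  inL2 f /\ forall j, (j < m)%N -> DomL (iter j opL f).

Definition testL (f : R -> R[i]) : Prop :=
  forall m, (0 < m)%N -> DomLpow m f.

Definition testnorm (m : nat) (f : R -> R[i]) : R :=
  \big[Num.max/0]_(j < m.+1) fine (L2norm (iter j opL f)).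

(* An element of D'_L is a functional of which only the values on C^oo_L matter.
   The norms increase with m, so that one of them with one radius suffices in
   continuity; linearity and continuity force the same value on functions that
   are equal almost everywhere. *)
Definition distr := (R -> R[i]) -> R[i].

Definition isdistr (u : distr) : Prop :=
  (forall (c : R[i]) f g, testL f -> testL g ->
     u (fun x => c * f x + g x) = c * u f + u g) /\
  (forall f, testL f -> forall e : R, 0 < e ->
     exists (m : nat) (d : R), 0 < d /\
       forall g, testL g -> testnorm m (fun x => g x - f x) < d ->
         cmod (u g - u f) < e).

Definition distr_eq (u v : distr) : Prop := forall f, testL f -> u f = v f.

Definition distr_of (psi : R -> R[i]) : distr := fun f => pairing psi f.

(* The norm of the function in L^2(0,1) that u is identified with, and +oo if
   there is none. *)
Definition distrL2norm (u : distr) : \bar R :=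
  ereal_inf [set L2norm psi | psi in
    [set psi | inL2 psi /\ distr_eq u (distr_of psi)]].

(* The same for the n-th derivative in x of u. *)
Definition distr_dx_L2norm (n : nat) (u : distr) : \bar R :=
  ereal_inf [set L2norm h | h in
    [set h | inL2 h /\ exists psi,
      [/\ inL2 psi, distr_eq u (distr_of psi) & distr_deriv n psi h]]].

(* w is the derivative of the D'_L-valued function u at time t. *)
Definition distr_dt (u : R -> distr) (t : R) (w : distr) : Prop :=
  isdistr w /\ forall f, testL f ->
    cmod ((h^-1)%:C * (u (t + h) f - u t f) - w f) @[h --> 0^'] --> (0 : R).

Definition coef (phi : nat -> R -> R) (n : nat) (f : R -> R[i]) : R[i] :=
  pairing f (cfun (phi n)).

(* phi is an orthonormal basis of L^2(0,1) of real eigenfunctions of L, for the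
   eigenvalues lam. *)
Definition eigenbasis (lam : nat -> R) (phi : nat -> R -> R) : Prop :=
  [/\ forall n, isL (cfun (phi n)) (fun x => (lam n)%:C * (phi n x)%:C),
      forall m n, coef phi m (cfun (phi n)) = (m == n)%:R &
      forall f, inL2 f ->
        L2norm (fun x => f x - \sum_(n < N) coef phi n f * (phi n x)%:C)
          @[N --> \oo] --> 0%E].

Section powers.
Variables (lam : nat -> R) (phi : nat -> R -> R).

(* L^s on functions: the (class of the) element of L^2(0,1) with coefficients
   lam_n^s (f, phi_n). *)
Definition powL (s : R) (f : R -> R[i]) : R -> R[i] :=
  xget (cst 0) [set g | inL2 g /\
    forall n, coef phi n g = (lam n `^ s)%:C * coef phi n f].

Definition distr_powL (s : R) (u : distr) : distr := fun f => u (powL s f).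

Definition inW (k : R) (u : distr) : Prop :=
  isdistr u /\
  exists psi, inL2 psi /\ distr_eq (distr_powL (k / 2) u) (distr_of psi).

Definition Wnorm (k : R) (u : distr) : \bar R :=
  distrL2norm (distr_powL (k / 2) u).

Definition contW (T k : R) (u : R -> distr) : Prop :=
  forall t, I0T T t ->
    inW k (u t) /\
    Wnorm k (fun f => u t' f - u t f) @[t' --> within (I0T T) (nbhs t)] --> 0%E.

(* The equation holds in D'_L for almost every t.  An equation that holds for
   almost every t determines a function of t only if the function is absolutely
   continuous (else a Cantor function could be added to the coefficients of u),
   so this is required of t |-> <u(t), f> for each test function f. *)
Definition schrodinger_sol (T s k : R) (a : R -> R) (u0 : distr)
    (u : R -> distr) : Prop :=
  [/\ contW T k u,
      forall f, testL f -> exists g, AC_deriv 0 T (fun t => u t f) g,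
      {ae leb, forall t, I0T T t -> exists w,
        distr_dt u t w /\
        distr_eq (fun f => (0 +i* 1) * w f + (a t)%:C * distr_powL s (u t) f)
                 (fun=> 0)} &
      distr_eq (u 0) u0].

End powers.
End operator.

Arguments distr R : clear implicits.

(* Main.v *)
From HB Require Import structures.
From mathcomp Require Import all_boot all_order all_algebra.
From mathcomp Require Import all_classical all_reals all_analysis.
From mathcomp Require Import ess_sup_inf measurable_realfun complex.
From mathcomp Require Import lra ring.
Require Import Defs.

Set Implicit Arguments.
Unset Strict Implicit.
Unset Printing Implicit Defensive.

Import Order.TTheory GRing.Theory Num.Theory.
Import numFieldNormedType.Exports.

(** Why the theorem is true.

    In the basis phi the operator L is diagonal, so the equation splits into the
    scalar equations i c_n' + a(t) lam_n^s c_n = 0, which are solved by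
    c_n(t) = exp(i lam_n^s A(t)) c_n(0) with A(t) the integral of a over [0, t].
    The phases have modulus one: all norms that are weighted l^2 norms of the
    coefficients (L^2, W^k) are conserved, and the estimate of the time
    derivative is the estimate of a(t) lam_n^s c_n(t).  The constant 2 serves for
    all the estimates at once.

    The work is to make this diagonal picture available for the operator and for
    the distributions.

    - The operator.  With green h the solution of - y'' = h, y(0) = y(1) = 0, the
      relation L f = g is f = green (g - q f) almost everywhere (isLP).  In this
      integrated form L is symmetric (isLr_sym), it is closed because green maps
      L^2 boundedly to continuous functions (isLr_closed), and its form dominates
      the L^2 norm of the derivative (isLr_energy), so that all lam_n are at least
      1 (lam_ge1).  Symmetry and closedness say that L is diagonal: L f = g if and
      only if the coefficients of g are lam_n times those of f (isL_coefP).  Hence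
      the test functions are the functions with rapidly decreasing coefficients
      (testLP), and every sequence b of polynomial growth in lam acts on them as a
      multiplier; the powers of L and the solution operator are multipliers.

    - The distributions.  A distribution is a linear form that is bounded by one
      of the norms (distr_bounded).  It is determined by its values on the phi_n
      (distr_ext), and its L^2 norm is the l^2 norm of these values, by the
      theorem of Riesz and Fischer and Parseval's identity (distrL2normE).

    - Time.  The solution is u(t) = u0 o (multiplier exp(i lam^s A(t))).  The first
      order Taylor expansion of the exponential is an identity of multipliers with
      an explicit quadratic remainder, so that applying u0 to it differentiates
      t |-> <u(t), f> along A without any series (evolve_taylor).  Since A is
      Lipschitz, with derivative a almost everywhere by Lebesgue's differentiation
      theorem, this yields absolute continuity (evolve_AC) and the equation for
      almost every t (evolve_derivative, evolve_equation).  For uniqueness, each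
      coefficient of the difference of two solutions is absolutely continuous and
      solves z' = i lam_n^s a z almost everywhere with z(0) = 0; integration by
      parts shows that |z|^2 is constant (sol_unique).

    - Space.  For s = 1, the derivatives of the partial sums of the expansion of
      u(t) are Cauchy in L^2 because the energy of a partial sum is at most the sum
      of the lam_n |c_n|^2; this gives the first derivative (weak_derivative,
      dx_bound).  The second one is q u - L u (d2x_bound).

    Identities between indefinite integrals are obtained without differentiating
    almost everywhere: a function whose increments over [x, y] are bounded by the
    increment of a monotone function times that of a uniformly continuous one is
    constant (constant_of_product_modulus). *)

(** * Integration by parts for absolutely continuous functions *)

Section partition.
Context {R : realType}.

(** Over a subdivision into intervals shorter than d, the increments of D sum up to at
    most the total increase of Phi times the largest increment of Psi. *)
Lemma constant_of_product_modulus (a b : R) (D Phi Psi : R -> R) : a <= b ->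
  (forall x y, a <= x -> x <= y -> y <= b ->
     `|D y - D x| <= (Phi y - Phi x) * (Psi y - Psi x)) ->
  (forall x y, a <= x -> x <= y -> y <= b -> Phi x <= Phi y) ->
  (forall e, 0 < e -> exists2 d, 0 < d & forall x y, a <= x -> x <= y ->
     y <= b -> y - x < d -> Psi y - Psi x <= e) ->
  D b = D a.
Proof.
move=> ab DPP Phi_homo Psi_unif.
apply/eqP; rewrite -subr_eq0 -normr_le0; apply/ler_addgt0Pl => e e0; rewrite addr0.
pose P := Phi b - Phi a; have P0 : 0 <= P by rewrite subr_ge0 Phi_homo.
have [d d0 Psid] := Psi_unif (e / (P + 1)) (divr_gt0 e0 (ltr_wpDl P0 ltr01)).
pose N := (Num.truncn ((b - a) / d)).+1.
have N0 : 0 < N%:R :> R by rewrite ltr0n.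
pose h := (b - a) / N%:R.
have h0 : 0 <= h by rewrite divr_ge0 ?subr_ge0// ltW.
have hd : h < d.
  by rewrite /h ltr_pdivrMr// mulrC -ltr_pdivrMr//; exact: truncnS_gt.
pose x i := a + i%:R * h.
have xN : x N = b by rewrite /x /h mulrC divfK ?gt_eqF// subrKC.
have x0 : x 0%N = a by rewrite /x mul0r addr0.
have xS i : x i.+1 - x i = h by rewrite /x -natr1; ring.
have ax i : a <= x i by rewrite lerDl mulr_ge0.
have xx i : x i <= x i.+1 by rewrite -subr_ge0 xS.
have xb i : (i <= N)%N -> x i <= b.
  by move=> iN; rewrite -xN lerD2l ler_wpM2r// ler_nat.
rewrite -xN -x0 -(telescope_sumr (D \o x) (leq0n N)).
rewrite (le_trans (ler_norm_sum _ _ _))//.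
apply: (@le_trans _ _ (\sum_(0 <= i < N) (Phi (x i.+1) - Phi (x i)) * (e / (P + 1)))).
  rewrite big_nat [leRHS]big_nat; apply: ler_sum => i /andP[_ iN].
  rewrite (le_trans (DPP _ _ (ax i) (xx i) (xb _ iN)))// ler_wpM2l//.
    by rewrite subr_ge0 Phi_homo// xb.
  by apply: Psid => //; [exact: xb|rewrite xS].
rewrite -mulr_suml (telescope_sumr (Phi \o x) (leq0n N))/= xN x0 -/P.
rewrite mulrA ler_pdivrMr; last by rewrite ltr_wpDl.
by rewrite mulrC ler_wpM2l ?ltW// ltrDl.
Qed.

End partition.

Section integrals.
Context {R : realType}.
Local Notation mu := (@lebesgue_measure R).
Local Notation integr D f := (mu.-integrable D (EFin \o f)).
Implicit Types (a b c x y : R) (f g F G : R -> R).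

Lemma aeS (P Q : R -> Prop) : (forall x, P x -> Q x) ->
  {ae mu, forall x, P x} -> {ae mu, forall x, Q x}.
Proof. by move=> PQ; apply: filterS => //; exact: (ae_filter_ringOfSetsType mu). Qed.

Lemma aeI (P Q S : R -> Prop) : (forall x, P x -> Q x -> S x) ->
  {ae mu, forall x, P x} -> {ae mu, forall x, Q x} -> {ae mu, forall x, S x}.
Proof. by move=> PQ; apply: filterS2 => //; exact: (ae_filter_ringOfSetsType mu). Qed.

Lemma aeW (P : R -> Prop) : (forall x, P x) -> {ae mu, forall x, P x}.
Proof.
move=> h; apply: (@filterE _ _ (ae_filter_ringOfSetsType mu)).
exact: h.
Qed.

Lemma inLp1P (D : set (measurableTypeR R)) f : measurable D -> inLp D 1 f <-> integr D f.
Proof.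
move=> mD; rewrite /inLp Lfun1_integrable.
rewrite (_ : EFin \o f \_ D = (EFin \o f) \_ D); last exact/esym/restrict_EFin.
by rewrite -integrable_restrict// setTI.
Qed.

(** The real counterpart of AC_deriv: F is on [a, b] an indefinite integral of f. *)
Definition ACr a b F f := integr `[a, b] f /\
  forall x, a <= x -> x <= b -> F x = F a + \int[mu]_(t in `[a, x]) f t.

Lemma integr_sub a b x y f : a <= x -> y <= b ->
  integr `[a, b] f -> integr `[x, y] f.
Proof.
by move=> ax yb; apply: integrableS => //; apply: subset_itvScc; rewrite bnd_simp.
Qed.

Lemma integr_sub_oc a b x y f : a <= x -> y <= b ->
  integr `[a, b] f -> integr `]x, y] f.
Proof.
move=> ax yb; apply: integrableS => //; apply: subset_itvScc => //; rewrite bnd_simp//.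
Qed.

Lemma integral_itvB a b x y f : a <= x -> x <= y -> y <= b -> integr `[a, b] f ->
  \int[mu]_(t in `[a, y]) f t - \int[mu]_(t in `[a, x]) f t =
  \int[mu]_(t in `]x, y]) f t.
Proof.
move=> ax xy yb fab; apply: Rintegral_itvB; rewrite ?bnd_simp//.
exact: integr_sub fab.
Qed.

Lemma ACr_incr a b x y F f : ACr a b F f -> a <= x -> x <= y -> y <= b ->
  F y - F x = \int[mu]_(t in `]x, y]) f t.
Proof.
move=> [fab Ff] ax xy yb.
rewrite (Ff y) ?(le_trans ax)// (Ff x) ?(le_trans xy)// opprD addrACA subrr add0r.
exact: integral_itvB fab.
Qed.

Lemma integr_norm (D : set (measurableTypeR R)) f : measurable D -> integr D f -> integr D (fun x => `|f x|).
Proof. by move=> mD /integrable_abse. Qed.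

Definition norm_integral a f x := \int[mu]_(t in `[a, x]) `|f t|.

Lemma ACr_norm_integral a b f : integr `[a, b] f ->
  ACr a b (norm_integral a f) (fun x => `|f x|).
Proof.
move=> fab; split; first exact: integr_norm.
by move=> x ax xb; rewrite /norm_integral set_itv1 Rintegral_set1 add0r.
Qed.

Lemma norm_integral_le a b x y F f : ACr a b F f -> a <= x -> x <= y -> y <= b ->
  `|F y - F x| <= norm_integral a f y - norm_integral a f x.
Proof.
move=> Ff ax xy yb; rewrite (ACr_incr Ff)// (ACr_incr (ACr_norm_integral Ff.1))//.
by apply: le_normr_Rintegral => //; exact: integr_sub_oc Ff.1.
Qed.

Lemma norm_integral_homo a b x y f : integr `[a, b] f -> a <= x -> x <= y -> y <= b ->
  norm_integral a f x <= norm_integral a f y.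
Proof.
move=> fab ax xy yb; rewrite -subr_ge0 (ACr_incr (ACr_norm_integral fab))//.
by apply: Rintegral_ge0 => t _.
Qed.

(** Absolute continuity of the integral of |f|. *)
Lemma norm_integral_unif a b f : integr `[a, b] f ->
  forall e, 0 < e -> exists2 d, 0 < d & forall x y, a <= x -> x <= y ->
     y <= b -> y - x < d -> norm_integral a f y - norm_integral a f x <= e.
Proof.
move=> fab e e0; pose g := f \_ `[a, b].
have gT : mu.-integrable setT (EFin \o g).
  rewrite /g (_ : EFin \o _ = (EFin \o f) \_ `[a, b]); last exact/esym/restrict_EFin.
  by apply/integrable_restrict; rewrite ?setTI.
have [d [d0 gd]] := integral_normr_continuous gT e0.
exists d => // x y ax xy yb yxd.
rewrite (ACr_incr (ACr_norm_integral fab))//; apply/ltW.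
rewrite [ltLHS](_ : _ = \int[mu]_(t in `]x, y]) `|g t|).
  apply: gd; first exact: measurable_itv.
  change (mu `]x, y]%classic < d%:E)%E; rewrite lebesgue_measure_itv/= lte_fin.
  by case: ifPn => // _; rewrite -EFinD lte_fin.
apply: eq_Rintegral => t; rewrite inE/= in_itv/= => /andP[xt ty].
rewrite /g patchE mem_set//= in_itv/= (le_trans ty)// andbT.
by rewrite (le_trans ax)// ltW.
Qed.

Lemma ACr_continuous a b F f : a <= b -> ACr a b F f -> {within `[a, b], continuous F}.
Proof.
move=> ab [fab Ff].
have := parameterized_integral_continuous ab fab.
rewrite /parameterized_integral => cf.
have : {within `[a, b], continuous (fun x => F a + \int[mu]_(t in `[a, x]) f t)}.
  move=> x; apply: cvgD; [exact: cvg_cst|exact: cf].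
apply: subspace_eq_continuous => x; rewrite inE/= in_itv/= => /andP[ax xb].
by rewrite [in RHS]/from_subspace/= (Ff x).
Qed.

Lemma ACr_measurable a b F f : a <= b -> ACr a b F f -> measurable_fun `[a, b] F.
Proof.
by move=> ab /(ACr_continuous ab) cF; exact: subspace_continuous_measurable_fun.
Qed.

Lemma ACr_bounded a b F f x : ACr a b F f -> a <= x -> x <= b ->
  `|F x| <= `|F a| + norm_integral a f b.
Proof.
move=> Ff ax xb; rewrite -lerBlDl (le_trans (lerB_dist _ _))//.
rewrite (le_trans (norm_integral_le Ff (lexx a) ax xb))//.
rewrite {2}/norm_integral set_itv1 Rintegral_set1 subr0.
exact: norm_integral_homo Ff.1 _ _ _.
Qed.

Lemma integrable_bounded_mul (D : set (measurableTypeR R)) f g (M : R) : measurable D ->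
  integr D f -> measurable_fun D g -> (forall x, D x -> `|g x| <= M) ->
  integr D (fun x => f x * g x).
Proof.
move=> mD fD mg gM.
apply: (@le_integrable _ _ _ mu D mD _ (EFin \o (fun x => M * f x))).
- by apply/measurable_EFinP/measurable_funM => //; apply/measurable_EFinP; case/integrableP : fD.
- move=> x Dx; rewrite /= lee_fin normrM [leRHS]normrM mulrC ler_wpM2r//.
  by rewrite (le_trans (gM _ Dx))// ler_norm.
- by have := integrableZl mD M fD.
Qed.

Lemma integrD (D : set (measurableTypeR R)) f g : measurable D -> integr D f -> integr D g ->
  integr D (fun x => f x + g x).
Proof. by move=> mD /[swap] gi fi; have := integrableD mD fi gi. Qed.

Lemma integrZl (D : set (measurableTypeR R)) (k : R) f : measurable D -> integr D f -> integr D (fun x => k * f x).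
Proof. by move=> mD fi; have := integrableZl mD k fi. Qed.

Lemma integrB (D : set (measurableTypeR R)) f g : measurable D -> integr D f -> integr D g ->
  integr D (fun x => f x - g x).
Proof. by move=> mD /[swap] gi fi; have := integrableB mD fi gi. Qed.

Lemma le_norm_integral_mul a x y f g (M : R) : a <= x -> x <= y ->
  integr `[a, y] f -> measurable_fun `]x, y] g ->
  (forall t, x <= t -> t <= y -> `|g t| <= M) ->
  `|\int[mu]_(t in `]x, y]) (f t * g t)| <= M * (norm_integral a f y - norm_integral a f x).
Proof.
move=> ax xy fab mg gM.
have fxy : integr `]x, y] f by exact: integr_sub_oc fab.
have gM' t : [set` `]x, y]] t -> `|g t| <= M.
  by rewrite /= in_itv/= => /andP[/ltW xt ty]; exact: gM.
rewrite (ACr_incr (ACr_norm_integral fab))//.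
have nf : integr `]x, y] (fun t => `|f t|) by exact: integr_norm.
rewrite -RintegralZl//; apply: (le_trans (le_normr_Rintegral _ _)) => //.
  exact: integrable_bounded_mul gM'.
apply: le_Rintegral => //.
- by apply: integr_norm => //; exact: integrable_bounded_mul gM'.
- exact: integrZl.
- by move=> t tI; rewrite normrM mulrC ler_wpM2r// gM'.
Qed.

Lemma ACr_mul_integrable a b F G f g : a <= b -> ACr a b F f -> ACr a b G g ->
  integr `[a, b] (fun t => f t * G t).
Proof.
move=> ab Ff Gg; apply: (integrable_bounded_mul (M := `|G a| + norm_integral a g b)) => //.
- exact: Ff.1.
- exact: ACr_measurable Gg.
- by move=> x /=; rewrite in_itv/= => /andP[]; exact: ACr_bounded.
Qed.

(** The function D x = F x G x - int_a^x (f G + F g) is constant: its increment over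
    ]x, y] is int f (G y - G t) - int g (F t - F x), which is at most twice the
    product of the increments of int |f| and int |g|. *)
Lemma ACr_parts a b F G f g : a <= b -> ACr a b F f -> ACr a b G g ->
  \int[mu]_(t in `[a, b]) (f t * G t + F t * g t) = F b * G b - F a * G a.
Proof.
move=> ab Ff Gg.
pose p t := f t * G t + F t * g t.
have fG : integr `[a, b] (fun t => f t * G t) by exact: ACr_mul_integrable Ff Gg.
have Fg : integr `[a, b] (fun t => F t * g t).
  rewrite (_ : (fun t => F t * g t) = (fun t => g t * F t)).
    exact: ACr_mul_integrable Gg Ff.
  by apply/funext => t; rewrite mulrC.
have pab : integr `[a, b] p by exact: integrD.
pose P x := \int[mu]_(t in `[a, x]) p t.
have Pp : ACr a b P p.
  by split=> // x ax xb; rewrite /P set_itv1 Rintegral_set1 add0r.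
pose D x := F x * G x - P x.
suff : D b = D a.
  rewrite /D {2}/P set_itv1 Rintegral_set1 subr0 /P => <-; ring.
pose Phi x := 2 * norm_integral a f x.
apply: (@constant_of_product_modulus _ _ _ _ Phi (norm_integral a g)) => //; last first.
- exact: norm_integral_unif Gg.1.
- by move=> x y ax xy yb; rewrite ler_pM2l//; exact: norm_integral_homo Ff.1 _ _ _.
move=> x y ax xy yb.
have xyab : `]x, y] `<=` `[a, b].
  by apply: subset_itvScc => //; rewrite bnd_simp.
have mF : measurable_fun `]x, y] F.
  by apply: measurable_funS (ACr_measurable ab Ff).
have mG : measurable_fun `]x, y] G.
  by apply: measurable_funS (ACr_measurable ab Gg).
have fxy : integr `]x, y] f by exact: integr_sub_oc Ff.1.
have gxy : integr `]x, y] g by exact: integr_sub_oc Gg.1.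
have bF t : x <= t -> t <= y -> `|F t| <= `|F a| + norm_integral a f b.
  by move=> xt ty; apply: (ACr_bounded Ff); [exact: le_trans xt|exact: le_trans yb].
have bG t : x <= t -> t <= y -> `|G t| <= `|G a| + norm_integral a g b.
  by move=> xt ty; apply: (ACr_bounded Gg); [exact: le_trans xt|exact: le_trans yb].
have bGt t : [set` `]x, y]] t -> `|G y - G t| <= norm_integral a g y - norm_integral a g x.
  rewrite /= in_itv/= => /andP[/ltW xt ty].
  rewrite (le_trans (norm_integral_le Gg (le_trans ax xt) ty yb))// lerD2l lerN2.
  by apply: (norm_integral_homo Gg.1) => //; exact: le_trans yb.
have bFt t : [set` `]x, y]] t -> `|F t - F x| <= norm_integral a f y - norm_integral a f x.
  rewrite /= in_itv/= => /andP[/ltW xt ty].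
  rewrite (le_trans (norm_integral_le Ff ax xt (le_trans ty yb)))// lerD2r.
  by apply: (norm_integral_homo Ff.1) => //; exact: le_trans xt.
(* G y and F x do not depend on t, so the terms with them integrate to multiples of the
   increments of F and of G *)
have DE : D y - D x = \int[mu]_(t in `]x, y]) (f t * (G y - G t)) -
    \int[mu]_(t in `]x, y]) (g t * (F t - F x)).
  have i1 : integr `]x, y] (fun t => f t * (G y - G t)).
    apply: integrable_bounded_mul bGt => //.
    exact: measurable_funB.
  have i2 : integr `]x, y] (fun t => g t * (F t - F x)).
    apply: integrable_bounded_mul bFt => //.
    exact: measurable_funB.
  rewrite -RintegralB//.
  under eq_Rintegral => t _.
    rewrite (_ : _ - _ = (G y * f t + F x * g t) - p t); last by rewrite /p; ring.
    over.
  rewrite RintegralB//; last 2 first.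
    by apply: integrD => //; exact: integrZl.
    by apply: integr_sub_oc pab.
  rewrite RintegralD//; [|exact: integrZl..].
  rewrite !RintegralZl// -(ACr_incr Ff)// -(ACr_incr Gg)// -(ACr_incr Pp)// /D.
  ring.
rewrite DE (le_trans (ler_normB _ _))// /Phi -mulrBr -mulrA mulr_natl mulr2n lerD//.
  rewrite mulrC; apply: le_norm_integral_mul => //.
  - exact: integr_sub Ff.1.
  - exact: measurable_funB.
  - move=> t xt ty; rewrite (le_trans (norm_integral_le Gg (le_trans ax xt) ty yb))// lerD2l lerN2.
    by apply: (norm_integral_homo Gg.1) => //; exact: le_trans yb.
apply: le_norm_integral_mul => //.
- exact: integr_sub Gg.1.
- exact: measurable_funB.
- move=> t xt ty; rewrite (le_trans (norm_integral_le Ff ax xt (le_trans ty yb)))// lerD2r.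
  by apply: (norm_integral_homo Ff.1) => //; exact: le_trans xt.
Qed.

End integrals.

(** * The real Hilbert space of square-integrable functions on the unit interval *)

Section L2.
Context {R : realType}.
Local Notation mu := (@lebesgue_measure R).
Local Notation integr D f := (mu.-integrable D (EFin \o f)).
Local Notation L2 f := (inLp I01 2%:E f).
Implicit Types (f g h : R -> R).

Lemma measurable_I01 : measurable (I01 : set (measurableTypeR R)).
Proof. exact: measurable_itv. Qed.
Hint Resolve measurable_I01 : core.

Lemma measure_I01 : mu I01 = 1%E.
Proof. by rewrite /I01 lebesgue_measure_itv/= lte_fin ltr01 oppr0 adde0. Qed.

Lemma L2P f : L2 f <-> measurable_fun I01 f /\ integr I01 (fun x => f x ^+ 2).
Proof.
have fE : (fun x => (f \_ I01) x ^+ 2) = (fun x => f x ^+ 2) \_ I01.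
  by apply/funext => x; rewrite !patchE; case: ifP => // _; rewrite expr0n.
split.
  move=> Lf; have := Lfun2_integrable_sqr Lf.
  rewrite (_ : EFin \o _ = (EFin \o (fun x => f x ^+ 2)) \_ I01); last first.
    by rewrite restrict_EFin -fE.
  rewrite -integrable_restrict// setTI => i2; split => //.
  move: Lf; rewrite /inLp inE => /andP[+ _]; rewrite inE/= => mf.
  exact/(measurable_restrictT _ _).2.
move=> [mf i2]; rewrite /inLp inE; apply/andP; split; rewrite inE/=.
  exact/(measurable_restrictT _ _).1.
rewrite /finite_norm unlock; apply: poweR_lty.
have : integr setT (fun x => (f \_ I01) x ^+ 2).
  rewrite fE (_ : EFin \o _ = (EFin \o (fun x => f x ^+ 2)) \_ I01); last first.
    exact/esym/restrict_EFin.
  by rewrite -integrable_restrict// setTI.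
move=> /integrableP[_]; apply: le_lt_trans.
rewrite le_eqVlt; apply/orP; left; apply/eqP/eq_integral => x _ /=.
by rewrite powR_mulrn// real_normK ?num_real// ger0_norm// sqr_ge0.
Qed.

Lemma L2_measurable f : L2 f -> measurable_fun I01 f.
Proof. by move=> /L2P[]. Qed.

Lemma L2_mul f g : L2 f -> L2 g -> integr I01 (fun x => f x * g x).
Proof.
move=> /L2P[mf if2] /L2P[mg ig2].
have i2 : integr I01 (fun x => f x ^+ 2 + g x ^+ 2) by exact: integrD.
apply: le_integrable i2 => //.
  by apply/measurable_EFinP; exact: measurable_funM.
move=> x _ /=; rewrite lee_fin [leRHS]ger0_norm ?addr_ge0 ?sqr_ge0//.
have := sqr_ge0 (f x - g x); have := sqr_ge0 (f x + g x).
by move=> h1 h2; rewrite ler_norml; apply/andP; split; nra.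
Qed.

Lemma L2_dom f g : measurable_fun I01 f -> L2 g ->
  {ae mu, forall x, I01 x -> f x ^+ 2 <= g x ^+ 2} -> L2 f.
Proof.
move=> mf /L2P[mg ig] fg; apply/L2P; split => //.
have mX h : measurable_fun I01 h -> measurable_fun I01 (EFin \o (fun x => h x ^+ 2)).
  by move=> mh; apply/measurable_EFinP; exact: measurable_funX.
apply/integrableP; split; first exact: mX.
have /integrableP[_] := ig; apply: le_lt_trans.
apply: ae_ge0_le_integral => //.
- by apply: measurableT_comp => //; exact: mX.
- by apply: measurableT_comp => //; exact: mX.
- by apply: aeS fg => x fg xI; rewrite /= lee_fin !ger0_norm ?sqr_ge0// fg.
Qed.

Lemma L2_cst (c : R) : L2 (fun=> c).
Proof.
apply/L2P; split; first exact: measurable_cst.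
apply/integrableP; split; first by apply/measurable_EFinP; exact: measurable_cst.
rewrite (eq_integral (cst (`|c ^+ 2|)%:E))// integral_cst//.
by rewrite [X in (_ * X)%E]measure_I01 mule1 ltry.
Qed.

Lemma L2Z (k : R) f : L2 f -> L2 (fun x => k * f x).
Proof.
move=> /L2P[mf if2]; apply/L2P; split; first exact: measurable_funM.
rewrite (_ : (fun _ => _) = (fun x => k ^+ 2 * f x ^+ 2)).
  exact: integrZl.
by apply/funext => x; rewrite exprMn.
Qed.

Lemma L2D f g : L2 f -> L2 g -> L2 (fun x => f x + g x).
Proof.
move=> Lf Lg; have [mf if2] := (L2P _).1 Lf; have [mg ig2] := (L2P _).1 Lg.
apply/L2P; split; first exact: measurable_funD.
rewrite (_ : (fun _ => _) = (fun x => (f x ^+ 2 + g x ^+ 2) + 2 * (f x * g x))).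
  apply: integrD => //; first exact: integrD.
  by apply: integrZl => //; exact: L2_mul.
by apply/funext => x; ring.
Qed.

Lemma L2N f : L2 f -> L2 (fun x => - f x).
Proof. by move=> /(L2Z (-1)); under eq_fun do rewrite mulN1r. Qed.

Lemma L2B f g : L2 f -> L2 g -> L2 (fun x => f x - g x).
Proof. by move=> Lf /L2N; exact: L2D. Qed.

Lemma L2_sum (J : Type) (r : seq J) (P : pred J) (F : J -> R -> R) :
  (forall j, L2 (F j)) -> L2 (fun x => \sum_(j <- r | P j) F j x).
Proof.
move=> LF; elim: r => [|j r ih].
  by under eq_fun do rewrite big_nil; exact: L2_cst.
under eq_fun do rewrite big_cons.
by case: (P j) => //; exact: L2D.
Qed.

Lemma L2_integrable f : L2 f -> integr I01 f.
Proof. by move=> /(L2_mul (L2_cst 1)); under eq_fun do rewrite mul1r. Qed.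

Definition ip f g : R := \int[mu]_(x in I01) (f x * g x).

Lemma ipC f g : ip f g = ip g f.
Proof. by apply: eq_Rintegral => x _; rewrite mulrC. Qed.

Lemma ipDl f g h : L2 f -> L2 g -> L2 h ->
  ip (fun x => f x + g x) h = ip f h + ip g h.
Proof.
move=> Lf Lg Lh; rewrite /ip -RintegralD//; [|exact: L2_mul..].
by apply: eq_Rintegral => x _; rewrite mulrDl.
Qed.

Lemma ipZl (k : R) f g : L2 f -> L2 g -> ip (fun x => k * f x) g = k * ip f g.
Proof.
move=> Lf Lg; rewrite /ip -RintegralZl//; last exact: L2_mul.
by apply: eq_Rintegral => x _; rewrite mulrA.
Qed.

Lemma ipNl f g : L2 f -> L2 g -> ip (fun x => - f x) g = - ip f g.
Proof.
by move=> Lf Lg; under [in LHS]eq_fun do rewrite -mulN1r; rewrite ipZl// mulN1r.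
Qed.

Lemma ipBl f g h : L2 f -> L2 g -> L2 h ->
  ip (fun x => f x - g x) h = ip f h - ip g h.
Proof. by move=> Lf Lg Lh; rewrite ipDl// ?ipNl//; exact: L2N. Qed.

Lemma ipDr f g h : L2 f -> L2 g -> L2 h ->
  ip h (fun x => f x + g x) = ip h f + ip h g.
Proof. by move=> *; rewrite ipC ipDl// !(ipC h). Qed.

Lemma ipZr (k : R) f g : L2 f -> L2 g -> ip g (fun x => k * f x) = k * ip g f.
Proof. by move=> *; rewrite ipC ipZl// ipC. Qed.

Lemma ipNr f g : L2 f -> L2 g -> ip g (fun x => - f x) = - ip g f.
Proof. by move=> *; rewrite ipC ipNl// ipC. Qed.

Lemma ipBr f g h : L2 f -> L2 g -> L2 h ->
  ip h (fun x => f x - g x) = ip h f - ip h g.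
Proof. by move=> *; rewrite ipC ipBl// !(ipC h). Qed.

Lemma ip_suml (J : Type) (r : seq J) (P : pred J) (F : J -> R -> R) g :
  (forall j, L2 (F j)) -> L2 g ->
  ip (fun x => \sum_(j <- r | P j) F j x) g = \sum_(j <- r | P j) ip (F j) g.
Proof.
move=> LF Lg; elim: r => [|j r ih].
  under [in LHS]eq_fun do rewrite big_nil; rewrite big_nil.
  rewrite /ip; under eq_Rintegral do rewrite mul0r.
  by rewrite Rintegral_cst// mul0r.
under [in LHS]eq_fun do rewrite big_cons; rewrite big_cons.
by case: (P j) => //; rewrite ipDl ?ih//; exact: L2_sum.
Qed.

Lemma eq_ip f f' g g' : (forall x, I01 x -> f x * g x = f' x * g' x) ->
  ip f g = ip f' g'.
Proof. by move=> fg; apply: eq_Rintegral => x; rewrite inE => /fg. Qed.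

Lemma ip_ge0 f : 0 <= ip f f.
Proof. by apply: Rintegral_ge0 => x _; rewrite -expr2 sqr_ge0. Qed.

Lemma ip_CS f g : L2 f -> L2 g -> ip f g ^+ 2 <= ip f f * ip g g.
Proof.
move=> Lf Lg.
(* the quadratic t |-> ip (f - t g) (f - t g) is taken at its minimum, or, when it is
   affine, at a point where it would be negative *)
have H (t : R) : 0 <= ip f f - 2 * t * ip f g + t ^+ 2 * ip g g.
  have := ip_ge0 (fun x => f x - t * g x).
  have Lt := L2Z t Lg.
  rewrite ipBl ?ipBr ?ipZl ?ipZr//; last exact: L2B.
  by rewrite (ipC g f); nra.
have gg0 := ip_ge0 g.
have [g0|g0] := eqVneq (ip g g) 0.
  have [->|fg0] := eqVneq (ip f g) 0; first by rewrite expr0n/= g0 mulr0.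
  have := H ((ip f f + 1) / (2 * ip f g)).
  rewrite g0 mulr0 addr0 (_ : 2 * _ * _ = ip f f + 1); last by field.
  by rewrite opprD addrA subrr sub0r oppr_ge0 ler10.
have := H (ip f g / ip g g).
rewrite (_ : _ + _ = ip f f - ip f g ^+ 2 / ip g g); last by field.
by rewrite subr_ge0 ler_pdivrMr ?lt_neqAle 1?eq_sym ?g0.
Qed.

Lemma EFin_ip f g : L2 f -> L2 g ->
  (ip f g)%:E = (\int[mu]_(x in I01) (f x * g x)%:E)%E.
Proof.
move=> Lf Lg; rewrite /ip /Rintegral fineK//.
by apply: integrable_fin_num => //; exact: L2_mul.
Qed.

Lemma Lpnorm2E f : L2 f -> Lpnorm I01 2%:E f = (Num.sqrt (ip f f))%:E.
Proof.
move=> Lf; rewrite /Lpnorm unlock.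
rewrite -powR12_sqrt ?ip_ge0// -poweR_EFin; congr (_ `^ _)%E.
rewrite EFin_ip// [RHS]integral_mkcond; apply: eq_integral => x _ /=.
rewrite powR_mulrn// real_normK ?num_real// !patchE.
by case: ifP => // _; rewrite expr0n.
Qed.

Lemma ip_ae_eq f f' g : L2 f -> L2 f' -> L2 g -> f = f' %[ae mu in I01] ->
  ip f g = ip f' g.
Proof.
move=> Lf Lf' Lg ff'; rewrite /ip /Rintegral; congr fine.
apply: ae_eq_integral => //.
- by apply/measurable_EFinP/measurable_funM; exact: L2_measurable.
- by apply/measurable_EFinP/measurable_funM; exact: L2_measurable.
- by apply: aeS ff' => x /[apply] /= ->.
Qed.

Lemma ip_eq0 f : L2 f -> ip f f = 0 -> f = cst 0 %[ae mu in I01].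
Proof.
move=> Lf f0.
have mf2 : measurable_fun I01 (EFin \o (fun x => f x * f x)).
  by apply/measurable_EFinP/measurable_funM; exact: L2_measurable.
have /(ae_eq_integral_abs mu measurable_I01 mf2) : (\int[mu]_(x in I01) `|(f x * f x)%:E| = 0)%E.
  rewrite -[RHS](congr1 EFin f0) EFin_ip//; apply: eq_integral => x _ /=.
  by rewrite ger0_norm// -expr2 sqr_ge0.
by apply: aeS => x /[apply] /= -[] /eqP; rewrite mulf_eq0 orbb => /eqP.
Qed.

Lemma ip_sub_eq0 f g : L2 f -> L2 g -> ip (fun x => f x - g x) (fun x => f x - g x) = 0 ->
  f = g %[ae mu in I01].
Proof.
move=> Lf Lg /ip_eq0 => /(_ (L2B Lf Lg)).
by apply: aeS => x /[apply] /eqP; rewrite subr_eq0 => /eqP.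
Qed.

Lemma L2_ae f g : L2 f -> measurable_fun I01 g -> f = g %[ae mu in I01] -> L2 g.
Proof.
move=> /L2P[mf if2] mg fg; apply/L2P; split => //.
have m2 h : measurable_fun I01 h -> measurable_fun I01 (EFin \o (fun x => h x ^+ 2)).
  by move=> mh; apply/measurable_EFinP; exact: measurable_funX.
have fg2 : ae_eq mu I01 (EFin \o (fun x => f x ^+ 2)) (EFin \o (fun x => g x ^+ 2)).
  by apply: aeS fg => x /[apply] /= ->.
apply/integrableP; split; first exact: m2.
have /integrableP[_] := if2; apply: le_lt_trans.
rewrite le_eqVlt; apply/orP; left; apply/eqP/ae_eq_integral => //.
- by apply: measurableT_comp => //; exact: m2.
- by apply: measurableT_comp => //; exact: m2.
- by apply: aeS fg2 => x fgx xI; congr (`|_|%E); exact/esym/fgx.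
Qed.

(** The norm of f as an element of L^2 is that of its absolute value. *)
Lemma ip_norm f : ip (fun x => `|f x|) (fun x => `|f x|) = ip f f.
Proof.
by apply: eq_ip => x _; rewrite -normrM ger0_norm// -expr2 sqr_ge0.
Qed.

Lemma L2_norm f : L2 f -> L2 (fun x => `|f x|).
Proof.
move=> Lf; apply: (L2_dom _ Lf); first by apply: measurableT_comp => //; exact: L2_measurable.
by apply: aeW => x _; rewrite real_normK ?num_real.
Qed.

Lemma ip11 : ip (fun=> 1) (fun=> 1) = 1.
Proof.
by rewrite /ip Rintegral_cst// [X in fine X]measure_I01 mulr1 mul1r.
Qed.

Lemma integral_norm_le f : L2 f ->
  (\int[mu]_(x in I01) `|(f x)%:E| <= (Num.sqrt (ip f f))%:E)%E.
Proof.
move=> Lf; have Ln := L2_norm Lf.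
have := ip_CS Ln (L2_cst 1); rewrite ip11 mulr1 ip_norm => h.
have -> : (\int[mu]_(x in I01) `|(f x)%:E|)%E = (ip (fun x => `|f x|) (fun=> 1))%:E.
  by rewrite EFin_ip//; [apply: eq_integral => x _; rewrite mulr1|exact: L2_cst].
have A0 : 0 <= ip (fun x => `|f x|) (fun=> 1).
  by apply: Rintegral_ge0 => x _; rewrite mulr1.
by rewrite lee_fin -(ger0_norm A0) -sqrtr_sqr ler_wsqrtr.
Qed.

(** The L^1 norm on the unit interval is at most the L^2 norm, so the sum of the
    |g (k+1) - g k| has a finite integral and is finite almost everywhere. *)
Lemma ae_cvg_of_summable (g : nat -> R -> R) (c : R) : (forall k, L2 (g k)) ->
  (forall n, \sum_(0 <= k < n) Num.sqrt (ip (fun x => g k.+1 x - g k x) (fun x => g k.+1 x - g k x)) <= c) ->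
  {ae mu, forall x, I01 x -> cvgn (g ^~ x)}.
Proof.
move=> Lg sc.
pose h k x := g k.+1 x - g k x.
have Lh k : L2 (h k) by exact: L2B.
pose S x := (\sum_(0 <= k <oo) `|(h k x)%:E|)%E.
have mh k : measurable_fun I01 (fun x => `|(h k x)%:E|%E).
  by apply: measurableT_comp => //; apply/measurable_EFinP; exact: L2_measurable.
have mS : measurable_fun I01 S.
  exact: ge0_emeasurable_sum.
have iS : mu.-integrable I01 S.
  apply/integrableP; split => //.
  under eq_integral => x _ do rewrite gee0_abs ?nneseries_ge0//.
  rewrite integral_nneseries//.
  apply: (@le_lt_trans _ _ c%:E); last by rewrite ltry.
  apply: lime_le; first by apply: is_cvg_nneseries => k _ _; exact: integral_ge0.
  apply: nearW => n.
  apply: (@le_trans _ _ (\sum_(0 <= k < n) (Num.sqrt (ip (h k) (h k)))%:E)%E).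
    by apply: lee_sum => k _; exact: integral_norm_le.
  by rewrite sumEFin lee_fin sc.
apply: aeS (integrable_ae measurable_I01 iS) => x /[apply] Sx.
have cvs : cvgn (series (h ^~ x)).
  apply: normed_cvg; apply: nondecreasing_is_cvgn.
    by apply/nondecreasing_seqP => n; change (series (fun k => `|h k x|) n <= series (fun k => `|h k x|) n.+1);
      rewrite seriesSr lerDl.
  exists (fine (S x)) => _ [n _ <-]; rewrite -lee_fin fineK//.
  rewrite /series/= -sumEFin; exact: (nneseries_lim_ge (u_ := fun k => `|(h k x)%:E|%E)).
have -> : g ^~ x = (fun n => g 0%N x + series (h ^~ x) n).
  apply/funext => n; rewrite /series/= (telescope_sumr (g ^~ x))//; ring.
by apply: is_cvgD => //; exact: is_cvg_cst.
Qed.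

(** A subsequence whose consecutive distances are at most 2^-k converges almost
    everywhere; Fatou's lemma, applied to the squared distances to a fixed term, then
    turns the Cauchy property into convergence in L^2. *)
Lemma L2_complete (F : nat -> R -> R) : (forall n, L2 (F n)) ->
  (forall e, 0 < e -> exists N, forall m n, (N <= m)%N -> (N <= n)%N ->
     ip (fun x => F m x - F n x) (fun x => F m x - F n x) <= e) ->
  exists2 f, L2 f & forall e, 0 < e -> exists N, forall n, (N <= n)%N ->
     ip (fun x => F n x - f x) (fun x => F n x - f x) <= e.
Proof.
move=> LF cF.
have e4 k : 0 < (2^-1 : R) ^+ k ^+ 2 by rewrite !exprn_gt0// invr_gt0.
have {e4}[N NP] := choice (fun k => cF _ (e4 k)).
(* M is nondecreasing, dominates N and is unbounded: the terms M k, M (k+1) of F are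
   within the distance prescribed for k *)
pose M k := (\sum_(0 <= i < k.+1) (N i).+1)%N.
have NM k : (N k <= M k)%N by rewrite /M big_nat_recr//= addnS leqW// leq_addl.
have M1 k : (M k <= M k.+1)%N by rewrite {2}/M big_nat_recr//= leq_addr.
have kM k : (k <= M k)%N.
  by elim: k => // k ih; rewrite /M big_nat_recr//= addnS ltnS (leq_trans ih) ?leq_addr.
pose g k := F (M k).
have Lg k : L2 (g k) by exact: LF.
have gae : {ae mu, forall x, I01 x -> cvgn (g ^~ x)}.
  apply: (ae_cvg_of_summable (c := 2)) => // n.
  apply: (@le_trans _ _ (series (geometric 1 2^-1) n)).
    apply: ler_sum => k _; rewrite /= mul1r -[leRHS]ger0_norm ?exprn_ge0 ?invr_ge0//.
    rewrite -sqrtr_sqr ler_wsqrtr// /g NP//; exact: leq_trans (NM _) (M1 _).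
  rewrite (le_trans (geometric_le_lim _ _ _ _))//.
  - by rewrite ger0_norm ?invr_ge0// invf_lt1// ltr1n.
  - by rewrite (_ : 1 - 2^-1 = 2^-1) ?div1r ?invrK//; lra.
(* the upper limit is measurable even where the sequence does not converge *)
pose f x := fine (limn_esup (fun k => (g k x)%:E)).
have mf : measurable_fun I01 f.
  apply: (measurableT_comp (f := fine)) => //.
  apply: measurable_fun_limn_esup => k.
  by apply/measurable_EFinP; exact: L2_measurable.
have fat n e N0 : (forall k, (N0 <= k)%N ->
      ip (fun x => F n x - g k x) (fun x => F n x - g k x) <= e) ->
    (\int[mu]_(x in I01) ((F n x - f x) * (F n x - f x))%:E <= e%:E)%E.
  move=> gke.
  pose h k x := ((F n x - g k x) * (F n x - g k x))%:E.
  have Lh k : L2 (fun x => F n x - g k x) by exact: L2B.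
  have mh k : measurable_fun I01 (h k).
    by apply/measurable_EFinP/measurable_funM; exact: L2_measurable.
  apply: (@le_trans _ _ (\int[mu]_(x in I01) limn_einf (h ^~ x))%E).
    rewrite le_eqVlt; apply/orP; left; apply/eqP/ae_eq_integral => //.
    - apply/measurable_EFinP/measurable_funM; apply: measurable_funB => //; exact: L2_measurable.
    - rewrite /limn_einf; apply: measurableT_comp => //.
      apply: measurable_fun_limn_esup => k.
      exact: (measurableT_comp (f := oppe) _ (mh k)).
    - apply: aeS gae => x /[apply] /cvg_ex[l gl].
      have fl : f x = l.
        have gl' : (g k x)%:E @[k --> \oo] --> l%:E by apply: cvg_EFin => //; exact: nearW.
        by rewrite /f (cvg_limn_einf_sup gl').2.
      have hl : h k x @[k --> \oo] --> ((F n x - l) * (F n x - l))%:E.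
        apply: cvg_EFin; first exact: nearW.
        by apply: cvgM; apply: cvgB => //; exact: cvg_cst.
      by rewrite (cvg_limn_einf_sup hl).1 fl.
  apply: (le_trans (fatou mu _ mh _)) => //.
    by move=> k x _; rewrite /h lee_fin -expr2 sqr_ge0.
  rewrite limn_einf_lim; apply: lime_le; first exact: is_cvg_einfs.
  apply: nearW => m; rewrite /einfs.
  apply: (@le_trans _ _ (\int[mu]_(x in I01) (h (maxn m N0) x))%E).
    apply: ereal_inf_lbound; exists (maxn m N0) => //=; exact: leq_maxl.
  by rewrite /h -EFin_ip// lee_fin gke// leq_maxr.
(* uniform in n: the bound passes from the subsequence g to its limit f *)
have Ff e : 0 < e -> exists N0, forall n, (N0 <= n)%N ->
    (\int[mu]_(x in I01) ((F n x - f x) * (F n x - f x))%:E <= e%:E)%E.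
  move=> e0; have [N0 NF] := cF e e0; exists N0 => n N0n.
  apply: (fat n e N0) => k N0k; apply: NF => //; exact: leq_trans (kM k).
have Lf : L2 f.
  have [N0 /(_ N0 (leqnn _)) FNf] := Ff 1 ltr01.
  have mFf : measurable_fun I01 (fun x => F N0 x - f x).
    by apply: measurable_funB => //; exact: L2_measurable.
  have LFf : L2 (fun x => F N0 x - f x).
    apply/L2P; split => //; apply/integrableP; split.
      by apply/measurable_EFinP; exact: measurable_funX.
    apply: le_lt_trans (ltry 1); apply: le_trans FNf.
    rewrite le_eqVlt; apply/orP; left; apply/eqP/eq_integral => x _ /=.
    by rewrite ger0_norm ?sqr_ge0.
  have := L2B (LF N0) LFf; congr (L2 _).
  by apply/funext => x; ring.
exists f => // e e0; have [N0 NF] := Ff e e0; exists N0 => n /NF.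
by rewrite -EFin_ip ?lee_fin//; exact: L2B.
Qed.

End L2.
#[global] Hint Extern 0 (measurable I01) => exact: measurable_I01 : core.

(** * Orthonormal bases, real and complex expansions *)

Section orthonormal_bases.
Context {R : realType}.
Local Notation mu := (@lebesgue_measure R).
Local Notation L2 f := (inLp I01 2%:E f).
Implicit Types (f g h : R -> R) (phi : nat -> R -> R) (c : nat -> R).

(** The form in which the convergence of a series is used: all blocks far out are small. *)
Lemma nneseries_tail_small (u : nat -> R) : (forall k, 0 <= u k) ->
  (\sum_(0 <= k <oo) (u k)%:E < +oo)%E ->
  forall e, 0 < e -> exists N, forall m n, (N <= m)%N -> \sum_(m <= k < n) u k <= e.
Proof.
move=> u0 uoo e e0.
have := nneseries_tail_cvg uoo (fun k _ => u0 k).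
move=> /fine_cvgP[_ /cvgrPdist_le /(_ e e0)[N _ NP]].
exists N => m n Nm; have := NP m Nm; rewrite /= sub0r normrN => h.
have mo : (\sum_(m <= k <oo) (u k)%:E < +oo)%E.
  apply: le_lt_trans uoo; rewrite [leRHS](nneseries_split 0 m); last by move=> k _; rewrite lee_fin.
  by rewrite add0n leeDr//; apply: sume_ge0 => k _; rewrite lee_fin.
rewrite (le_trans _ (le_trans (ler_norm _) h))//.
rewrite -lee_fin fineK ?ge0_fin_numE//; last by apply: nneseries_ge0 => k _ _; rewrite lee_fin.
rewrite -?lee_fin.
by rewrite -sumEFin; apply: nneseries_lim_ge => k _ _; rewrite lee_fin.
Qed.

Definition orthonormal_basis phi := [/\ forall n, L2 (phi n),
  forall m n, ip (phi m) (phi n) = (m == n)%:R &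
  forall f, L2 f ->
    ip (fun x => f x - \sum_(0 <= n < N) ip f (phi n) * phi n x)
       (fun x => f x - \sum_(0 <= n < N) ip f (phi n) * phi n x) @[N --> \oo] --> (0 : R)].

Section basis.
Variable phi : nat -> R -> R.
Hypothesis bphi : orthonormal_basis phi.

Let Lphi n : L2 (phi n). Proof. by case: bphi. Qed.

Definition combination c m n x := \sum_(m <= k < n) c k * phi k x.

Lemma L2_combination c m n : L2 (combination c m n).
Proof. by apply: L2_sum => k; exact: L2Z. Qed.
Local Hint Resolve L2_combination : core.

Lemma ip_combination c m n f : L2 f ->
  ip (combination c m n) f = \sum_(m <= k < n) c k * ip (phi k) f.
Proof.
move=> Lf; rewrite /combination ip_suml//; last by move=> k; exact: L2Z.
by apply: eq_bigr => k _; rewrite ipZl.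
Qed.

Lemma coef_combination c m n k :
  ip (combination c m n) (phi k) = (if (m <= k < n)%N then c k else 0).
Proof.
rewrite ip_combination//.
under eq_bigr => i _ do (have [_ -> _] := bphi).
have [/andP[mk kn]|] := boolP (m <= k < n)%N.
  rewrite (bigD1_seq k) ?mem_index_iota ?mk ?iota_uniq//= eqxx mulr1 big1 ?addr0//.
  by move=> i /negbTE ->; rewrite mulr0.
move=> mkn; rewrite big_seq big1// => i; rewrite mem_index_iota.
by case: eqP => [->|]; rewrite ?mulr0// (negbTE mkn).
Qed.

Lemma ip_combination_combination c d m n :
  ip (combination c m n) (combination d m n) = \sum_(m <= k < n) c k * d k.
Proof.
rewrite ip_combination// [LHS]big_seq [RHS]big_seq; apply: eq_bigr => k.
by rewrite mem_index_iota ipC coef_combination => ->.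
Qed.

Lemma combinationB c m n x : (m <= n)%N ->
  combination c 0 n x - combination c 0 m x = combination c m n x.
Proof.
move=> mn; rewrite /combination (big_cat_nat (n := m))//=; ring.
Qed.

Lemma ip_residual f N : L2 f ->
  ip (fun x => f x - combination (fun n => ip f (phi n)) 0 N x)
     (fun x => f x - combination (fun n => ip f (phi n)) 0 N x) =
  ip f f - \sum_(0 <= n < N) ip f (phi n) ^+ 2.
Proof.
move=> Lf; rewrite ipBl ?ipBr//; last exact: L2B.
rewrite ip_combination_combination (ipC f) ip_combination//.
under eq_bigr => k _ do rewrite (ipC (phi k)).
by rewrite subrr subr0; congr (_ - _); apply: eq_bigr => k _; rewrite expr2.
Qed.

Lemma parseval f : L2 f ->
  (\sum_(0 <= n <oo) (ip f (phi n) ^+ 2)%:E = (ip f f)%:E)%E.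
Proof.
move=> Lf; apply/cvg_lim => //.
rewrite (_ : (fun n => _) = (EFin \o (fun N => \sum_(0 <= n < N) ip f (phi n) ^+ 2))); last first.
  by apply/funext => N /=; rewrite sumEFin.
apply: cvg_EFin; first exact: nearW.
have [_ _ /(_ f Lf)] := bphi.
under eq_fun => N do rewrite (ip_residual N Lf).
move=> res0.
rewrite (_ : fine \o _ = (fun N => ip f f - (ip f f - \sum_(0 <= n < N) ip f (phi n) ^+ 2))); last first.
  by apply/funext => N /=; ring.
have := cvgB (cvg_cst (ip f f)) res0; rewrite subr0; exact.
Qed.

(** The squared norm of a block of the series is the sum of the squares of its
    coefficients, so the partial sums are Cauchy. *)
Lemma riesz_fischer c : (\sum_(0 <= n <oo) (c n ^+ 2)%:E < +oo)%E ->
  exists2 f, L2 f & forall n, ip f (phi n) = c n.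
Proof.
move=> coo; pose F := combination c 0.
have cF e : 0 < e -> exists N, forall m n, (N <= m)%N -> (N <= n)%N ->
     ip (fun x => F m x - F n x) (fun x => F m x - F n x) <= e.
  move=> e0; have [N NP] := nneseries_tail_small (fun k => sqr_ge0 (c k)) coo e0.
  exists N.
  have H m n : (N <= m)%N -> (m <= n)%N ->
     ip (fun x => F n x - F m x) (fun x => F n x - F m x) <= e.
    move=> Nm mn; rewrite /F; under eq_fun do rewrite combinationB//.
    rewrite ip_combination_combination; under eq_bigr do rewrite -expr2.
    exact: NP.
  move=> m n Nm Nn; have [mn|/ltnW nm] := leqP m n; last exact: H.
  rewrite (le_trans _ (H _ _ Nm mn))// le_eqVlt; apply/orP; left; apply/eqP.
  by apply: eq_ip => x _; ring.
have [f Lf Ff] := L2_complete (L2_combination c 0) cF.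
exists f => // n; apply/eqP; rewrite -subr_eq0 -normr_le0.
apply/ler_addgt0Pl => e e0; rewrite addr0.
have [N NP] := Ff (e ^+ 2) (exprn_gt0 2 e0).
have := NP (maxn N n.+1) (leq_maxl _ _); set M := maxn _ _ => FM.
have LMf : L2 (fun x => F M x - f x) by apply: L2B => //; exact: L2_combination.
have -> : ip f (phi n) - c n = - ip (fun x => F M x - f x) (phi n).
  rewrite ipBl//; last exact: L2_combination.
  rewrite coef_combination leq0n leq_maxr /=; ring.
rewrite normrN -(ger0_norm (ltW e0)) -!sqrtr_sqr ler_wsqrtr//.
rewrite (le_trans (ip_CS LMf (Lphi n)))//.
by have [_ -> _] := bphi; rewrite eqxx mulr1.
Qed.

End basis.

Implicit Types (F G : R -> R[i]).

Lemma cmod_sq (z : R[i]) : cmod z ^+ 2 = complex.Re z ^+ 2 + complex.Im z ^+ 2.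
Proof. by case: z => a b; rewrite /cmod/= sqr_sqrtr// addr_ge0 ?sqr_ge0. Qed.

Lemma cmod_ge0 (z : R[i]) : 0 <= cmod z.
Proof. by case: z => a b; rewrite /cmod sqrtr_ge0. Qed.

Lemma cmodM (z w : R[i]) : cmod (z * w) = cmod z * cmod w.
Proof. exact: ComplexField.Normc.normcM. Qed.

Lemma cmodD (z w : R[i]) : cmod (z + w) <= cmod z + cmod w.
Proof. exact: (@le_normcD R z w). Qed.

Lemma cmodN (z : R[i]) : cmod (- z) = cmod z.
Proof. exact: (@normcN R z). Qed.

Lemma cmod0 : cmod (0 : R[i]) = 0.
Proof. exact: ComplexField.Normc.normc0. Qed.

Lemma cmodR (x : R) : cmod x%:C = `|x|.
Proof. by rewrite /cmod /= expr0n/= addr0 sqrtr_sqr. Qed.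

Lemma cmod_Re (z : R[i]) : `|complex.Re z| <= cmod z.
Proof. by rewrite -sqrtr_sqr; case: z => a b; rewrite ler_wsqrtr//= lerDl sqr_ge0. Qed.

Lemma cmod_Im (z : R[i]) : `|complex.Im z| <= cmod z.
Proof. by rewrite -sqrtr_sqr; case: z => a b; rewrite ler_wsqrtr//= lerDr sqr_ge0. Qed.

Lemma cmod_le (z : R[i]) : cmod z <= `|complex.Re z| + `|complex.Im z|.
Proof.
case: z => a b /=; rewrite /cmod/= -[leRHS]ger0_norm ?addr_ge0// -sqrtr_sqr ler_wsqrtr//.
rewrite sqrrD !real_normK ?num_real// [leRHS]addrAC lerDl.
by rewrite mulrn_wge0 ?mulr_ge0.
Qed.

Lemma cmod_eq0 (z : R[i]) : cmod z = 0 -> z = 0.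
Proof. exact: ComplexField.Normc.eq0_normc. Qed.

Notation re F := (fun x => complex.Re (F x)).
Notation im F := (fun x => complex.Im (F x)).

Definition normsq F : R := ip (re F) (re F) + ip (im F) (im F).

Lemma normsq_ge0 F : 0 <= normsq F.
Proof. by rewrite addr_ge0 ?ip_ge0. Qed.

Lemma L2_cmod F : inL2 F -> L2 (fun x => cmod (F x)).
Proof.
move=> [LR LI]; have [mR iR] := (L2P _).1 LR; have [mI iI] := (L2P _).1 LI.
apply/L2P; split; last first.
  under eq_fun do rewrite cmod_sq.
  by apply: integrD => //; exact: measurable_I01.
rewrite (_ : (fun _ => _) = (fun x => Num.sqrt (complex.Re (F x) ^+ 2 + complex.Im (F x) ^+ 2))).
  apply: measurableT_comp => //.
    by apply: continuous_measurable_fun; exact: sqrt_continuous.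
  by apply: measurable_funD; exact: measurable_funX.
by apply/funext => x; rewrite /cmod; case: (F x).
Qed.

Lemma L2normE F : inL2 F -> L2norm F = (Num.sqrt (normsq F))%:E.
Proof.
move=> LF; rewrite /L2norm Lpnorm2E; last exact: L2_cmod.
congr (Num.sqrt _)%:E; have [LR LI] := LF.
rewrite /normsq /ip -RintegralD//; [|exact: L2_mul..].
by apply: eq_Rintegral => x _; rewrite -!expr2 cmod_sq.
Qed.

Lemma coefE phi n F : coef phi n F = ip (re F) (phi n) +i* ip (im F) (phi n).
Proof.
rewrite /coef /pairing /cintegral /ip; congr (_ +i* _); apply: eq_Rintegral => x _;
  by rewrite /cfun; case: (F x) => a b /=; rewrite mulr0 ?subr0 ?add0r.
Qed.

(** The squared l^2 norm, with value +oo for sequences that are not square summable: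
    norms that may be infinite are compared by comparing series termwise. *)
Definition S2 (c : nat -> R[i]) : \bar R := (\sum_(0 <= n <oo) (cmod (c n) ^+ 2)%:E)%E.

Lemma S2_ge0 (c : nat -> R[i]) : (0 <= S2 c)%E.
Proof. by apply: nneseries_ge0 => n _ _; rewrite lee_fin sqr_ge0. Qed.

Lemma S2_split (c : nat -> R[i]) : S2 c = (\sum_(0 <= n <oo) (complex.Re (c n) ^+ 2)%:E +
  \sum_(0 <= n <oo) (complex.Im (c n) ^+ 2)%:E)%E.
Proof.
rewrite -nneseriesD//; last 2 first.
- by move=> n _; rewrite lee_fin sqr_ge0.
- by move=> n _; rewrite lee_fin sqr_ge0.
by apply: eq_eseriesr => n _; rewrite cmod_sq EFinD.
Qed.

Lemma le_S2 (c d : nat -> R[i]) (M : R) : (forall n, cmod (c n) <= M * cmod (d n)) ->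
  (S2 c <= (M ^+ 2)%:E * S2 d)%E.
Proof.
move=> cd; rewrite /S2 -nneseriesZl//; last by move=> n _; rewrite lee_fin sqr_ge0.
apply: lee_nneseries => n _; first by rewrite lee_fin sqr_ge0.
rewrite -EFinM lee_fin -exprMn -[leRHS]real_normK ?num_real//.
by rewrite lerXn2r ?nnegrE ?cmod_ge0// (le_trans (cd n))// ler_norm.
Qed.

Section complex_basis.
Variable phi : nat -> R -> R.
Hypothesis bphi : orthonormal_basis phi.

Lemma parsevalC F : inL2 F -> S2 (fun n => coef phi n F) = (normsq F)%:E.
Proof.
move=> [LR LI]; rewrite S2_split /normsq EFinD -(parseval bphi LR) -(parseval bphi LI).
by congr (_ + _)%E; apply: eq_eseriesr => n _; rewrite coefE.
Qed.

Lemma riesz_fischerC (c : nat -> R[i]) : (S2 c < +oo)%E ->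
  exists2 F, inL2 F & forall n, coef phi n F = c n.
Proof.
rewrite S2_split => h.
have sq0 (u : nat -> R) : (0 <= \sum_(0 <= n <oo) (u n ^+ 2)%:E)%E.
  by apply: nneseries_ge0 => n _ _; rewrite lee_fin sqr_ge0.
have [|f Lf fc] := riesz_fischer bphi (c := fun n => complex.Re (c n)).
  by apply: le_lt_trans h; rewrite leeDl.
have [|g Lg gc] := riesz_fischer bphi (c := fun n => complex.Im (c n)).
  by apply: le_lt_trans h; rewrite leeDr.
exists (fun x => f x +i* g x) => // n.
by rewrite coefE /= fc gc; case: (c n).
Qed.

End complex_basis.
End orthonormal_bases.

(** * The Green operator of the Dirichlet problem *)

Section operator.
Context {R : realType}.
Local Notation mu := (@lebesgue_measure R).
Local Notation integr D f := (mu.-integrable D (EFin \o f)).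
Local Notation L2 f := (inLp I01 2%:E f).
Local Notation re F := (fun x => complex.Re (F x)).
Local Notation im F := (fun x => complex.Im (F x)).
Implicit Types (f g h : R -> R).

Lemma I01_itv : I01 `<=` [set` `[0 : R, 1]].
Proof. by apply: subset_itvScc => //; rewrite bnd_simp. Qed.

Lemma integr_I01 f : integr `[0, 1] f -> integr I01 f.
Proof. apply: integrableS => //; exact: I01_itv. Qed.

Lemma Rintegral_I01 f : integr `[0, 1] f ->
  \int[mu]_(x in I01) f x = \int[mu]_(x in `[0, 1]) f x.
Proof.
move=> fi; rewrite /I01 Rintegral_itv_bndo_bndc; last exact: integr_I01.
rewrite Rintegral_itv_obnd_cbnd//; exact: integr_sub_oc fi.
Qed.

Lemma integr_restrict f : integr I01 f -> integr `[0, 1] (f \_ I01).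
Proof.
move=> fi; rewrite (_ : EFin \o _ = (EFin \o f) \_ I01); last exact/esym/restrict_EFin.
by apply/integrable_restrict => //; rewrite setIidr//; exact: I01_itv.
Qed.

Lemma ACr_L2 (F f : R -> R) : ACr 0 1 F f -> L2 F.
Proof.
move=> Ff; have mF := ACr_measurable ler01 Ff.
apply: (L2_dom _ (L2_cst (`|F 0| + norm_integral 0 f 1))).
  by apply: measurable_funS mF => //; exact: I01_itv.
apply: aeW => x /I01_itv/=; rewrite in_itv/= => /andP[x0 x1].
have := ACr_bounded Ff x0 x1 => b; rewrite -[leLHS]real_normK ?num_real//.
by rewrite lerXn2r ?nnegrE ?(le_trans _ b).
Qed.

Lemma ae_neq (c : R) : {ae mu, forall x, x != c}.
Proof.
exists [set c]; split => //; first exact: lebesgue_measure_set1.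
by move=> x /= /negP; rewrite negbK => /eqP.
Qed.

Lemma ae_eq_Rintegral_itv (x y : R) f g : integr `[x, y] f -> integr `[x, y] g ->
  {ae mu, forall t, x <= t -> t <= y -> f t = g t} ->
  \int[mu]_(t in `[x, y]) f t = \int[mu]_(t in `[x, y]) g t.
Proof.
move=> /integrableP[mf _] /integrableP[mg _] fg; rewrite /Rintegral; congr fine.
apply: ae_eq_integral => //.
by apply: aeS fg => t fg; rewrite /= in_itv/= => /andP[xt ty]; rewrite fg.
Qed.

(** The boundary value problem - y'' = h, y(0) = y(1) = 0 is solved by y = green h, with
    y' = dgreen h and y'(0) = slope h.  Extending h by zero makes it integrable on
    the closed interval. *)
Definition primitive h x := \int[mu]_(t in `[0, x]) (h \_ I01) t.
Definition slope h := \int[mu]_(t in `[0, 1]) primitive h t.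
Definition dgreen h x := slope h - primitive h x.
Definition green h x := \int[mu]_(t in `[0, x]) dgreen h t.

Lemma ACr_primitive h : integr I01 h -> ACr 0 1 (primitive h) (h \_ I01).
Proof.
move=> hi; split; first exact: integr_restrict.
by move=> x _ _; rewrite /primitive set_itv1 Rintegral_set1 add0r.
Qed.

Lemma ACr_integr (F f : R -> R) : ACr 0 1 F f -> integr `[0, 1] F.
Proof.
move=> Ff.
have i1 : integr `[0, 1] (fun=> 1 : R).
  apply/integrableP; split; first exact/measurable_EFinP.
  rewrite (eq_integral (cst 1%E)); last by move=> x _ /=; rewrite normr1.
  by rewrite integral_cst// mul1e /= lebesgue_measure_itv/= lte_fin ltr01 oppr0 adde0 ltry.
have := integrable_bounded_mul (M := `|F 0| + norm_integral 0 f 1) _ i1 (ACr_measurable ler01 Ff).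
rewrite (_ : (fun x => 1 * F x) = F); last by apply/funext => x; rewrite mul1r.
apply => //.
by move=> x /=; rewrite in_itv/= => /andP[]; exact: ACr_bounded.
Qed.

Lemma primitive_integr h : integr I01 h -> integr `[0, 1] (primitive h).
Proof. by move=> /ACr_primitive; exact: ACr_integr. Qed.

Lemma ACr_dgreen h : integr I01 h -> ACr 0 1 (dgreen h) (fun x => - (h \_ I01) x).
Proof.
move=> hi; split.
  have := integrZl (-1) (measurable_itv _) (integr_restrict hi).
  by rewrite (_ : (fun x => -1 * _ x) = (fun x => - (h \_ I01) x))//; apply/funext => x; rewrite mulN1r.
move=> x x0 x1; rewrite /dgreen /primitive set_itv1 Rintegral_set1 subr0; congr (_ + _).
under [RHS]eq_Rintegral do rewrite -mulN1r.
rewrite RintegralZl ?mulN1r//.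
by apply: integr_sub (integr_restrict hi).
Qed.

Lemma ACr_green h : integr I01 h -> ACr 0 1 (green h) (dgreen h).
Proof.
move=> hi; split; first exact: ACr_integr (ACr_dgreen hi).
by move=> x _ _; rewrite /green set_itv1 Rintegral_set1 add0r.
Qed.

Lemma green0 h : green h 0 = 0.
Proof. by rewrite /green set_itv1 Rintegral_set1. Qed.

Lemma integr01_cst (c : R) : integr `[0, 1] (fun=> c).
Proof.
have : ACr 0 1 (fun=> c) (fun=> 0).
  split; last by move=> x _ _; rewrite Rintegral_cst// mul0r addr0.
  by apply/integrableP; split; [exact/measurable_EFinP|
    under eq_integral do rewrite /= normr0; rewrite integral0 ltry].
exact: ACr_integr.
Qed.

Lemma measure_itv01 : mu `[0 : R, 1]%classic = 1%E.
Proof. by rewrite lebesgue_measure_itv/= lte_fin ltr01 oppr0 adde0. Qed.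

Lemma green1 h : integr I01 h -> green h 1 = 0.
Proof.
move=> hi; rewrite /green /dgreen RintegralB//; [|exact: integr01_cst|exact: primitive_integr].
by rewrite Rintegral_cst// [X in fine X]measure_itv01 mulr1 subrr.
Qed.

Lemma primitiveZD (a b : R) h h' x : integr I01 h -> integr I01 h' -> x <= 1 ->
  primitive (fun t => a * h t + b * h' t) x = a * primitive h x + b * primitive h' x.
Proof.
move=> hi hi' x1.
have i1 := integr_sub (lexx 0) x1 (integr_restrict hi).
have i2 := integr_sub (lexx 0) x1 (integr_restrict hi').
rewrite /primitive -!RintegralZl// -RintegralD//; [|exact: integrZl..].
apply: eq_Rintegral => t _; rewrite !patchE.
by case: ifP => // _; rewrite !mulr0 addr0.
Qed.

Lemma slopeZD (a b : R) h h' : integr I01 h -> integr I01 h' ->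
  slope (fun t => a * h t + b * h' t) = a * slope h + b * slope h'.
Proof.
move=> hi hi'; have p1 := primitive_integr hi; have p2 := primitive_integr hi'.
rewrite /slope -!RintegralZl// -RintegralD//; [|exact: integrZl..].
by apply: eq_Rintegral => t; rewrite inE/= in_itv/= => /andP[_]; exact: primitiveZD.
Qed.

Lemma dgreenZD (a b : R) h h' x : integr I01 h -> integr I01 h' -> x <= 1 ->
  dgreen (fun t => a * h t + b * h' t) x = a * dgreen h x + b * dgreen h' x.
Proof. by move=> hi hi' x1; rewrite /dgreen slopeZD// primitiveZD//; ring. Qed.

Lemma greenZD (a b : R) h h' x : integr I01 h -> integr I01 h' -> x <= 1 ->
  green (fun t => a * h t + b * h' t) x = a * green h x + b * green h' x.
Proof.
move=> hi hi' x1.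
have p1 := integr_sub (lexx 0) x1 (ACr_integr (ACr_dgreen hi)).
have p2 := integr_sub (lexx 0) x1 (ACr_integr (ACr_dgreen hi')).
rewrite /green -!RintegralZl// -RintegralD//; [|exact: integrZl..].
apply: eq_Rintegral => t; rewrite inE/= in_itv/= => /andP[_ tx].
by rewrite dgreenZD// (le_trans tx).
Qed.

(** The L^1 norm on the unit interval is at most the L^2 norm. *)
Lemma abs_integral_itv_le f x : L2 f -> integr `[0, 1] f -> 0 <= x -> x <= 1 ->
  `|\int[mu]_(t in `[0, x]) f t| <= Num.sqrt (ip f f).
Proof.
move=> Lf fi x0 x1.
apply: (@le_trans _ _ (norm_integral 0 f x)).
  by apply: le_normr_Rintegral => //; exact: integr_sub fi.
apply: (le_trans (norm_integral_homo fi x0 x1 (lexx _))).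
rewrite /norm_integral -Rintegral_I01; last exact: integr_norm.
rewrite -lee_fin; apply: le_trans (integral_norm_le Lf).
rewrite /Rintegral fineK//; apply: integrable_fin_num => //.
by have /integrable_abse := L2_integrable Lf.
Qed.

Lemma ip_restrict f g : ip (f \_ I01) (g \_ I01) = ip f g.
Proof. by apply: eq_ip => x xI; rewrite !patchE mem_set. Qed.

Lemma L2_restrict f : L2 f -> L2 (f \_ I01).
Proof.
move=> Lf; apply: (L2_dom _ Lf).
  by apply/measurable_restrict => //; rewrite setIid; exact: L2_measurable.
by apply: aeW => x xI; rewrite patchE mem_set.
Qed.

Lemma primitive_le h x : L2 h -> 0 <= x -> x <= 1 -> `|primitive h x| <= Num.sqrt (ip h h).
Proof.
move=> Lh x0 x1; rewrite -ip_restrict; apply: abs_integral_itv_le => //.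
  exact: L2_restrict.
exact/integr_restrict/L2_integrable.
Qed.

Lemma abs_integral_le_sup f (M x : R) : integr `[0, 1] f -> 0 <= x -> x <= 1 -> 0 <= M ->
  (forall t, 0 <= t -> t <= 1 -> `|f t| <= M) ->
  `|\int[mu]_(t in `[0, x]) f t| <= M.
Proof.
move=> fi x0 x1 M0 fM.
have fx : integr `[0, x] f by exact: integr_sub fi.
apply: (le_trans (le_normr_Rintegral _ fx)) => //.
apply: (@le_trans _ _ (\int[mu]_(t in `[0, x]) M)).
  apply: le_Rintegral => //; first exact: integr_norm.
    by apply: integr_sub (integr01_cst M).
  by move=> t /=; rewrite in_itv/= => /andP[t0 tx]; rewrite fM// (le_trans tx).
rewrite Rintegral_cst// ler_piMr// [X in fine X]lebesgue_measure_itv/= lte_fin.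
by case: ifPn; rewrite // oppr0 adde0.
Qed.

Lemma dgreen_le h x : L2 h -> 0 <= x -> x <= 1 -> `|dgreen h x| <= 2 * Num.sqrt (ip h h).
Proof.
move=> Lh x0 x1; rewrite (le_trans (ler_normB _ _))// mulr_natl mulr2n lerD ?primitive_le//.
rewrite /slope; apply: abs_integral_le_sup => //; last by move=> t t0 t1; exact: primitive_le.
exact/primitive_integr/L2_integrable.
Qed.

Lemma green_le h x : L2 h -> 0 <= x -> x <= 1 -> `|green h x| <= 2 * Num.sqrt (ip h h).
Proof.
move=> Lh x0 x1; rewrite /green; apply: abs_integral_le_sup => //.
- exact: ACr_integr (ACr_dgreen (L2_integrable Lh)).
- by move=> t t0 t1; exact: dgreen_le.
Qed.

(** Cauchy-Schwarz for y(x), the integral of y' over [0, x]. *)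
Lemma green_poincare h x : L2 h -> 0 <= x -> x <= 1 ->
  green h x ^+ 2 <= ip (dgreen h) (dgreen h).
Proof.
move=> Lh x0 x1; have dA := ACr_dgreen (L2_integrable Lh).
have := abs_integral_itv_le (ACr_L2 dA) (ACr_integr dA) x0 x1.
rewrite -/(green h x) => gh; rewrite -[leLHS]real_normK ?num_real//.
by rewrite -[leRHS]sqr_sqrtr ?ip_ge0// lerXn2r ?nnegrE ?sqrtr_ge0.
Qed.

Lemma ip_le_sup f (M : R) : L2 f -> (forall x, I01 x -> f x ^+ 2 <= M) -> ip f f <= M.
Proof.
move=> Lf fM; have -> : M = \int[mu]_(x in I01) (M * 1).
  by rewrite Rintegral_cst// [X in fine X]measure_I01 !mulr1.
apply: le_Rintegral => //; first exact: L2_mul.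
  by apply: L2_mul; exact: L2_cst.
by move=> x xI; rewrite -expr2 mulr1 fM.
Qed.

(** Integration by parts of y'' against green h', which vanishes at both ends. *)
Lemma ip_dirichlet h h' : L2 h -> L2 h' -> ip h (green h') = ip (dgreen h) (dgreen h').
Proof.
move=> Lh Lh'.
have [hi hi'] := (L2_integrable Lh, L2_integrable Lh').
have dA := ACr_dgreen hi; have gA := ACr_green hi'.
have := ACr_parts ler01 dA gA; rewrite green1// green0 !mulr0 subr0.
have i1 : integr `[0, 1] (fun t => - (h \_ I01) t * green h' t).
  exact: ACr_mul_integrable dA gA.
have i2 : integr `[0, 1] (fun t => dgreen h t * dgreen h' t).
  have := ACr_mul_integrable ler01 gA dA.
  by rewrite (_ : (fun t => _) = (fun t => dgreen h t * dgreen h' t))//; apply/funext => t; rewrite mulrC.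
rewrite RintegralD// -!Rintegral_I01// => /eqP; rewrite addrC addr_eq0 => /eqP.
rewrite -/(ip (dgreen h) (dgreen h')) => ->.
rewrite -[RHS]mulN1r -RintegralZl//; last exact: integr_I01.
by apply: eq_Rintegral => x xI; rewrite patchE xI; ring.
Qed.

End operator.

(** * The Dirichlet operator with a bounded potential *)

Section schroedinger_operator.
Context {R : realType}.
Local Notation mu := (@lebesgue_measure R).
Local Notation integr D f := (mu.-integrable D (EFin \o f)).
Local Notation L2 f := (inLp I01 2%:E f).
Local Notation re F := (fun x => complex.Re (F x)).
Local Notation im F := (fun x => complex.Im (F x)).
Implicit Types (f g h : R -> R).

Lemma AC_derivP (a b : R) (F G : R -> R[i]) : a <= b ->
  AC_deriv a b F G <-> ACr a b (re F) (re G) /\ ACr a b (im F) (im G).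
Proof.
move=> ab; split.
  move=> [Gr Gi FG]; split; split; rewrite ?inLp1P//; try exact/inLp1P.
    by move=> x ax xb; rewrite (FG x)// ?in_itv/= ?ax//; case: (F a).
  by move=> x ax xb; rewrite (FG x)// ?in_itv/= ?ax//; case: (F a).
move=> [[Gr FGr] [Gi FGi]]; split; try exact/inLp1P.
move=> x; rewrite in_itv/= => /andP[ax xb]; apply/eqP.
rewrite eq_complex (FGr x)// (FGi x)//; apply/andP; split; apply/eqP;
  by case: (F a).
Qed.

Definition essbounded (D : set R) (q : R -> R) (M : R) :=
  [/\ measurable_fun D q, 0 <= M & {ae mu, forall x, D x -> `|q x| <= M}].

Lemma inLoo_essbounded (D : set (measurableTypeR R)) (q : R -> R) : measurable D ->
  inLp D +oo%E q -> exists2 M, essbounded D q M & Lpnorm D +oo%E q = M%:E.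
Proof.
move=> mD qoo; have := qoo; rewrite /inLp inE => /andP[]; rewrite inE/= => mq.
rewrite inE/= /finite_norm => fin.
have L0 : (0 <= Lpnorm D +oo%E q)%E by exact: Lnorm_ge0.
have LE : Lpnorm D +oo%E q = (fine (Lpnorm D +oo%E q))%:E.
  by rewrite fineK// ge0_fin_numE.
exists (fine (Lpnorm D +oo%E q)) => //; split.
- exact/(measurable_restrictT _ _).2.
- exact: fine_ge0.
- have := LE; rewrite {1}/Lpnorm unlock.
  have -> : (0 < leb [set: R])%E.
    apply: (@lt_le_trans _ _ (mu I01)); first by rewrite [ltRHS]measure_I01.
    by apply: le_measure => //; rewrite inE//; exact: measurable_I01.
  move=> es; have := ess_sup_ge leb (abse \o (EFin \o (q \_ D))).
  by rewrite es; apply: aeS => x /=; rewrite patchE lee_fin => + xI; rewrite mem_set.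
Qed.

Section fixed_potential.
Variables (q : R -> R) (M : R).
Hypothesis qM : essbounded I01 q M.

Let mq : measurable_fun I01 q. Proof. by case: qM. Qed.
Let M0 : 0 <= M. Proof. by case: qM. Qed.
Let qle : {ae mu, forall x, I01 x -> `|q x| <= M}. Proof. by case: qM. Qed.

Lemma L2q f : L2 f -> L2 (fun x => q x * f x).
Proof.
move=> Lf; apply: (L2_dom _ (L2Z M Lf)).
  by apply: measurable_funM => //; exact: L2_measurable.
apply: aeS qle => x qx xI; rewrite !exprMn ler_wpM2r ?sqr_ge0//.
by rewrite -[leLHS]real_normK ?num_real// lerXn2r ?nnegrE// qx.
Qed.

Lemma ip_qq f : L2 f -> ip (fun x => q x * f x) (fun x => q x * f x) <= M ^+ 2 * ip f f.
Proof.
move=> Lf; have Lqf := L2q Lf.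
have LMf := L2Z M Lf.
have -> : M ^+ 2 * ip f f = ip (fun x => M * f x) (fun x => M * f x).
  by rewrite ipZl// ipZr// expr2 mulrA.
rewrite -lee_fin !EFin_ip//; apply: ae_ge0_le_integral => //.
- by move=> x _; rewrite lee_fin -expr2 sqr_ge0.
- by apply/measurable_EFinP/measurable_funM; exact: L2_measurable.
- by move=> x _; rewrite lee_fin -expr2 sqr_ge0.
- by apply/measurable_EFinP/measurable_funM; exact: L2_measurable.
apply: aeS qle => x qx xI; rewrite lee_fin -!expr2 !exprMn ler_wpM2r ?sqr_ge0//.
by rewrite -[leLHS]real_normK ?num_real// lerXn2r ?nnegrE// qx.
Qed.

(** If L f = g, then - f'' is source f g. *)
Definition source f g x := g x - q x * f x.

Lemma L2_source f g : L2 f -> L2 g -> L2 (source f g).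
Proof. by move=> Lf Lg; apply: L2B => //; exact: L2q. Qed.

(** L f = g for real functions, in integrated form: the derivatives are hidden in the
    Green operator, which makes the relation stable under limits in L^2. *)
Definition isLr f g := [/\ L2 f, L2 g & f = green (source f g) %[ae mu in I01]].

(** Integrating y'' = q y - g twice gives y up to the value of y'(0), which the
    condition y(1) = 0 fixes to be slope (source f g). *)
Lemma isLr_green f g y y1 y2 : L2 f -> L2 g -> f = y %[ae mu in I01] ->
  ACr 0 1 y y1 -> ACr 0 1 y1 y2 -> y 0 = 0 -> y 1 = 0 ->
  g = (fun x => - y2 x + q x * y x) %[ae mu in I01] -> isLr f g.
Proof.
move=> Lf Lg fy yA y1A y00 y10 gy; split => //.
have fy' := fy.
apply: aeS fy => x fy /[dup] xI /I01_itv/=; rewrite in_itv/= => /andP[x0 x1].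
rewrite fy//.
have si : integr I01 (source f g) by apply: L2_integrable; exact: L2_source.
have y1E t : 0 <= t -> t <= 1 -> y1 t = y1 0 - primitive (source f g) t.
  move=> t0 t1; rewrite (y1A.2 t t0 t1); congr (_ + _).
  rewrite -[RHS]mulN1r /primitive -RintegralZl//; last by apply: integr_sub (integr_restrict si).
  apply: ae_eq_Rintegral_itv.
  - by apply: integr_sub y1A.1.
  - apply: integrZl => //; by apply: integr_sub (integr_restrict si).
  - have y2E : {ae mu, forall u, I01 u -> y2 u = - source f g u}.
      by apply: aeI fy' gy => u fyu gyu uI; rewrite /source fyu// gyu//; ring.
    have uI : {ae mu, forall u, 0 <= u -> u <= 1 -> I01 u}.
      apply: aeI (ae_neq 0) (ae_neq 1) => u u0 u1 lu0 lu1.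
      by rewrite /I01/= in_itv/= !lt_neqAle eq_sym u0 u1 lu0.
    apply: aeI y2E uI => u y2u uI u0 ut; have {}uI := uI u0 (le_trans ut t1).
    by rewrite patchE mem_set// y2u// mulN1r.
have yE t : 0 <= t -> t <= 1 -> y t = \int[mu]_(u in `[0, t]) (y1 0 - primitive (source f g) u).
  move=> t0 t1; rewrite (yA.2 t t0 t1) y00 add0r.
  apply: eq_Rintegral => u; rewrite inE/= in_itv/= => /andP[u0 ut].
  by rewrite y1E// (le_trans ut).
have : y1 0 = slope (source f g).
  have := yE 1 ler01 (lexx _); rewrite y10 RintegralB//; [|exact: integr01_cst|exact: primitive_integr].
  rewrite Rintegral_cst// [X in fine X]measure_itv01 mulr1 => /esym/eqP.
  by rewrite subr_eq0 => /eqP.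
by move=> s; rewrite yE// s.
Qed.

Lemma isLP (F G : R -> R[i]) : isL q F G <-> isLr (re F) (re G) /\ isLr (im F) (im G).
Proof.
split.
  move=> [[FR FI] [GR GI] [y [y1 [y2 [Fy [/AC_derivP yA /AC_derivP y1A] [y00 y10] Gy]]]]].
  have [yAr yAi] := yA ler01; have [y1Ar y1Ai] := y1A ler01.
  split; [apply: isLr_green yAr y1Ar _ _ _ | apply: isLr_green yAi y1Ai _ _ _] => //.
  - by apply: aeS Fy => x Fy xI; rewrite Fy.
  - by rewrite y00.
  - by rewrite y10.
  - apply: aeS Gy => x Gy xI; rewrite Gy//; case: (y x) (y2 x) => a b [c d] /=; ring.
  - by apply: aeS Fy => x Fy xI; rewrite Fy.
  - by rewrite y00.
  - by rewrite y10.
  - apply: aeS Gy => x Gy xI; rewrite Gy//; case: (y x) (y2 x) => a b [c d] /=; ring.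
move=> [[FR GR Fr] [FI GI Fi]].
have hr := L2_integrable (L2_source FR GR); have hi := L2_integrable (L2_source FI GI).
have [gr1 gr2] := (ACr_green hr, ACr_dgreen hr).
have [gi1 gi2] := (ACr_green hi, ACr_dgreen hi).
split=> //.
exists (fun x => green (source (re F) (re G)) x +i* green (source (im F) (im G)) x),
  (fun x => dgreen (source (re F) (re G)) x +i* dgreen (source (im F) (im G)) x),
  (fun x => (- (source (re F) (re G) \_ I01) x) +i* (- (source (im F) (im G) \_ I01) x)).
split => //.
- apply: aeI Fr Fi => x Fr Fi xI; rewrite -Fr// -Fi//; by case: (F x).
- split; apply: (AC_derivP _ _ ler01).2; [exact: (conj gr1 gi1)|exact: (conj gr2 gi2)].
- by rewrite !green0 !green1.
- apply: aeI Fr Fi => x Fr Fi xI; rewrite -Fr// -Fi// !patchE mem_set// /source /=.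
  case: (F x) (G x) => a b [c d] /=; apply/eqP; rewrite eq_complex /=.
  by apply/andP; split; apply/eqP; ring.
Qed.

Lemma isLr_lin (a b : R) f g f' g' : isLr f g -> isLr f' g' ->
  isLr (fun x => a * f x + b * f' x) (fun x => a * g x + b * g' x).
Proof.
move=> [Lf Lg fE] [Lf' Lg' fE']; split; [by apply: L2D; exact: L2Z..|].
apply: aeI fE fE' => x fE fE' /[dup] xI /I01_itv/=; rewrite in_itv/= => /andP[_ x1].
have hs := L2_integrable (L2_source Lf Lg); have hs' := L2_integrable (L2_source Lf' Lg').
rewrite (fE xI) (fE' xI) -(greenZD a b hs hs' x1); congr (green _ x).
by apply/funext => t; rewrite /source; ring.
Qed.

Lemma L2_green h : L2 h -> L2 (green h).
Proof. by move=> /L2_integrable/ACr_green/ACr_L2. Qed.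

Lemma L2_dgreen h : L2 h -> L2 (dgreen h).
Proof. by move=> /L2_integrable/ACr_dgreen/ACr_L2. Qed.

(** The bilinear form of L. *)
Lemma isLr_form f g f' g' : isLr f g -> isLr f' g' ->
  ip g f' = ip (dgreen (source f g)) (dgreen (source f' g')) + ip (fun x => q x * f x) f'.
Proof.
move=> [Lf Lg fE] [Lf' Lg' fE'].
have Ls := L2_source Lf Lg; have Ls' := L2_source Lf' Lg'.
rewrite -ip_dirichlet// (ipC _ (green _)) -(ip_ae_eq _ _ _ fE')//; last exact: L2_green.
rewrite (ipC f') -ipDl//; last exact: L2q.
by apply: eq_ip => x _; rewrite /source subrK.
Qed.

Lemma isLr_sym f g f' g' : isLr f g -> isLr f' g' -> ip g f' = ip f g'.
Proof.
move=> fg fg'; rewrite (isLr_form fg fg') (ipC f) (isLr_form fg' fg) (ipC (dgreen _)).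
by congr (_ + _); apply: eq_ip => x _; ring.
Qed.

Lemma ipD_le f g : L2 f -> L2 g ->
  ip (fun x => f x + g x) (fun x => f x + g x) <= 2 * (ip f f + ip g g).
Proof.
move=> Lf Lg; have LD := L2D Lf Lg; have LB := L2B Lf Lg.
have := ip_ge0 (fun x => f x - g x).
rewrite ipBl ?ipBr// ipDl// !ipDr// (ipC g f); lra.
Qed.

(** Multiplication by q is bounded on L^2 and green is bounded from L^2 to the bounded
    functions, so both sides of f = green (g - q f) pass to the limit. *)
Lemma isLr_closed f g : L2 f -> L2 g ->
  (forall e, 0 < e -> exists f' g', [/\ isLr f' g',
     ip (fun x => f' x - f x) (fun x => f' x - f x) <= e &
     ip (fun x => g' x - g x) (fun x => g' x - g x) <= e]) ->
  isLr f g.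
Proof.
move=> Lf Lg H; split => //.
have Ls := L2_source Lf Lg; have Lgs := L2_green Ls.
apply: ip_sub_eq0 => //; apply/eqP; rewrite -normr_le0; apply/ler_addgt0Pl => e e0.
rewrite addr0 ger0_norm ?ip_ge0//.
(* 4 is the square of the norm of green in green_le; each 2 comes from the square of a
   sum of two terms, and M bounds q *)
pose c := 2 * (1 + 4 * (2 * (1 + M ^+ 2))).
have c0 : 0 < c by rewrite /c; have := sqr_ge0 M; nra.
have [f' [g' [[Lf' Lg' fE'] fe ge]]] := H (e / c) (divr_gt0 e0 c0).
have Ls' := L2_source Lf' Lg'; have Lgs' := L2_green Ls'.
have Ld : L2 (fun x => f x - f' x) by exact: L2B.
have Ldg : L2 (fun x => green (source f' g') x - green (source f g) x) by exact: L2B.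
rewrite (_ : ip _ _ = ip (fun x => (f x - f' x) + (green (source f' g') x - green (source f g) x))
   (fun x => (f x - f' x) + (green (source f' g') x - green (source f g) x))); last first.
  have Lx : L2 (fun x => f x - green (source f g) x) by exact: L2B.
  have Ly : L2 (fun x => (f x - f' x) + (green (source f' g') x - green (source f g) x)) by exact: L2D.
  have E : (fun x => f x - green (source f g) x) = (fun x => (f x - f' x) + (green (source f' g') x - green (source f g) x)) %[ae mu in I01].
    by apply: aeS fE' => x fE' xI; rewrite (fE' xI) addrA subrK.
  by rewrite (ip_ae_eq _ _ _ E)// ipC (ip_ae_eq _ _ _ E).
apply: (le_trans (ipD_le Ld Ldg)).
have sE : (fun t => source f' g' t - source f g t) =
    (fun t => (g' t - g t) + - 1 * (q t * (f' t - f t))).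
  by apply/funext => t; rewrite /source; ring.
have Lfd : L2 (fun x => f' x - f x) by exact: L2B.
have Lgd : L2 (fun x => g' x - g x) by exact: L2B.
have Lqfd : L2 (fun x => q x * (f' x - f x)) by exact: L2q.
have sle : ip (fun t => source f' g' t - source f g t) (fun t => source f' g' t - source f g t) <=
    2 * (1 + M ^+ 2) * (e / c).
  rewrite sE (le_trans (ipD_le Lgd (L2Z _ Lqfd)))// -mulrA ler_pM2l// mulrDl mul1r lerD//.
  rewrite ipZl//; last exact: L2Z.
  by rewrite ipZr// mulrA mulrNN !mul1r (le_trans (ip_qq Lfd))// ler_wpM2l// sqr_ge0.
have gle : ip (fun x => green (source f' g') x - green (source f g) x)
    (fun x => green (source f' g') x - green (source f g) x) <= 4 * (2 * (1 + M ^+ 2) * (e / c)).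
  apply: ip_le_sup => // x /I01_itv/=; rewrite in_itv/= => /andP[x0 x1].
  have LB := L2B Ls' Ls.
  have -> : green (source f' g') x - green (source f g) x =
      green (fun t => source f' g' t - source f g t) x.
    rewrite (_ : (fun t => source f' g' t - source f g t) =
      (fun t => 1 * source f' g' t + (-1) * source f g t)); last first.
      by apply/funext => t; ring.
    by rewrite (greenZD _ _ (L2_integrable Ls') (L2_integrable Ls) x1) mul1r mulN1r.
  have := green_le LB x0 x1 => gl.
  apply: (@le_trans _ _ (4 * ip (fun t => source f' g' t - source f g t)
     (fun t => source f' g' t - source f g t))); last by rewrite ler_pM2l//; exact: sle.
  rewrite -[leLHS]real_normK ?num_real// -[X in _ * X]sqr_sqrtr ?ip_ge0//.
  rewrite (_ : 4 * _ ^+ 2 = (2 * Num.sqrt (ip (fun t => source f' g' t - source f g t)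
     (fun t => source f' g' t - source f g t))) ^+ 2); last by ring.
  by rewrite lerXn2r ?nnegrE// mulr_ge0// sqrtr_ge0.
have fle : ip (fun x => f x - f' x) (fun x => f x - f' x) <= e / c.
  by rewrite (le_trans _ fe)// le_eqVlt; apply/orP; left; apply/eqP/eq_ip => x _; ring.
apply: (@le_trans _ _ (2 * (e / c + 4 * (2 * (1 + M ^+ 2) * (e / c))))).
  by rewrite ler_pM2l// lerD.
rewrite (_ : 2 * _ = e)//; rewrite /c; field.
by rewrite gt_eqF//; have := sqr_ge0 M; nra.
Qed.

Hypothesis q0 : {ae mu, forall x, I01 x -> 0 <= q x}.

Lemma ip_q_ge0 f : L2 f -> 0 <= ip (fun x => q x * f x) f.
Proof.
move=> Lf; have Lq := L2q Lf.
have E : (fun x => q x * f x) = (fun x => `|q x| * f x) %[ae mu in I01].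
  by apply: aeS q0 => x qx xI; rewrite ger0_norm// qx.
rewrite (ip_ae_eq _ _ _ E)//; last first.
  apply: L2_ae E => //; apply: measurable_funM; last exact: L2_measurable.
  exact: measurableT_comp.
by apply: Rintegral_ge0 => x _; rewrite -mulrA mulr_ge0// -expr2 sqr_ge0.
Qed.

Lemma isLr_energy f g : isLr f g ->
  ip (dgreen (source f g)) (dgreen (source f g)) <= ip g f.
Proof. by move=> fg; rewrite (isLr_form fg fg) lerDl; case: fg => Lf _ _; exact: ip_q_ge0. Qed.

(** For the eigenfunctions this is lam_n >= 1. *)
Lemma isLr_poincare f g : isLr f g -> ip f f <= ip g f.
Proof.
move=> fg; apply: le_trans (isLr_energy fg); have [Lf Lg fE] := fg.
have Ls := L2_source Lf Lg; have Lgs := L2_green Ls.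
rewrite (ip_ae_eq _ _ _ fE)// ipC (ip_ae_eq _ _ _ fE)//.
apply: ip_le_sup => // x /I01_itv/=; rewrite in_itv/= => /andP[x0 x1].
exact: green_poincare.
Qed.

End fixed_potential.
End schroedinger_operator.

(** * Eigenfunction expansions, test functions and multipliers *)

Section complex_L2.
Context {R : realType}.
Local Notation mu := (@lebesgue_measure R).
Local Notation L2 f := (inLp I01 2%:E f).
Local Notation re F := (fun x => complex.Re (F x)).
Local Notation im F := (fun x => complex.Im (F x)).
Implicit Types (F G : R -> R[i]) (phi : nat -> R -> R).

Lemma Re_lin (a b : R) (z w : R[i]) : complex.Re ((a +i* b) * z + w) =
  (a * complex.Re z + (- b) * complex.Im z) + complex.Re w.
Proof. by case: z w => u v [y z] /=; rewrite mulNr. Qed.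

Lemma Im_lin (a b : R) (z w : R[i]) : complex.Im ((a +i* b) * z + w) =
  (a * complex.Im z + b * complex.Re z) + complex.Im w.
Proof. by case: z w => u v [y z]. Qed.

Lemma inL2_lin (c : R[i]) F G : inL2 F -> inL2 G -> inL2 (fun x => c * F x + G x).
Proof.
case: c => a b [Fr Fi] [Gr Gi]; split.
  under eq_fun do rewrite Re_lin.
  by apply: L2D => //; apply: L2D; exact: L2Z.
under eq_fun do rewrite Im_lin.
by apply: L2D => //; apply: L2D; exact: L2Z.
Qed.

Lemma coef_lin phi n (c : R[i]) F G : (forall n, L2 (phi n)) -> inL2 F -> inL2 G ->
  coef phi n (fun x => c * F x + G x) = c * coef phi n F + coef phi n G.
Proof.
move=> Lphi [Fr Fi] [Gr Gi]; rewrite !coefE; case: c => a b.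
have -> : (fun x => complex.Re ((a +i* b) * F x + G x)) =
  (fun x => (a * complex.Re (F x) + (- b) * complex.Im (F x)) + complex.Re (G x)).
  by apply/funext => x; exact: Re_lin.
have -> : (fun x => complex.Im ((a +i* b) * F x + G x)) =
  (fun x => (a * complex.Im (F x) + b * complex.Re (F x)) + complex.Im (G x)).
  by apply/funext => x; exact: Im_lin.
have LZ1 := L2Z a Fr; have LZ2 := L2Z (- b) Fi; have LZ3 := L2Z a Fi; have LZ4 := L2Z b Fr.
rewrite (ipDl (L2D LZ1 LZ2) Gr (Lphi n)) (ipDl LZ1 LZ2 (Lphi n)).
rewrite (ipDl (L2D LZ3 LZ4) Gi (Lphi n)) (ipDl LZ3 LZ4 (Lphi n)).
rewrite (ipZl a Fr (Lphi n)) (ipZl (- b) Fi (Lphi n)) (ipZl a Fi (Lphi n)) (ipZl b Fr (Lphi n)).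
by rewrite mulNr.
Qed.

Lemma cfun_inL2 (f : R -> R) : L2 f -> inL2 (cfun f).
Proof. by move=> Lf; split => //; exact: L2_cst. Qed.

Lemma ip0l (f : R -> R) : ip (fun=> 0) f = 0.
Proof. by rewrite /ip; under eq_Rintegral do rewrite mul0r; rewrite Rintegral_cst// mul0r. Qed.

Lemma coef_cfun phi n (f : R -> R) : coef phi n (cfun f) = (ip f (phi n))%:C.
Proof. by rewrite coefE /= ip0l. Qed.

Lemma normsq_cfun (f : R -> R) : normsq (cfun f) = ip f f.
Proof. by rewrite /normsq /= ip0l addr0. Qed.

Lemma sum_cfun (c : nat -> R) (u : nat -> R -> R) N x :
  \sum_(n < N) (c n)%:C * (u n x)%:C = (\sum_(0 <= n < N) c n * u n x)%:C.
Proof.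
rewrite big_mkord; elim/big_rec2: _ => [|i y z _ ->]//.
by rewrite !rmorphD rmorphM.
Qed.

End complex_L2.

Section eigenexpansion.
Context {R : realType}.
Local Notation mu := (@lebesgue_measure R).
Local Notation L2 f := (inLp I01 2%:E f).
Local Notation re F := (fun x => complex.Re (F x)).
Local Notation im F := (fun x => complex.Im (F x)).
Variables (q : R -> R) (M : R) (lam : nat -> R) (phi : nat -> R -> R).

Definition eigensystem := [/\ essbounded I01 q M, {ae mu, forall x, I01 x -> 0 <= q x} &
  eigenbasis q lam phi].
Hypothesis sys : eigensystem.
Implicit Types (F G : R -> R[i]) (b : nat -> R[i]) (f g : R -> R).

Let qM : essbounded I01 q M. Proof. by case: sys. Qed.
Let q0 : {ae mu, forall x, I01 x -> 0 <= q x}. Proof. by case: sys. Qed.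

Lemma isLr_phi n : isLr q (phi n) (fun x => lam n * phi n x).
Proof.
have [_ _ [/(_ n) /(isLP qM)[h _] _ _]] := sys; move: h.
have -> : (fun x => complex.Re ((lam n)%:C * (phi n x)%:C)) = (fun x => lam n * phi n x).
  by apply/funext => x /=; rewrite mulr0 subr0.
exact.
Qed.

Lemma L2_phi n : L2 (phi n). Proof. by case: (isLr_phi n). Qed.

(** The expansion of a real function has real coefficients, so that completeness for
    complex functions gives it for real ones. *)
Lemma orthonormal_phi : orthonormal_basis phi.
Proof.
case: sys => _ _ [_ orth compl]; split; first exact: L2_phi.
  move=> m n; have := orth m n; rewrite coef_cfun ipC => /(congr1 (@complex.Re R)) /= ->.
  by case: eqP.
move=> f Lf; have := compl _ (cfun_inL2 Lf).
pose res N x := f x - \sum_(0 <= n < N) ip f (phi n) * phi n x.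
rewrite (_ : (fun N => L2norm _) = (fun N => (Num.sqrt (ip (res N) (res N)))%:E)); last first.
  apply/funext => N; rewrite -normsq_cfun -L2normE; last first.
    apply: cfun_inL2; apply: L2B => //; apply: L2_sum => n; apply: L2Z; exact: L2_phi.
  congr L2norm; apply/funext => x; rewrite /cfun /res rmorphB; congr (_ - _).
  under eq_bigr do rewrite coef_cfun; exact: sum_cfun.
move=> /fine_cvgP[_ h]; have hh := cvgM h h; rewrite mul0r in hh.
have resE N : ip (res N) (res N) =
    Num.sqrt (ip (res N) (res N)) * Num.sqrt (ip (res N) (res N)).
  by rewrite -expr2 sqr_sqrtr// ip_ge0.
change ((fun N => ip (res N) (res N)) @ \oo --> (0 : R)).
by under eq_fun do rewrite resE; exact: hh.
Qed.

Lemma lam_ge1 n : 1 <= lam n.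
Proof.
have := isLr_poincare qM q0 (isLr_phi n).
rewrite ipZl; [|exact: L2_phi..].
by have [_ -> _] := orthonormal_phi; rewrite eqxx mulr1.
Qed.

Lemma lam_ge0 n : 0 <= lam n. Proof. exact: le_trans ler01 (lam_ge1 n). Qed.
Lemma coef_isLr f g n : isLr q f g -> ip g (phi n) = lam n * ip f (phi n).
Proof.
move=> fg; rewrite (isLr_sym qM fg (isLr_phi n)) ipZr//; last by case: fg.
exact: L2_phi.
Qed.

Lemma isLr_combination (c : nat -> R) N :
  isLr q (combination phi c 0 N) (combination phi (fun n => lam n * c n) 0 N).
Proof.
elim: N => [|N ih].
  have := isLr_lin qM 0 0 (isLr_phi 0) (isLr_phi 0).
  rewrite (_ : (fun x => _) = combination phi c 0 0); last first.
    by apply/funext => x; rewrite /combination big_geq// !mul0r addr0.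
  rewrite (_ : (fun x => _ * (_ * _) + _) = combination phi (fun n => lam n * c n) 0 0)//.
  by apply/funext => x; rewrite /combination big_geq// !mul0r addr0.
have := isLr_lin qM 1 (c N) ih (isLr_phi N).
rewrite (_ : (fun x => _) = combination phi c 0 N.+1); last first.
  by apply/funext => x; rewrite /combination big_nat_recr//= mul1r.
rewrite (_ : (fun x => _ + _ * (_ * _)) = combination phi (fun n => lam n * c n) 0 N.+1)//.
by apply/funext => x; rewrite /combination big_nat_recr//= mul1r mulrA (mulrC (c N)).
Qed.

Lemma residual_small f e : L2 f -> 0 < e -> exists N, forall n, (N <= n)%N ->
  ip (fun x => combination phi (fun k => ip f (phi k)) 0 n x - f x)
     (fun x => combination phi (fun k => ip f (phi k)) 0 n x - f x) <= e.
Proof.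
move=> Lf e0; have [_ _ /(_ f Lf)] := orthonormal_phi.
move=> /cvgrPdist_le /(_ e e0)[N _ NP]; exists N => n /NP /=.
rewrite sub0r normrN ger0_norm ?ip_ge0//; apply: le_trans.
by rewrite le_eqVlt; apply/orP; left; apply/eqP/eq_ip => x _; rewrite /combination; ring.
Qed.

(** The partial sums of the expansions of f and g are related by L and converge to f and
    g; L is closed. *)
Lemma isLr_of_coef f g : L2 f -> L2 g ->
  (forall n, ip g (phi n) = lam n * ip f (phi n)) -> isLr q f g.
Proof.
move=> Lf Lg fg; apply: (isLr_closed qM) => // e e0.
have [N1 H1] := residual_small Lf e0.
have [N2 H2] := residual_small Lg e0.
pose N := maxn N1 N2.
exists (combination phi (fun k => ip f (phi k)) 0 N), (combination phi (fun k => ip g (phi k)) 0 N).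
split.
- rewrite (_ : (fun k => ip g (phi k)) = (fun k => lam k * ip f (phi k))); last exact/funext.
  exact: isLr_combination.
- by apply: H1; exact: leq_maxl.
- by apply: H2; exact: leq_maxr.
Qed.

(** L is diagonal in the basis phi. *)
Lemma isL_coefP F G : isL q F G <->
  [/\ inL2 F, inL2 G & forall n, coef phi n G = (lam n)%:C * coef phi n F].
Proof.
split.
  move=> FG; have [FGr FGi] := (isLP qM _ _).1 FG; case: FG => LF LG _; split => // n.
  rewrite !coefE (coef_isLr n FGr) (coef_isLr n FGi).
  by apply/eqP; rewrite eq_complex /= !mul0r subr0 addr0 !eqxx.
move=> [LF LG FG]; apply/(isLP qM).
have [[Fr Fi] [Gr Gi]] := (LF, LG).
split; apply: isLr_of_coef => // n; have := FG n; rewrite !coefE.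
  by move=> /(congr1 (@complex.Re R)) /= ->; rewrite mul0r subr0.
by move=> /(congr1 (@complex.Im R)) /= ->; rewrite mul0r addr0.
Qed.

Lemma opL_spec F : DomL q F -> isL q F (opL q F).
Proof. by move=> [G FG]; exact: (@xgetI _ (cst 0) _ G FG). Qed.

Lemma DomL_coef F : inL2 F -> (S2 (fun n => (lam n)%:C * coef phi n F)%R < +oo)%E -> DomL q F.
Proof.
move=> LF /(riesz_fischerC orthonormal_phi)[G LG GE].
by exists G; apply/isL_coefP.
Qed.

Lemma iter_opL F m : testL q F -> inL2 (iter m (opL q) F) /\
  forall n, coef phi n (iter m (opL q) F) = (lam n ^+ m)%:C * coef phi n F.
Proof.
move=> tF; elim: m => [|m [ih1 ih2]].
  by split => [|n]; [case: (tF 1%N isT)|rewrite mul1r].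
have [_ /(_ m (leqnn _)) /opL_spec/isL_coefP[_ LG GE]] := tF m.+1 isT.
split => // n; rewrite /= GE ih2 mulrA exprS; congr (_ * _).
by rewrite rmorphM.
Qed.

(** The test functions are the functions with rapidly decreasing coefficients. *)
Lemma testLP F : testL q F <->
  inL2 F /\ forall m, (S2 (fun n => (lam n ^+ m)%:C * coef phi n F)%R < +oo)%E.
Proof.
split.
  move=> tF; split => [|m]; first by case: (tF 1%N isT).
  have [LF FE] := iter_opL m tF.
  under [X in S2 X]eq_fun do rewrite -FE.
  by rewrite (parsevalC orthonormal_phi)// ltry.
move=> [LF Fm].
have H m : inL2 (iter m (opL q) F) /\
  forall n, coef phi n (iter m (opL q) F) = (lam n ^+ m)%:C * coef phi n F.
  elim: m => [|m [ih1 ih2]]; first by split => // n; rewrite mul1r.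
  have D : DomL q (iter m (opL q) F).
    apply: DomL_coef => //; rewrite (_ : (fun n => _) = (fun n => (lam n ^+ m.+1)%:C * coef phi n F)) ?Fm//.
    by apply/funext => n; rewrite ih2 mulrA exprS rmorphM.
  have /isL_coefP[_ LG GE] := opL_spec D.
  by split => // n; rewrite /= GE ih2 mulrA exprS rmorphM.
move=> m _; split => // j _; have [LG GE] := H j.
apply: DomL_coef => //; rewrite (_ : (fun n => _) = (fun n => (lam n ^+ j.+1)%:C * coef phi n F)) ?Fm//.
by apply/funext => n; rewrite GE mulrA exprS rmorphM.
Qed.

Lemma testL_inL2 F : testL q F -> inL2 F. Proof. by case/testLP. Qed.

(** The squared L^2 norm of L^m F.  As lam >= 1 it increases with m, so that the test
    norm of order m is its square root. *)
Definition normsq_opL m F := normsq (iter m (opL q) F).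

Lemma normsq_opL_S2 m F : testL q F -> S2 (fun n => (lam n ^+ m)%:C * coef phi n F) = (normsq_opL m F)%:E.
Proof.
move=> tF; have [LF FE] := iter_opL m tF.
under [X in S2 X]eq_fun do rewrite -FE.
by rewrite (parsevalC orthonormal_phi).
Qed.

Lemma normsq_opL_ge0 m F : 0 <= normsq_opL m F. Proof. exact: normsq_ge0. Qed.

Lemma normsq_opL_homo m n F : testL q F -> (m <= n)%N -> normsq_opL m F <= normsq_opL n F.
Proof.
move=> tF mn; rewrite -lee_fin -!normsq_opL_S2//.
rewrite -[leRHS]mul1e -[X in (X%:E * _)%E](expr1n _ 2%N).
apply: le_S2 => k; rewrite mul1r !cmodM ler_wpM2r ?cmod_ge0// !cmodR.
rewrite !ger0_norm ?exprn_ge0 ?lam_ge0//.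
by rewrite ler_weXn2l// lam_ge1.
Qed.

Lemma testnormE m F : testL q F -> testnorm q m F = Num.sqrt (normsq_opL m F).
Proof.
move=> tF; rewrite /testnorm.
have E j : fine (L2norm (iter j (opL q) F)) = Num.sqrt (normsq_opL j F).
  by have [LF _] := iter_opL j tF; rewrite L2normE.
under eq_bigr do rewrite E.
apply/eqP; rewrite eq_le; apply/andP; split.
  apply: bigmax_le; first exact: sqrtr_ge0.
  by move=> i _; rewrite ler_wsqrtr// normsq_opL_homo// -ltnS.
exact: (le_bigmax _ (fun j : 'I_m.+1 => Num.sqrt (normsq_opL j F)) ord_max).
Qed.

Lemma testL_lin (c : R[i]) F G : testL q F -> testL q G -> testL q (fun x => c * F x + G x).
Proof.
move=> tF tG; have [LF Fm] := (testLP _).1 tF; have [LG Gm] := (testLP _).1 tG.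
apply/testLP; split; first exact: inL2_lin.
move=> m; have [LF' FE] := iter_opL m tF; have [LG' GE] := iter_opL m tG.
rewrite (_ : (fun n => _) = (fun n => coef phi n (fun x => c * iter m (opL q) F x + iter m (opL q) G x))).
  rewrite (parsevalC orthonormal_phi) ?ltry//; exact: inL2_lin.
apply/funext => n; rewrite !coef_lin//; [|exact: L2_phi..].
by rewrite FE GE mulrDr mulrCA.
Qed.

Lemma testL_phi n : testL q (cfun (phi n)).
Proof.
apply/testLP; split; first exact/cfun_inL2/L2_phi.
move=> m; rewrite (_ : (fun k => _) = (fun k => coef phi k (cfun (fun x => lam n ^+ m * phi n x)))).
  rewrite (parsevalC orthonormal_phi) ?ltry//; apply/cfun_inL2/L2Z/L2_phi.
apply/funext => k; rewrite !coef_cfun ipZl; [|exact: L2_phi..].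
have [_ -> _] := orthonormal_phi.
by case: eqP => [->|_]; rewrite ?mulr1 ?mulr0.
Qed.

(** The operator that is diagonal in the basis phi with eigenvalues b.  The powers of L
    and the solution operator are of this kind. *)
Definition multiplier b F : R -> R[i] := xget (cst 0) [set G | inL2 G /\
  forall n, coef phi n G = b n * coef phi n F].

Lemma powL_multiplier s F : powL lam phi s F = multiplier (fun n => (lam n `^ s)%:C) F.
Proof. by []. Qed.

(** The factor e is kept apart from the power of lam: a multiplier with small e is a
    small operator between the test norms. *)
Definition growth (e : R) (r : nat) b := forall n, cmod (b n) <= e * lam n ^+ r.

Lemma multiplier_S2 b e r m F : growth e r b -> testL q F ->
  (S2 (fun n => (lam n ^+ m)%:C * (b n * coef phi n F))%R <= (e ^+ 2 * normsq_opL (m + r) F)%:E)%E.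
Proof.
move=> be tF; rewrite EFinM -normsq_opL_S2//; apply: le_S2 => n.
rewrite !cmodM mulrCA !mulrA ler_wpM2r ?cmod_ge0// !cmodR.
by rewrite !ger0_norm ?exprn_ge0 ?lam_ge0// addnC exprD mulrA ler_wpM2r ?exprn_ge0 ?lam_ge0.
Qed.

Lemma multiplier_spec b e r F : growth e r b -> testL q F -> inL2 (multiplier b F) /\
  forall n, coef phi n (multiplier b F) = b n * coef phi n F.
Proof.
move=> be tF.
have [|G LG GE] := riesz_fischerC orthonormal_phi (c := fun n => b n * coef phi n F).
  apply: le_lt_trans (ltry (e ^+ 2 * normsq_opL (0 + r) F)).
  apply: le_trans (multiplier_S2 0 be tF).
  by rewrite le_eqVlt; apply/orP; left; apply/eqP; congr S2; apply/funext => n; rewrite mul1r.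
exact: (@xgetI _ (cst 0) [set G | inL2 G /\ forall n, coef phi n G = b n * coef phi n F] G (conj LG GE)).
Qed.

Lemma multiplier_test b e r F : growth e r b -> testL q F -> testL q (multiplier b F).
Proof.
move=> be tF; have [LG GE] := multiplier_spec be tF; apply/testLP; split => // m.
apply: le_lt_trans (ltry (e ^+ 2 * normsq_opL (m + r) F)); apply: le_trans (multiplier_S2 m be tF).
by rewrite le_eqVlt; apply/orP; left; apply/eqP; congr S2; apply/funext => n; rewrite GE.
Qed.

Lemma normsq_opL_multiplier b e r m F : growth e r b -> testL q F ->
  normsq_opL m (multiplier b F) <= e ^+ 2 * normsq_opL (m + r) F.
Proof.
move=> be tF; have [LG GE] := multiplier_spec be tF.
rewrite -lee_fin -normsq_opL_S2; last exact: multiplier_test be tF.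
apply: le_trans (multiplier_S2 m be tF).
by rewrite le_eqVlt; apply/orP; left; apply/eqP; congr S2; apply/funext => n; rewrite GE.
Qed.

(** As lam >= 1, a real power of lam is at most a natural one. *)
Lemma growth_powR s : exists r, growth 1 r (fun n => (lam n `^ s)%:C).
Proof.
exists (Num.truncn `|s|).+1 => n; rewrite mul1r cmodR ger0_norm ?powR_ge0//.
rewrite -powR_mulrn ?lam_ge0// ler_powR ?lam_ge1//.
by rewrite (le_trans (ler_norm _))// ltW// truncnS_gt.
Qed.

Lemma growth_weak e r e' r' b : growth e r b -> 0 <= e -> e <= e' -> (r <= r')%N -> growth e' r' b.
Proof.
move=> be e0 ee rr n; apply: (le_trans (be n)).
by rewrite ler_pM ?exprn_ge0 ?lam_ge0// ler_weXn2l// lam_ge1.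
Qed.

Lemma growthM e r e' r' b b' : 0 <= e -> growth e r b -> growth e' r' b' ->
  growth (e * e') (r + r') (fun n => b n * b' n).
Proof.
move=> e0 be be' n; rewrite cmodM exprD mulrACA.
by rewrite ler_pM ?cmod_ge0// be.
Qed.

End eigenexpansion.

(** * Distributions and their coefficients *)

Section distributions.
Context {R : realType}.
Local Notation mu := (@lebesgue_measure R).
Local Notation L2 f := (inLp I01 2%:E f).
Local Notation re F := (fun x => complex.Re (F x)).
Local Notation im F := (fun x => complex.Im (F x)).
Variables (q : R -> R) (M : R) (lam : nat -> R) (phi : nat -> R -> R).
Hypothesis sys : eigensystem q M lam phi.
Implicit Types (F G H : R -> R[i]) (b : nat -> R[i]) (f g : R -> R) (u v : distr R).

Local Notation normsq_opL := (@normsq_opL R q).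
Local Notation multiplier := (@multiplier R phi).
Local Notation growth := (@growth R lam).
Let L2phi n : L2 (phi n). Proof. exact: L2_phi sys n. Qed.
Let lin := testL_lin sys.

Lemma testL0 : testL q (fun=> 0).
Proof.
have := lin (-1) (testL_phi sys 0) (testL_phi sys 0).
by under eq_fun do rewrite mulN1r addNr.
Qed.

Lemma testLZ (c : R[i]) F : testL q F -> testL q (fun x => c * F x).
Proof. by move=> /lin /(_ testL0) h; have := h c; under eq_fun do rewrite addr0. Qed.

Lemma testLB F G : testL q F -> testL q G -> testL q (fun x => F x - G x).
Proof.
by move=> tF tG; have := lin (-1) tG tF; under eq_fun do rewrite mulN1r addrC.
Qed.

Lemma coefB F G n : testL q F -> testL q G ->
  coef phi n (fun x => F x - G x) = coef phi n F - coef phi n G.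
Proof.
move=> tF tG.
rewrite (_ : (fun x => F x - G x) = (fun x => -1 * G x + F x)); last first.
  by apply/funext => x; rewrite mulN1r addrC.
by rewrite coef_lin//; [rewrite mulN1r addrC|exact: testL_inL2 sys _ _..].
Qed.

Lemma coefZ (c : R[i]) F n : testL q F -> coef phi n (fun x => c * F x) = c * coef phi n F.
Proof.
move=> tF; have := coef_lin n c L2phi (testL_inL2 sys tF) (testL_inL2 sys tF).
have := coef_lin n (c - 1) L2phi (testL_inL2 sys tF) (testL_inL2 sys tF).
rewrite (_ : (fun x => _) = (fun x => c * F x)); last by apply/funext => x; ring.
by move=> -> _; ring.
Qed.

Lemma distr_lin u (c : R[i]) F G : isdistr q u -> testL q F -> testL q G ->
  u (fun x => c * F x + G x) = c * u F + u G.
Proof. by move=> [ul _]; exact: ul. Qed.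

Lemma distr0 u : isdistr q u -> u (fun=> 0) = 0.
Proof.
move=> du; have := distr_lin (-1) du testL0 testL0.
by under eq_fun do rewrite mulN1r addNr; rewrite mulN1r addNr.
Qed.

Lemma distrZ u (c : R[i]) F : isdistr q u -> testL q F -> u (fun x => c * F x) = c * u F.
Proof.
move=> du tF; have := distr_lin c du tF testL0.
by under eq_fun do rewrite addr0; rewrite distr0// addr0.
Qed.

Lemma distrB u F G : isdistr q u -> testL q F -> testL q G ->
  u (fun x => F x - G x) = u F - u G.
Proof.
move=> du tF tG; have := distr_lin (-1) du tG tF.
by under eq_fun do rewrite mulN1r addrC; rewrite mulN1r addrC.
Qed.

Lemma normsq_opLZ_le m (c : R[i]) F : testL q F -> normsq_opL m (fun x => c * F x) <= cmod c ^+ 2 * normsq_opL m F.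
Proof.
move=> tF; rewrite -lee_fin EFinM -!(normsq_opL_S2 sys)//; last exact: testLZ.
by apply: le_S2 => n; rewrite (coefZ _ _ tF) (mulrCA _ c) !cmodM.
Qed.

(** Continuity at 0 and homogeneity of the test norms. *)
Lemma distr_bounded u : isdistr q u -> exists m, exists2 K : R, 0 <= K &
  forall F, testL q F -> cmod (u F) ^+ 2 <= K * normsq_opL m F.
Proof.
move=> du; have [_ /(_ _ testL0 1 ltr01)[m [d [d0 dP]]]] := du.
exists m, (d ^-1 ^+ 2); first exact: sqr_ge0.
move=> F tF; set s := Num.sqrt (normsq_opL m F).
suff h : cmod (u F) <= d^-1 * s.
  rewrite -[normsq_opL m F]sqr_sqrtr ?normsq_opL_ge0// -exprMn lerXn2r ?nnegrE ?cmod_ge0//.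
  by rewrite mulr_ge0 ?sqrtr_ge0// invr_ge0 ltW.
have s0 : 0 <= s := sqrtr_ge0 _.
rewrite mulrC ler_pdivlMr//; apply/ler_addgt0Pl => e e0.
have es : 0 < e + s by rewrite ltr_pwDl.
have tc := testLZ (d / (e + s))%:C tF.
have c0 : 0 <= d / (e + s) by rewrite divr_ge0// ltW.
have : cmod (u (fun x => (d / (e + s))%:C * F x) - u (fun=> 0)) < 1.
  apply: dP => //; under eq_fun do rewrite subr0.
  rewrite (testnormE sys)//.
  apply: (@le_lt_trans _ _ (Num.sqrt ((d / (e + s)) ^+ 2 * normsq_opL m F))).
    by rewrite ler_wsqrtr// (le_trans (normsq_opLZ_le _ _ tF))// cmodR real_normK ?num_real.
  rewrite sqrtrM ?sqr_ge0// sqrtr_sqr ger0_norm// -/s mulrAC ltr_pdivrMr//.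
  by rewrite ltr_pM2l// ltrDr.
rewrite (distr0 du) subr0 distrZ// cmodM cmodR ger0_norm// mulrAC.
by rewrite ltr_pdivrMr// mul1r mulrC => /ltW.
Qed.

Lemma bounded_isdistr u (m : nat) (K : R) : 0 <= K ->
  (forall (c : R[i]) F G, testL q F -> testL q G ->
     u (fun x => c * F x + G x) = c * u F + u G) ->
  (forall F, testL q F -> cmod (u F) ^+ 2 <= K * normsq_opL m F) -> isdistr q u.
Proof.
move=> K0 ul ub; split => // F tF e e0.
have K1 : 0 < Num.sqrt (K + 1) by rewrite sqrtr_gt0 ltr_wpDl.
exists m, (e / Num.sqrt (K + 1)); split; first by rewrite divr_gt0.
move=> G tG; have tGF := testLB tG tF; rewrite (testnormE sys)// => h.
have -> : u G - u F = u (fun x => G x - F x).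
  have := ul (-1) _ _ tF tG; rewrite (_ : (fun x => -1 * F x + G x) = (fun x => G x - F x)).
    by move=> ->; rewrite mulN1r addrC.
  by apply/funext => x; rewrite mulN1r addrC.
rewrite -(@ltr_pXn2r _ 2)// ?nnegrE ?cmod_ge0 ?(ltW e0)//.
apply: (le_lt_trans (ub _ tGF)).
have t0 := normsq_opL_ge0 q m (fun x => G x - F x).
apply: (@le_lt_trans _ _ ((K + 1) * normsq_opL m (fun x => G x - F x))).
  by rewrite ler_wpM2r// lerDl.
rewrite mulrC -ltr_pdivlMr; last by rewrite ltr_wpDl.
rewrite -[X in _ < _ / X]sqr_sqrtr; last by rewrite addr_ge0.
rewrite -expr_div_n -[ltLHS]sqr_sqrtr// ltr_pXn2r// ?nnegrE ?sqrtr_ge0//.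
by rewrite divr_ge0 ?ltW.
Qed.

(** Test functions with the same coefficients differ by a test function all of whose
    norms vanish. *)
Lemma distr_coef u F G : isdistr q u -> testL q F -> testL q G ->
  (forall n, coef phi n F = coef phi n G) -> u F = u G.
Proof.
move=> du tF tG FG; have [m [K K0 ub]] := distr_bounded du.
apply/eqP; rewrite -subr_eq0 -distrB//; apply/eqP/cmod_eq0.
have tFG := testLB tF tG.
have : normsq_opL m (fun x => F x - G x) = 0.
  apply/EFin_inj; rewrite -(normsq_opL_S2 sys)// /S2 eseries0// => n _ _.
  by rewrite coefB// FG subrr mulr0 cmod0 expr0n.
move=> t0; have := ub _ tFG; rewrite t0 mulr0 => h.
by apply/eqP; rewrite -sqrf_eq0 eq_le h sqr_ge0.
Qed.

Lemma distr_lin_coef u (c : R[i]) F G H : isdistr q u -> testL q F -> testL q G -> testL q H ->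
  (forall n, coef phi n H = c * coef phi n F + coef phi n G) -> u H = c * u F + u G.
Proof.
move=> du tF tG tH HE; rewrite -distr_lin//; apply: distr_coef => //; first exact: lin.
by move=> n; rewrite HE coef_lin//; exact: testL_inL2 sys _ _.
Qed.

Lemma distr_multiplier_lin u (c : R[i]) b b' e e' r r' F : isdistr q u -> testL q F ->
  0 <= e -> 0 <= e' -> growth e r b -> growth e' r' b' ->
  u (multiplier (fun n => c * b n + b' n) F) = c * u (multiplier b F) + u (multiplier b' F).
Proof.
move=> du tF e0 e'0 be be'.
have bb : growth (cmod c * e + e') (maxn r r') (fun n => c * b n + b' n).
  move=> n; apply: (le_trans (cmodD _ _)); rewrite cmodM mulrDl lerD//.
    rewrite -mulrA ler_wpM2l ?cmod_ge0//.
    by apply: (growth_weak sys be e0 (lexx _) (leq_maxl _ _)).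
  by apply: (growth_weak sys be' e'0 (lexx _) (leq_maxr _ _)).
apply: distr_lin_coef => //; [exact: (multiplier_test sys be)|exact: (multiplier_test sys be')|exact: (multiplier_test sys bb)|].
move=> n; have [_ ->] := multiplier_spec sys be tF; have [_ ->] := multiplier_spec sys be' tF.
by have [_ ->] := multiplier_spec sys bb tF; ring.
Qed.

Lemma distr_multiplier_comp u b b' e e' r r' F : isdistr q u -> testL q F ->
  0 <= e -> growth e r b -> growth e' r' b' ->
  u (multiplier b (multiplier b' F)) = u (multiplier (fun n => b n * b' n) F).
Proof.
move=> du tF e0 be be'; have tF' := multiplier_test sys be' tF.
have bb := growthM e0 be be'.
apply: (distr_coef du (multiplier_test sys be tF') (multiplier_test sys bb tF)).
move=> n; have [_ ->] := multiplier_spec sys be tF'; have [_ ->] := multiplier_spec sys be' tF.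
by have [_ ->] := multiplier_spec sys bb tF; rewrite mulrA.
Qed.

Lemma distr_multiplier_phi u b e r n : isdistr q u -> growth e r b ->
  u (multiplier b (cfun (phi n))) = b n * u (cfun (phi n)).
Proof.
move=> du be; have tp := testL_phi sys n.
rewrite -distrZ//; apply: distr_coef => //; [exact: (multiplier_test sys be)|exact: testLZ|].
move=> k; have [_ ->] := multiplier_spec sys be tp; rewrite coefZ// coef_cfun.
by have [_ -> _] := orthonormal_phi sys; case: eqP => [->//|_]; rewrite !mulr0.
Qed.

Lemma isdistr_multiplier u b e r : isdistr q u -> 0 <= e -> growth e r b -> isdistr q (fun F => u (multiplier b F)).
Proof.
move=> du e0 be; have [m [K K0 ub]] := distr_bounded du.
apply: (@bounded_isdistr _ (m + r) (K * e ^+ 2)); first by rewrite mulr_ge0// sqr_ge0.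
- move=> c F G tF tG; have tFG := lin c tF tG.
  apply: distr_lin_coef => //; [exact: (multiplier_test sys be)..|].
  move=> n; have [_ ->] := multiplier_spec sys be tF; have [_ ->] := multiplier_spec sys be tG.
  have [_ ->] := multiplier_spec sys be tFG; rewrite coef_lin//; [ring|exact: testL_inL2 sys _ _..].
- move=> F tF; apply: (le_trans (ub _ (multiplier_test sys be tF))).
  by rewrite -mulrA ler_wpM2l// (normsq_opL_multiplier sys).
Qed.

(** The constant K does not depend on the multiplier: estimates of multipliers pass to
    u with the same factor e. *)
Lemma distr_multiplier_bound u F r : isdistr q u -> testL q F ->
  exists2 K : R, 0 <= K & forall b e, 0 <= e -> growth e r b -> cmod (u (multiplier b F)) <= e * K.
Proof.
move=> du tF; have [m [K K0 ub]] := distr_bounded du.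
exists (Num.sqrt (K * normsq_opL (m + r) F)); first exact: sqrtr_ge0.
move=> b e e0 be.
have t0 : 0 <= K * normsq_opL (m + r) F by rewrite mulr_ge0// normsq_opL_ge0.
rewrite -(@ler_pXn2r _ 2)// ?nnegrE ?cmod_ge0 ?mulr_ge0 ?sqrtr_ge0//.
rewrite exprMn sqr_sqrtr// mulrCA (le_trans (ub _ (multiplier_test sys be tF)))//.
by rewrite ler_wpM2l// (normsq_opL_multiplier sys).
Qed.

(** The remainder of the expansion of F after N terms. *)
Definition expansion_tail N F : R -> R[i] := multiplier (fun n => if (n < N)%N then 0 else 1) F.

Let growth_tail N : growth 1 0 (fun n => if (n < N)%N then 0 else 1).
Proof.
by move=> n; rewrite expr0 mulr1; case: ifP; rewrite ?cmod0// cmodR normr1.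
Qed.

Lemma testL_expansion_tail N F : testL q F -> testL q (expansion_tail N F).
Proof. by move=> tF; exact: (multiplier_test sys (growth_tail N) tF). Qed.

Lemma coef_expansion_tail N F n : testL q F ->
  coef phi n (expansion_tail N F) = if (n < N)%N then 0 else coef phi n F.
Proof.
move=> tF; have [_ ->] := multiplier_spec sys (growth_tail N) tF.
by case: ifP; rewrite ?mul0r ?mul1r.
Qed.

Lemma expansion_tail_small m F (e : R) : testL q F -> 0 < e -> exists N, normsq_opL m (expansion_tail N F) <= e.
Proof.
move=> tF e0; pose x n := cmod ((lam n ^+ m)%:C * coef phi n F) ^+ 2.
have x0 n : 0 <= x n by exact: sqr_ge0.
have xoo : (\sum_(0 <= k <oo) (x k)%:E < +oo)%E.
  by have := normsq_opL_S2 sys m tF; rewrite /S2 => ->; rewrite ltry.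
have [N NP] := nneseries_tail_small x0 xoo e0.
exists N; rewrite -lee_fin -(normsq_opL_S2 sys); last exact: testL_expansion_tail.
apply: lime_le; first by apply: is_cvg_nneseries => k _ _; rewrite lee_fin sqr_ge0.
apply: nearW => n; rewrite sumEFin lee_fin.
have E k : cmod ((lam k ^+ m)%:C * coef phi k (expansion_tail N F)) ^+ 2 = if (k < N)%N then 0 else x k.
  by rewrite coef_expansion_tail//; case: ifP => // _; rewrite mulr0 cmod0 expr0n.
under eq_bigr do rewrite E.
have [nN|Nn] := leqP n N.
  rewrite big_nat big1 ?(ltW e0)// => k /andP[_ kn].
  by rewrite (leq_trans kn nN).
rewrite (big_cat_nat (n := N)) ?(ltnW Nn)//= big_nat big1 ?add0r; last first.
  by move=> k /andP[_ ->].
apply: le_trans (NP N n (leqnn _)).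
rewrite big_nat [leRHS]big_nat; apply: ler_sum => k /andP[Nk _].
by rewrite ltnNge Nk.
Qed.

(** By linearity u and v agree on partial sums of the expansion of F; the remainders
    tend to 0 in the norm of any order. *)
Lemma distr_ext u v : isdistr q u -> isdistr q v ->
  (forall n, u (cfun (phi n)) = v (cfun (phi n))) -> distr_eq q u v.
Proof.
move=> du dv uv F tF.
have tailE N : u F - u (expansion_tail N F) = v F - v (expansion_tail N F).
  elim: N => [|N ih].
    have E n : coef phi n F = coef phi n (expansion_tail 0 F) by rewrite coef_expansion_tail.
    by rewrite -(distr_coef du tF (testL_expansion_tail 0 tF) E) -(distr_coef dv tF (testL_expansion_tail 0 tF) E) !subrr.
  have E n : coef phi n (expansion_tail N F) = coef phi N F * coef phi n (cfun (phi N)) + coef phi n (expansion_tail N.+1 F).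
    rewrite !coef_expansion_tail// coef_cfun; have [_ -> _] := orthonormal_phi sys.
    rewrite ltnS; case: ltngtP => // [nN|nN|->].
    - by rewrite mulr0 addr0.
    - by rewrite mulr0 add0r.
    - by rewrite mulr1 addr0.
  have tp := testL_phi sys N.
  move: ih; rewrite (distr_lin_coef du tp (testL_expansion_tail _ tF) (testL_expansion_tail _ tF) E).
  rewrite (distr_lin_coef dv tp (testL_expansion_tail _ tF) (testL_expansion_tail _ tF) E) uv => /eqP.
  rewrite !opprD !addrA ![_ - coef _ _ _ * _]addrC -!addrA => /eqP/addrI.
  by [].
have [m [K K0 ub]] := distr_bounded du.
have [m' [K' K0' vb]] := distr_bounded dv.
pose p := maxn m m'; pose c := 2 * (K + K') + 1.
have c0 : 0 < c by rewrite ltr_wpDl// mulr_ge0// addr_ge0.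
apply/eqP; rewrite -subr_eq0; apply/eqP/cmod_eq0/eqP.
rewrite -sqrf_eq0 -normr_le0; apply/ler_addgt0Pl => e e0; rewrite addr0.
rewrite ger0_norm ?sqr_ge0//.
have [N NP] := expansion_tail_small p tF (divr_gt0 e0 c0).
have tN := testL_expansion_tail N tF.
have -> : u F - v F = u (expansion_tail N F) - v (expansion_tail N F).
  by have /eqP := tailE N; rewrite subr_eq => /eqP ->; ring.
set t := normsq_opL p (expansion_tail N F) in NP.
have t0 : 0 <= t by exact: normsq_opL_ge0.
have ut : cmod (u (expansion_tail N F)) ^+ 2 <= K * t.
  by rewrite (le_trans (ub _ tN))// ler_wpM2l// (normsq_opL_homo sys)// leq_maxl.
have vt : cmod (v (expansion_tail N F)) ^+ 2 <= K' * t.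
  by rewrite (le_trans (vb _ tN))// ler_wpM2l// (normsq_opL_homo sys)// leq_maxr.
have := cmodD (u (expansion_tail N F)) (- v (expansion_tail N F)); rewrite cmodN => h.
apply: (@le_trans _ _ ((cmod (u (expansion_tail N F)) + cmod (v (expansion_tail N F))) ^+ 2)).
  by rewrite lerXn2r ?nnegrE ?addr_ge0 ?cmod_ge0.
apply: (@le_trans _ _ (c * t)); last by rewrite mulrC -ler_pdivlMr.
have := sqr_ge0 (cmod (u (expansion_tail N F)) - cmod (v (expansion_tail N F))); rewrite /c; nra.
Qed.

Lemma pairingE (F G : R -> R[i]) : inL2 F -> inL2 G -> pairing F G =
  (ip (re F) (re G) - ip (im F) (im G)) +i* (ip (re F) (im G) + ip (im F) (re G)).
Proof.
move=> [Fr Fi] [Gr Gi]; rewrite /pairing /cintegral /ip.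
rewrite -RintegralB ?measurable_I01//; [|exact: L2_mul..].
rewrite -RintegralD ?measurable_I01//; [|exact: L2_mul..].
by congr (_ +i* _); apply: eq_Rintegral => x _; case: (F x) (G x) => a b' [c d] /=.
Qed.

Lemma pairing_le (F G : R -> R[i]) : inL2 F -> inL2 G ->
  cmod (pairing F G) ^+ 2 <= 2 * normsq F * normsq G.
Proof.
move=> LF LG; rewrite pairingE// cmod_sq /normsq /=.
case: LF LG => [Fr Fi] [Gr Gi].
have := ip_CS Fr Gr; have := ip_CS Fi Gi; have := ip_CS Fr Gi; have := ip_CS Fi Gr.
set A := ip (re F) (re G); set B := ip (im F) (im G).
set C := ip (re F) (im G); set D := ip (im F) (re G).
move=> h1 h2 h3 h4.
have := sqr_ge0 (A + B); have := sqr_ge0 (C - D); nra.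
Qed.

Lemma isdistr_of F : inL2 F -> isdistr q (distr_of F).
Proof.
move=> LF; apply: (@bounded_isdistr _ 0 (2 * normsq F)).
- by rewrite mulr_ge0// normsq_ge0.
- move=> c G H /(testL_inL2 sys) LG /(testL_inL2 sys) LH.
  rewrite /distr_of !pairingE//; last exact: inL2_lin.
  case: LF LG LH => [Fr Fi] [Gr Gi] [Hr Hi]; case: c => a b'.
  have -> : re (fun x => (a +i* b') * G x + H x) =
    (fun x => (a * complex.Re (G x) + (- b') * complex.Im (G x)) + complex.Re (H x)).
    by apply/funext => x; exact: Re_lin.
  have -> : im (fun x => (a +i* b') * G x + H x) =
    (fun x => (a * complex.Im (G x) + b' * complex.Re (G x)) + complex.Im (H x)).
    by apply/funext => x; exact: Im_lin.
  have L1 := L2Z a Gr; have L2' := L2Z (- b') Gi; have L3 := L2Z a Gi; have L4 := L2Z b' Gr.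
  rewrite !(ipDr (L2D L1 L2') Hr) // !(ipDr L1 L2')// !(ipDr (L2D L3 L4) Hi)// !(ipDr L3 L4)//.
  rewrite !(ipZr _ Gr)// !(ipZr _ Gi)//.
  by apply/eqP; rewrite eq_complex /=; apply/andP; split; apply/eqP; ring.
- move=> G tG; exact: pairing_le (testL_inL2 sys tG).
Qed.

Lemma distr_of_coef F n : distr_of F (cfun (phi n)) = coef phi n F.
Proof. by []. Qed.

Definition esqrt (x : \bar R) : \bar R := if x is r%:E then (Num.sqrt r)%:E else +oo%E.

Definition distr_coefs u n := u (cfun (phi n)).

(** The function whose coefficients are the values of u on the phi_n, given by the
    theorem of Riesz and Fischer. *)
Lemma distr_repr u : isdistr q u -> (S2 (distr_coefs u) < +oo)%E ->
  exists2 F, inL2 F & distr_eq q u (distr_of F).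
Proof.
move=> du /(riesz_fischerC (orthonormal_phi sys))[F LF FE]; exists F => //.
by apply: distr_ext => //; [exact: isdistr_of|move=> n; rewrite distr_of_coef FE].
Qed.

Lemma distr_repr_normsq u F : inL2 F -> distr_eq q u (distr_of F) ->
  S2 (distr_coefs u) = (normsq F)%:E.
Proof.
move=> LF uF; rewrite -(parsevalC (orthonormal_phi sys))//; congr S2; apply/funext => n.
by rewrite /distr_coefs uF ?distr_of_coef//; exact: testL_phi sys n.
Qed.

(** All functions in L^2 that represent u have the coefficients of u, hence the same
    norm by Parseval's identity; one exists exactly if these are square summable. *)
Lemma distrL2normE u : isdistr q u -> distrL2norm q u = esqrt (S2 (distr_coefs u)).
Proof.
move=> du; rewrite /distrL2norm.
have [S2oo|/negbTE S2oo] := boolP (S2 (distr_coefs u) < +oo)%E.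
  have [F LF uF] := distr_repr du S2oo.
  rewrite (distr_repr_normsq LF uF) /= -L2normE//.
  rewrite (_ : [set _ | _ in _] = [set L2norm F]) ?ereal_inf1//.
  apply/seteqP; split => [_ [G [LG uG] <-]|_ ->]; last by exists F.
  rewrite /= !L2normE//; congr (Num.sqrt _)%:E; apply/EFin_inj.
  by rewrite -(distr_repr_normsq LG uG) (distr_repr_normsq LF uF).
have -> : S2 (distr_coefs u) = +oo%E.
  by move: S2oo; have := S2_ge0 (distr_coefs u); case: (S2 _) => // r; rewrite ltry.
rewrite /= (_ : [set _ | _ in _] = set0) ?ereal_inf0//.
apply/seteqP; split => // x [G [LG uG] _].
by move: S2oo; rewrite (distr_repr_normsq LG uG) ltry.
Qed.

Lemma esqrt_le (x y : \bar R) (m : R) : 0 < m -> (0 <= x)%E -> (0 <= y)%E ->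
  (x <= (m ^+ 2)%:E * y)%E -> (esqrt x <= m%:E * esqrt y)%E.
Proof.
move=> m0; case: y => [y| |]//; last first.
  by move=> _ _ _; rewrite /= gt0_muley ?lte_fin// leey.
case: x => [x| |]//= x0 y0.
rewrite -!EFinM !lee_fin => xy; rewrite -[m]ger0_norm ?(ltW m0)// -sqrtr_sqr.
by rewrite -sqrtrM ?sqr_ge0// ler_wsqrtr.
Qed.

Lemma eq_esqrt_S2 (c d : nat -> R[i]) : (forall n, cmod (c n) = cmod (d n)) ->
  esqrt (S2 c) = esqrt (S2 d).
Proof. by move=> cd; congr esqrt; apply: eq_eseriesr => n _; rewrite cd. Qed.

End distributions.

(** * Unimodular phases and the time change *)

Section oscillation.
Context {R : realType}.
Implicit Types x y : R.

(** The mean value theorem on the interval between 0 and y, whatever the sign of y. *)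
Lemma mean_value0 (f df : R -> R) y : (forall x, is_derive x 1 f (df x)) ->
  exists2 c, `|c| <= `|y| & f y - f 0 = df c * y.
Proof.
move=> fd; have cf D : {within D, continuous f}.
  apply: continuous_subspaceT => x; apply: differentiable_continuous.
  by apply/derivable1_diffP; have [] := fd x.
have [y0|/ltW y0] := leP 0 y.
  have [c] := MVT_segment y0 (fun x _ => fd x) (cf _).
  rewrite in_itv/= subr0 => /andP[c0 cy] E; exists c => //.
  by rewrite !ger0_norm.
have [c] := MVT_segment y0 (fun x _ => fd x) (cf _).
rewrite in_itv/= sub0r => /andP[yc c0] E; exists c.
  by rewrite !ler0_norm// lerN2.
by rewrite -opprB E mulrN opprK.
Qed.

Lemma sin_lip y : `|sin y| <= `|y|.
Proof.
have [c _] := mean_value0 y (@is_derive_sin R).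
by rewrite sin0 subr0 => ->; rewrite normrM ler_piMl// cos_max.
Qed.

Lemma cos_lip y : `|cos y - 1| <= `|y|.
Proof.
have [c _] := mean_value0 y (@is_derive_cos R).
by rewrite cos0 => ->; rewrite normrM ler_piMl// normrN sin_max.
Qed.

Lemma cos_quad y : `|cos y - 1| <= y ^+ 2.
Proof.
have [c cy] := mean_value0 y (@is_derive_cos R).
rewrite cos0 => ->; rewrite normrM normrN -[leRHS]real_normK ?num_real// expr2.
by rewrite ler_wpM2r// (le_trans (sin_lip _)).
Qed.

Lemma sin_quad y : `|sin y - y| <= y ^+ 2.
Proof.
have D x : is_derive x 1 (fun x => sin x - x) (cos x - 1).
  exact: is_deriveB.
have [c cy] := mean_value0 y D.
rewrite sin0 !subr0 => ->; rewrite normrM -[leRHS]real_normK ?num_real// expr2.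
by rewrite ler_wpM2r// (le_trans (cos_lip _)).
Qed.

Definition expi x : R[i] := cos x +i* sin x.

Lemma expi0 : expi 0 = 1. Proof. by rewrite /expi cos0 sin0. Qed.

Lemma cmod_expi x : cmod (expi x) = 1.
Proof. by rewrite /cmod /= cos2Dsin2 sqrtr1. Qed.

Lemma expiD x y : expi (x + y) = expi x * expi y.
Proof. by rewrite /expi sinD cosD; apply/eqP; rewrite eq_complex /= eqxx addrC eqxx. Qed.

Lemma expi_lip x y : cmod (expi (x + y) - expi x) <= 2 * `|y|.
Proof.
rewrite expiD -[X in _ - X]mulr1 -mulrBr cmodM cmod_expi mul1r.
rewrite (le_trans (cmod_le _))//= subr0 mulr_natl mulr2n lerD//.
  exact: cos_lip.
exact: sin_lip.
Qed.

Lemma expi_quad x y : cmod (expi (x + y) - expi x - (0 +i* y) * expi x) <= 2 * y ^+ 2.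
Proof.
rewrite expiD (_ : _ - _ = expi x * (expi y - 1 - (0 +i* y))); last by ring.
rewrite cmodM cmod_expi mul1r.
rewrite (le_trans (cmod_le _))//= !subr0 mulr_natl mulr2n lerD//.
  exact: cos_quad.
exact: sin_quad.
Qed.

End oscillation.

Section primitives.
Context {R : realType}.
Local Notation mu := (@lebesgue_measure R).
Local Notation integr D f := (mu.-integrable D (EFin \o f)).

Lemma integr_essbounded (T : R) (a : R -> R) (Ma : R) :
  essbounded (I0T T) a Ma -> mu.-integrable setT (EFin \o (a \_ (I0T T))).
Proof.
move=> [ma M0 aM].
rewrite (_ : EFin \o _ = (EFin \o a) \_ (I0T T)); last exact/esym/restrict_EFin.
have mI : measurable (I0T T : set (measurableTypeR R)) by exact: measurable_itv.
apply/integrable_restrict => //; rewrite setTI.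
apply/integrableP; split; first exact/measurable_EFinP.
apply: (@le_lt_trans _ _ (\int[mu]_(x in I0T T) Ma%:E)%E).
  apply: ae_ge0_le_integral => //.
  by apply: measurableT_comp => //; exact/measurable_EFinP.
rewrite integral_cst// [X in (_ * X)%E]lebesgue_measure_itv/=.
by case: ifP => _; rewrite -?EFinD ?mule0 -?EFinM ltry.
Qed.

(** Lebesgue's differentiation theorem. *)
Lemma derivative_of_primitive (f : R -> R) : mu.-integrable setT (EFin \o f) ->
  {ae mu, forall t,
    h^-1 * (\int[mu]_(x in `]-oo, (t + h)]) f x - \int[mu]_(x in `]-oo, t]) f x)
      @[h --> 0^'] --> f t}.
Proof.
move=> fi.
have fy y : mu.-integrable `]-oo, y] (EFin \o f) by apply: integrableS fi.
have := FTC1Ny fy (open_integrable_locally openT fi).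
apply: aeS => t [df]; rewrite derive1E => ft.
pose F x := \int[mu]_(x in `]-oo, x]) f x.
have {}df : h^-1 *: ((F \o shift t) (h *: 1) - F t) @[h --> 0^'] --> 'D_1 F t by exact: df.
rewrite ft in df; apply: cvg_trans df; apply: near_eq_cvg; apply: nearW => h /=.
by rewrite [h%:A]mulr1 (addrC t h).
Qed.

Section bounded_rate.
Variables (T : R) (a : R -> R) (Ma : R).
Hypothesis aM : essbounded (I0T T) a Ma.

Definition rate := a \_ (I0T T).
(** The solution depends on t only through this primitive of a.  The extension of a by
    zero makes it defined and Lipschitz on the whole line. *)
Definition clock t := \int[mu]_(x in `]-oo, t]) rate x.

Let ri : mu.-integrable setT (EFin \o rate). Proof. exact: integr_essbounded aM. Qed.
Let Ma0 : 0 <= Ma. Proof. by case: aM. Qed.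

Lemma integr_rate (D : set (measurableTypeR R)) : measurable D -> integr D rate.
Proof. by move=> mD; apply: integrableS ri. Qed.

Lemma clock_incr x y : x <= y -> clock y - clock x = \int[mu]_(t in `]x, y]) rate t.
Proof.
move=> xy; apply: Rintegral_itvB; rewrite ?bnd_simp//.
exact: integr_rate.
Qed.

Lemma rate_bound x y : x <= y -> \int[mu]_(t in `]x, y]) `|rate t| <= Ma * (y - x).
Proof.
move=> xy; have mI : measurable (`]x, y]%classic : set (measurableTypeR R)) by exact: measurable_itv.
have ii := integr_norm mI (integr_rate mI).
rewrite -lee_fin /Rintegral fineK; last exact: integrable_fin_num.
apply: (@le_trans _ _ (\int[mu]_(t in `]x, y]) Ma%:E)%E).
  apply: ae_ge0_le_integral => //.
  - by case/integrableP : ii.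
  - have [_ _ aM'] := aM; apply: aeS aM' => t aM' _; rewrite lee_fin /rate patchE.
    by case: ifPn => [/set_mem/aM'//|_]; rewrite normr0.
rewrite integral_cst// [X in (_ * X)%E]lebesgue_measure_itv/= lte_fin.
case: ifPn => _; first by rewrite -EFinD -EFinM.
by rewrite mule0 lee_fin mulr_ge0 ?subr_ge0.
Qed.

Lemma clock_lip x y : `|clock y - clock x| <= Ma * `|y - x|.
Proof.
wlog xy : x y / x <= y.
  move=> H; have [|/ltW] := leP x y; first exact: H.
  by move=> /H; rewrite distrC (distrC x).
have mI : measurable (`]x, y]%classic : set (measurableTypeR R)) by exact: measurable_itv.
rewrite clock_incr// [`|y - x|]ger0_norm ?subr_ge0//.
apply: le_trans (rate_bound xy); apply: le_normr_Rintegral => //; exact: integr_rate.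
Qed.

Lemma clock0 : clock 0 = 0.
Proof.
rewrite /clock -Rintegral_itv_bndo_bndc; last exact: integr_rate.
transitivity (\int[mu]_(x in `]-oo, (0 : R)[) (0 : R)); last first.
  by rewrite /Rintegral integral0.
apply: eq_Rintegral => t; rewrite inE/= in_itv/= => t0; rewrite /rate patchE memNset//.
by rewrite /I0T/= in_itv/= leNgt t0.
Qed.

Lemma clock_derivative : {ae mu, forall t, 0 < t -> t < T ->
    h^-1 * (clock (t + h) - clock t) @[h --> 0^'] --> a t}.
Proof.
apply: aeS (derivative_of_primitive ri) => t + t0 tT.
by rewrite {3}/rate patchE mem_set// /I0T/= in_itv/= !ltW.
Qed.

(** The function X x - int_0^x rate k has increments that are quadratic in y - x, because
    X moves along the clock with speed k up to a quadratic error and k is Lipschitz. *)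
Lemma ACr_of_clock (X k : R -> R) (C L : R) : 0 <= T -> 0 <= C -> 0 <= L ->
  (forall x y, x <= y -> `|X y - X x - k x * (clock y - clock x)| <= C * (y - x) ^+ 2) ->
  (forall x y, `|k y - k x| <= L * `|y - x|) ->
  ACr 0 T X (fun t => rate t * k t).
Proof.
move=> T0 C0 L0 Xk kL.
have ck : continuous k.
  move=> x; apply/cvgrPdist_le => /= e e0.
  have L1 : 0 < L + 1 by rewrite ltr_wpDl.
  near=> y; rewrite (le_trans (kL _ _))//.
  apply: (@le_trans _ _ ((L + 1) * `|x - y|)); first by rewrite ler_wpM2r// lerDl.
  rewrite mulrC -ler_pdivlMr//; apply/ltW.
  by near: y; apply: cvgr_dist_lt => //; rewrite divr_gt0.
have mk D : measurable D -> measurable_fun D k.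
  by move=> mD; apply: measurable_funTS; exact: continuous_measurable_fun.
have rki : integr `[0, T] (fun t => rate t * k t).
  apply: (integrable_bounded_mul (M := `|k 0| + L * T)) => //.
  - exact: integr_rate.
  - exact: mk.
  - move=> t /=; rewrite in_itv/= => /andP[t0 tT].
    rewrite -lerBlDl (le_trans (lerB_dist _ _))// (le_trans (kL _ _))// subr0 ler_wpM2l//.
    by rewrite ger0_norm.
split => // z z0 zT.
pose P x := \int[mu]_(t in `[0, x]) (rate t * k t).
have PA : ACr 0 T P (fun t => rate t * k t).
  by split => // x _ _; rewrite /P set_itv1 Rintegral_set1 add0r.
pose D x := X x - P x.
suff : D z = D 0.
  rewrite /D {2}/P set_itv1 Rintegral_set1 subr0 => /eqP.
  by rewrite subr_eq => /eqP.
pose c := C + Ma * L; have c0 : 0 <= c by rewrite addr_ge0// mulr_ge0.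
apply: (@constant_of_product_modulus _ _ _ D (fun x => c * x) id) => //; last first.
- move=> e e0; exists e => // x y _ _ _ /ltW; by [].
- by move=> x y _ xy _; rewrite ler_wpM2l.
move=> x y x0 xy yz; have yT := le_trans yz zT.
have mI : measurable (`]x, y]%classic : set (measurableTypeR R)) by exact: measurable_itv.
have ir := integr_rate mI.
have kb t : [set` `]x, y]] t -> `|k x - k t| <= L * (y - x).
  rewrite /= in_itv/= => /andP[xt ty]; rewrite (le_trans (kL _ _))// ler_wpM2l//.
  by rewrite ler0_norm ?opprB ?lerB// subr_le0 ltW.
have i2 : integr `]x, y] (fun t => rate t * (k x - k t)).
  apply: integrable_bounded_mul kb => //.
  by apply: measurable_funB => //; exact: mk.
have E : D y - D x = (X y - X x - k x * (clock y - clock x)) +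
    \int[mu]_(t in `]x, y]) (rate t * (k x - k t)).
  have -> : \int[mu]_(t in `]x, y]) (rate t * (k x - k t)) =
      k x * (clock y - clock x) - (P y - P x).
    rewrite clock_incr// (ACr_incr PA)// -RintegralZl// -RintegralB//.
    - by apply: eq_Rintegral => t _; ring.
    - exact: integrZl.
    - by apply: integr_sub_oc rki.
  rewrite /D; ring.
rewrite E (le_trans (ler_normD _ _))// -mulrBr -mulrA -expr2 /c mulrDl lerD ?Xk//.
apply: (le_trans (le_normr_Rintegral mI i2)).
apply: (@le_trans _ _ (\int[mu]_(t in `]x, y]) (L * (y - x) * `|rate t|))).
  apply: le_Rintegral => //; first exact: integr_norm.
    by apply: integrZl => //; exact: integr_norm.
  by move=> t tI; rewrite normrM mulrC ler_wpM2r// kb.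
rewrite RintegralZl//; last exact: integr_norm.
rewrite [leRHS](_ : _ = L * (y - x) * (Ma * (y - x))); last by ring.
by rewrite ler_wpM2l ?rate_bound// mulr_ge0// subr_ge0.
Unshelve. all: by end_near. Qed.

End bounded_rate.

Lemma ACr_derivative (T : R) (F f : R -> R) : ACr 0 T F f ->
  {ae mu, forall t, 0 < t -> t < T -> h^-1 * (F (t + h) - F t) @[h --> 0^'] --> f t}.
Proof.
move=> [fi Ff].
have gi : mu.-integrable setT (EFin \o (f \_ `[0, T])).
  rewrite (_ : EFin \o _ = (EFin \o f) \_ `[0, T]); last exact/esym/restrict_EFin.
  by apply/integrable_restrict => //; rewrite setTI.
apply: aeS (derivative_of_primitive gi) => t + t0 tT.
rewrite patchE mem_set/= ?in_itv/= ?ltW//.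
have E y : 0 <= y -> y <= T -> \int[mu]_(x in `]-oo, y]) (f \_ `[0, T]) x = F y - F 0.
  move=> y0 yT; rewrite (Ff y)// addrAC subrr add0r.
  rewrite [LHS]Rintegral_mkcond [RHS]Rintegral_mkcond; apply: eq_Rintegral => x _.
  rewrite !patchE !mem_setE !in_itv/=.
  by case: (leP 0 x) => x0 //=; case: (leP x y) => //= xy; rewrite (le_trans xy yT).
apply: cvg_trans; apply: near_eq_cvg; near=> h.
have ht : `|h| < t by near: h; exact: dnbhs0_lt.
have hT : `|h| < T - t by near: h; apply: dnbhs0_lt; rewrite subr_gt0.
have := ler_norm h; have := ler_norm (- h); rewrite normrN => h1 h2.
rewrite !E//; [by congr (_ * _); ring|exact: ltW..|lra|lra].
Unshelve. all: by end_near. Qed.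

End primitives.

(** * The solution operator *)

Section evolution.
Context {R : realType}.
Local Notation mu := (@lebesgue_measure R).
Variables (q : R -> R) (M : R) (lam : nat -> R) (phi : nat -> R -> R).
Hypothesis sys : eigensystem q M lam phi.
Implicit Types (F G : R -> R[i]) (b : nat -> R[i]) (u v w : distr R).

Local Notation multiplier := (@multiplier R phi).
Local Notation growth := (@growth R lam).

Lemma distrL2norm_eq u v : distr_eq q u v -> distrL2norm q u = distrL2norm q v.
Proof.
move=> uv; rewrite /distrL2norm; congr (ereal_inf (image _ _)).
by apply/seteqP; split => F [LF uF]; split => // G tG; rewrite -uF// uv.
Qed.

Lemma distrL2norm_multiplier u v b e r : isdistr q u -> 0 <= e -> growth e r b ->
  (forall F, testL q F -> v F = u (multiplier b F)) ->
  distrL2norm q v = esqrt (S2 (fun n => b n * distr_coefs phi u n)).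
Proof.
move=> du e0 be vE; rewrite (@distrL2norm_eq v (fun F => u (multiplier b F)))//.
rewrite (distrL2normE sys); last exact: (isdistr_multiplier sys du e0 be).
congr (esqrt (S2 _)); apply/funext => n.
by rewrite /distr_coefs (distr_multiplier_phi sys n du be).
Qed.

Lemma distr_eq_isdistr u v : isdistr q u -> (forall F, testL q F -> v F = u F) -> isdistr q v.
Proof.
move=> [ul uc] vu; split.
  by move=> c F G tF tG; rewrite !vu// ?ul//; exact: testL_lin sys _ _ _ tF tG.
move=> F tF e e0; have [m [d [d0 h]]] := uc F tF e e0; exists m, d; split => // G tG Gd.
by rewrite !vu//; exact: h.
Qed.

Lemma distr_multiplierZ u (c : R[i]) b e r F : isdistr q u -> testL q F -> 0 <= e -> growth e r b ->
  u (multiplier (fun n => c * b n) F) = c * u (multiplier b F).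
Proof.
move=> du tF e0 be.
have b0 : growth 0 0 (fun=> 0) by move=> n; rewrite cmod0 mul0r.
have := distr_multiplier_lin sys c du tF e0 (lexx 0) be b0.
rewrite (_ : (fun n => _) = (fun n => c * b n)); last by apply/funext => n; rewrite addr0.
move=> ->; rewrite (_ : u (multiplier (fun=> 0) F) = 0) ?addr0//.
rewrite (distr_coef sys du (multiplier_test sys b0 tF) (testL0 sys)) ?(distr0 sys du)//.
move=> n; have [_ ->] := multiplier_spec sys b0 tF.
have := coefZ sys 0 n tF; rewrite (_ : (fun x => _) = (fun=> 0)) => [->|]; first by rewrite !mul0r.
by apply/funext => x; rewrite mul0r.
Qed.

Lemma distr_multiplierB u b b' e e' r r' F : isdistr q u -> testL q F ->
  0 <= e -> 0 <= e' -> growth e r b -> growth e' r' b' ->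
  u (multiplier (fun n => b n - b' n) F) = u (multiplier b F) - u (multiplier b' F).
Proof.
move=> du tF e0 e0' be be'.
rewrite (_ : (fun n => _) = (fun n => -1 * b' n + b n)).
  by rewrite (distr_multiplier_lin sys _ du tF e0' e0 be' be) mulN1r addrC.
by apply/funext => n; rewrite mulN1r addrC.
Qed.

Variables (T s : R) (a : R -> R) (Ma : R).
Hypothesis aM : essbounded (I0T T) a Ma.

Definition symbol n := lam n `^ s.
Local Notation A := (clock T a).
Definition phase t n : R[i] := expi (symbol n * A t).
Definition velocity t n : R[i] := (symbol n)%:C * phase t n.

Let Ma0 : 0 <= Ma. Proof. by case: aM. Qed.

Lemma symbol_ge0 n : 0 <= symbol n. Proof. exact: powR_ge0. Qed.

Lemma growth_phase t : growth 1 0 (phase t).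
Proof. by move=> n; rewrite cmod_expi mul1r expr0. Qed.

Section bounds.
Variable r : nat.
Hypothesis sr : growth 1 r (fun n => (symbol n)%:C).

Lemma symbol_le n : symbol n <= lam n ^+ r.
Proof. by have := sr n; rewrite mul1r cmodR ger0_norm// symbol_ge0. Qed.

Lemma growth_velocity t : growth 1 r (velocity t).
Proof.
move=> n; rewrite cmodM cmod_expi mulr1; exact: sr.
Qed.

Lemma growth_phaseB x y : growth (2 * `|A y - A x|) r (fun n => phase y n - phase x n).
Proof.
move=> n; rewrite /phase (_ : symbol n * A y = symbol n * A x + symbol n * (A y - A x)); last by ring.
rewrite (le_trans (expi_lip _ _))// normrM (ger0_norm (symbol_ge0 n)) -mulrA ler_wpM2l//.
by rewrite mulrC ler_wpM2l// symbol_le.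
Qed.

Lemma growth_velocityB x y : growth (2 * `|A y - A x|) (r + r) (fun n => velocity y n - velocity x n).
Proof.
move=> n; rewrite /velocity -mulrBr cmodM exprD mulrCA.
apply: ler_pM; rewrite ?cmod_ge0//; last exact: growth_phaseB.
by rewrite cmodR ger0_norm ?symbol_ge0// symbol_le.
Qed.

(** The second order remainder of the exponential costs the square of lam^s. *)
Lemma growth_taylor x y : growth (2 * (A y - A x) ^+ 2) (r + r)
  (fun n => (phase y n - phase x n) - (0 +i* (A y - A x)) * velocity x n).
Proof.
move=> n; rewrite /velocity /phase (_ : symbol n * A y = symbol n * A x + symbol n * (A y - A x)); last by ring.
have -> : (0 +i* (A y - A x)) * ((symbol n)%:C * expi (symbol n * A x)) =
   (0 +i* (symbol n * (A y - A x))) * expi (symbol n * A x).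
  rewrite mulrA; congr (_ * _); apply/eqP; rewrite eq_complex /= !mul0r !mulr0 !subr0 add0r mulrC.
  by rewrite !eqxx.
rewrite (le_trans (expi_quad _ _))//.
have -> : 2 * (A y - A x) ^+ 2 * lam n ^+ (r + r) = 2 * ((lam n ^+ r) ^+ 2 * (A y - A x) ^+ 2).
  by rewrite exprD; ring.
rewrite exprMn ler_pM2l// ler_wpM2r ?sqr_ge0//.
by rewrite lerXn2r ?nnegrE ?symbol_ge0 ?symbol_le// exprn_ge0// (lam_ge0 sys).
Qed.

End bounds.

Variable u0 : distr R.
Hypothesis du0 : isdistr q u0.

(** The coefficients of u0 are multiplied by the phases; the multiplier is moved to the
    test function. *)
Definition evolve t : distr R := fun F => u0 (multiplier (phase t) F).
Definition velocity_of t : distr R := fun F => u0 (multiplier (velocity t) F).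

Lemma isdistr_evolve t : isdistr q (evolve t).
Proof. exact: isdistr_multiplier sys _ _ _ _ du0 ler01 (growth_phase t). Qed.

(** The bounds on the multipliers of the two differences, applied to u0. *)
Lemma evolve_taylor F : testL q F -> exists2 K, 0 <= K & forall x y,
  cmod (evolve y F - evolve x F - (0 +i* (A y - A x)) * velocity_of x F) <= K * (A y - A x) ^+ 2 /\
  cmod (velocity_of y F - velocity_of x F) <= K * `|A y - A x|.
Proof.
move=> tF; have [r sr] := growth_powR sys s.
have [K K0 Kb] := distr_multiplier_bound sys (r + r) du0 tF.
exists (2 * K) => [|x y]; first by rewrite mulr_ge0.
have e1 : 0 <= 2 * `|A y - A x| by rewrite mulr_ge0.
have e2 : 0 <= 2 * (A y - A x) ^+ 2 by rewrite mulr_ge0// sqr_ge0.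
split.
  have := Kb _ _ e2 (growth_taylor sr x y); rewrite mulrAC; congr (cmod _ <= _).
  have gv := growth_velocity sr x.
  have gz : growth `|A y - A x| r (fun n => (0 +i* (A y - A x)) * velocity x n).
    move=> n; rewrite cmodM ler_pM ?cmod_ge0//; last by have := gv n; rewrite mul1r.
    by rewrite (le_trans (cmod_le _))//= normr0 add0r.
  rewrite (distr_multiplierB du0 tF e1 (normr_ge0 _) (growth_phaseB sr x y) gz).
  rewrite (distr_multiplierB du0 tF ler01 ler01 (growth_phase y) (growth_phase x)).
  by rewrite (distr_multiplierZ _ du0 tF ler01 gv).
have := Kb _ _ e1 (growth_velocityB sr x y); rewrite mulrAC; congr (cmod _ <= _).
by rewrite (distr_multiplierB du0 tF ler01 ler01 (growth_velocity sr y) (growth_velocity sr x)).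
Qed.

Lemma clock_sq_le x y : (A y - A x) ^+ 2 <= Ma ^+ 2 * (y - x) ^+ 2.
Proof.
rewrite -[leLHS]real_normK ?num_real// -[X in _ * X]real_normK ?num_real// -exprMn.
by rewrite lerXn2r ?nnegrE ?mulr_ge0// clock_lip.
Qed.

Lemma evolve_AC F : 0 <= T -> testL q F ->
  AC_deriv 0 T (fun t => evolve t F) (fun t => (rate T a t)%:C * ((0 +i* 1) * velocity_of t F)).
Proof.
move=> T0 tF; have [K K0 KP] := evolve_taylor tF.
have H (X k : R -> R) :
  (forall x y, `|X y - X x - k x * (A y - A x)| <=
     cmod (evolve y F - evolve x F - (0 +i* (A y - A x)) * velocity_of x F)) ->
  (forall x y, `|k y - k x| <= cmod (velocity_of y F - velocity_of x F)) ->
  ACr 0 T X (fun t => rate T a t * k t).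
  move=> Xk kv; apply: (ACr_of_clock aM (C := K * Ma ^+ 2) (L := K * Ma)) => //.
  - by rewrite mulr_ge0// sqr_ge0.
  - by rewrite mulr_ge0.
  - move=> x y xy; apply: (le_trans (Xk _ _)); apply: (le_trans (KP x y).1).
    by rewrite -mulrA ler_wpM2l// clock_sq_le.
  - move=> x y; apply: (le_trans (kv _ _)); apply: (le_trans (KP x y).2).
    by rewrite -mulrA ler_wpM2l// clock_lip.
apply/AC_derivP => //; split.
  rewrite (_ : (fun x => complex.Re (_ * (_ * _))) = (fun t => rate T a t * (- complex.Im (velocity_of t F)))); last first.
    by apply/funext => t; case: (velocity_of t F) => c d /=; ring.
  apply: H => x y.
    apply: le_trans (cmod_Re _); rewrite le_eqVlt; apply/orP; left; apply/eqP.
    by congr `|_|; case: (evolve y F) (evolve x F) (velocity_of x F) => c d [e f] [g h] /=; ring.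
  apply: le_trans (cmod_Im _); rewrite le_eqVlt; apply/orP; left; apply/eqP.
  by rewrite -normrN; congr `|_|; case: (velocity_of y F) (velocity_of x F) => c d [e f] /=; ring.
rewrite (_ : (fun x => complex.Im (_ * (_ * _))) = (fun t => rate T a t * (complex.Re (velocity_of t F)))); last first.
  by apply/funext => t; case: (velocity_of t F) => c d /=; ring.
apply: H => x y.
  apply: le_trans (cmod_Im _); rewrite le_eqVlt; apply/orP; left; apply/eqP.
  by congr `|_|; case: (evolve y F) (evolve x F) (velocity_of x F) => c d [e f] [g h] /=; ring.
apply: le_trans (cmod_Re _); rewrite le_eqVlt; apply/orP; left; apply/eqP.
by congr `|_|; case: (velocity_of y F) (velocity_of x F) => c d [e f] /=; ring.
Qed.

Definition evolve_dt t : distr R := fun F => (0 +i* a t) * velocity_of t F.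

Lemma evolve_dtE t F : testL q F -> evolve_dt t F = u0 (multiplier (fun n => (0 +i* a t) * velocity t n) F).
Proof.
move=> tF; have [r sr] := growth_powR sys s.
by rewrite (distr_multiplierZ _ du0 tF ler01 (growth_velocity sr t)).
Qed.

Lemma growth_dt t r : growth 1 r (fun n => (symbol n)%:C) ->
  growth `|a t| r (fun n => (0 +i* a t) * velocity t n).
Proof.
move=> sr n; rewrite cmodM ler_pM ?cmod_ge0//; last by have := growth_velocity sr t n; rewrite mul1r.
by rewrite (le_trans (cmod_le _))//= normr0 add0r.
Qed.

Lemma isdistr_dt t : isdistr q (evolve_dt t).
Proof.
have [r sr] := growth_powR sys s.
apply: (distr_eq_isdistr (isdistr_multiplier sys du0 (normr_ge0 _) (growth_dt t sr))).
by move=> F tF; rewrite evolve_dtE.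
Qed.

Lemma evolve_derivative : {ae mu, forall t, 0 < t -> t < T -> distr_dt q evolve t (evolve_dt t)}.
Proof.
apply: aeS (clock_derivative aM) => t + t0 tT => /(_ t0 tT) At.
split; first exact: isdistr_dt.
move=> F tF; have [K K0 KP] := evolve_taylor tF.
pose V := velocity_of t F.
apply: (@squeeze_cvgr _ _ _ _ (fun=> 0)
  (fun h => K * Ma ^+ 2 * `|h| + `|h^-1 * (A (t + h) - A t) - a t| * cmod V)).
- near=> h; rewrite cmod_ge0 /=.
  have h0 : h != 0 by near: h; exact: nbhs_dnbhs_neq.
  have -> : (h^-1)%:C * (evolve (t + h) F - evolve t F) - evolve_dt t F =
    (h^-1)%:C * (evolve (t + h) F - evolve t F - (0 +i* (A (t + h) - A t)) * V) +
    (0 +i* (h^-1 * (A (t + h) - A t) - a t)) * V.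
    rewrite /evolve_dt -/V; case: (evolve (t + h) F) (evolve t F) V => c d [e f] [g i].
    by apply/eqP; rewrite eq_complex /=; apply/andP; split; apply/eqP; ring.
  rewrite (le_trans (cmodD _ _))// lerD//.
    rewrite cmodM cmodR.
    apply: (@le_trans _ _ (`|h^-1| * (K * (Ma ^+ 2 * h ^+ 2)))).
      rewrite ler_wpM2l//; apply: (le_trans (KP t (t + h)).1); rewrite ler_wpM2l//.
      by have := clock_sq_le t (t + h); rewrite [t + h]addrC addrK.
    rewrite -[h ^+ 2]real_normK ?num_real// normfV le_eqVlt; apply/orP; left; apply/eqP.
    by field; rewrite normr_eq0.
  rewrite cmodM ler_wpM2r ?cmod_ge0//.
  by rewrite (le_trans (cmod_le _))//= normr0 add0r.
- exact: cvg_cst.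
- rewrite -[X in _ --> X]addr0; apply: cvgD.
    rewrite -[X in _ --> X](mulr0 (K * Ma ^+ 2)); apply: cvgM; first exact: cvg_cst.
    apply: cvg_within_filter; have := @norm_continuous R R (0 : R).
    by rewrite /continuous_at normr0; exact.
  rewrite -[X in _ --> X](mul0r (cmod V)); apply: cvgM; last exact: cvg_cst.
  have := cvg_norm (cvgB At (cvg_cst (a t))); rewrite subrr normr0; exact.
Unshelve. all: by end_near. Qed.

Lemma evolve_equation t : distr_eq q
  (fun F => (0 +i* 1) * evolve_dt t F + (a t)%:C * distr_powL lam phi s (evolve t) F) (fun=> 0).
Proof.
move=> F tF; have [r sr] := growth_powR sys s.
rewrite /distr_powL /evolve powL_multiplier.
rewrite (distr_multiplier_comp sys du0 tF ler01 (growth_phase t) sr).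
have -> : (fun n => phase t n * (lam n `^ s)%:C) = velocity t.
  by apply/funext => n; rewrite mulrC.
rewrite -/(velocity_of t F) /evolve_dt; case: (velocity_of t F) => c d.
by apply/eqP; rewrite eq_complex /=; apply/andP; split; apply/eqP; ring.
Qed.

Lemma evolve0 : distr_eq q (evolve 0) u0.
Proof.
apply: (distr_ext sys (isdistr_evolve 0) du0) => n.
rewrite /evolve (distr_multiplier_phi sys n du0 (growth_phase 0)).
by rewrite /phase (clock0 aM) ?mulr0 ?expi0 ?mul1r.
Qed.

End evolution.

(** * Continuity in time and uniqueness *)

Section well_posedness.
Context {R : realType}.
Local Notation mu := (@lebesgue_measure R).
Variables (q : R -> R) (M : R) (lam : nat -> R) (phi : nat -> R -> R).
Hypothesis sys : eigensystem q M lam phi.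
Implicit Types (F G : R -> R[i]) (b c d : nat -> R[i]) (v w : distr R).

Local Notation multiplier := (@multiplier R phi).
Local Notation growth := (@growth R lam).

Lemma esqrt_cvg0 (X : Type) (U : set_system X) {FU : Filter U} (z : X -> \bar R) :
  (forall x, 0 <= z x)%E -> (forall x, z x < +oo)%E ->
  (forall e : R, 0 < e -> \forall x \near U, (z x <= e%:E)%E) ->
  esqrt (z x) @[x --> U] --> 0%E.
Proof.
move=> z0 zoo ze.
have zE x : z x = (fine (z x))%:E by rewrite fineK// ge0_fin_numE.
rewrite (_ : (fun x => _) = (fun x => (Num.sqrt (fine (z x)))%:E)); last first.
  by apply/funext => x; rewrite {1}zE.
apply: cvg_EFin; first exact: nearW.
apply/cvgrPdist_le => e e0; have := ze _ (exprn_gt0 2 e0).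
apply: filterS => x; rewrite zE lee_fin => zx.
rewrite sub0r normrN ger0_norm ?sqrtr_ge0//.
by rewrite -[leRHS]ger0_norm ?(ltW e0)// -sqrtr_sqr ler_wsqrtr.
Qed.

Variables (T s : R) (a : R -> R) (Ma : R).
Hypothesis aM : essbounded (I0T T) a Ma.
Local Notation A := (clock T a).
Local Notation phase := (phase lam T s a).

Let Ma0 : 0 <= Ma. Proof. by case: aM. Qed.

(** The phases have modulus one, so the modes beyond some N contribute at most four times
    the remainder of a convergent series; the finitely many other phases are Lipschitz
    in time. *)
Lemma S2_phase_small d t (e : R) : (S2 d < +oo)%E -> 0 < e ->
  \forall t' \near t, (S2 (fun n => ((phase t' n - phase t n) * d n)%R) <= e%:E)%E.
Proof.
move=> doo e0; have [r sr] := growth_powR sys s.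
pose x n := cmod (d n) ^+ 2; have x0 n : 0 <= x n by exact: sqr_ge0.
have [N NP] := nneseries_tail_small x0 doo (divr_gt0 e0 (ltr0n R 8)).
pose C := \sum_(0 <= n < N) (lam n ^+ r) ^+ 2 * x n.
have C0 : 0 <= C by apply: sumr_ge0 => n _; rewrite mulr_ge0// sqr_ge0.
have D0 : 0 < 8 * (Ma ^+ 2 + 1) * (C + 1).
  by rewrite !mulr_gt0// ltr_wpDl// sqr_ge0.
near=> t'.
have tt : (t' - t) ^+ 2 <= e / (8 * (Ma ^+ 2 + 1) * (C + 1)).
  have h : `|t - t'| <= Num.sqrt (e / (8 * (Ma ^+ 2 + 1) * (C + 1))).
    near: t'; apply: cvgr_dist_le; first exact: cvg_id.
    by rewrite sqrtr_gt0 divr_gt0.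
  rewrite -[leLHS]real_normK ?num_real// distrC.
  rewrite -[leRHS]sqr_sqrtr ?divr_ge0 ?(ltW e0) ?(ltW D0)//.
  by rewrite lerXn2r ?nnegrE ?sqrtr_ge0.
have lowb n : cmod ((phase t' n - phase t n) * d n) ^+ 2 <=
    4 * (A t' - A t) ^+ 2 * ((lam n ^+ r) ^+ 2 * x n).
  rewrite cmodM exprMn [leRHS]mulrA ler_wpM2r ?sqr_ge0//.
  have := growth_phaseB T a sr t t' n => h.
  have -> : 4 * (A t' - A t) ^+ 2 * lam n ^+ r ^+ 2 = (2 * `|A t' - A t| * lam n ^+ r) ^+ 2.
    by rewrite !exprMn real_normK ?num_real//; ring.
  by rewrite lerXn2r ?nnegrE ?cmod_ge0// (le_trans _ h) ?cmod_ge0.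
have highb n : cmod ((phase t' n - phase t n) * d n) ^+ 2 <= 4 * x n.
  rewrite cmodM exprMn ler_wpM2r ?sqr_ge0//.
  have h : cmod (phase t' n - phase t n) <= 2.
    by rewrite (le_trans (cmodD _ _))// cmodN !cmod_expi.
  by rewrite (_ : 4 = 2 ^+ 2); [rewrite lerXn2r ?nnegrE ?cmod_ge0|ring].
apply: lime_le; first by apply: is_cvg_nneseries => k _ _; rewrite lee_fin sqr_ge0.
apply: nearW => n; rewrite sumEFin lee_fin.
apply: (@le_trans _ _ (\sum_(0 <= k < maxn n N) cmod ((phase t' k - phase t k) * d k) ^+ 2)).
  rewrite [leRHS](big_cat_nat (n := n)) ?leq_maxl//= lerDl.
  by apply: sumr_ge0 => k _; exact: sqr_ge0.
rewrite (big_cat_nat (n := N)) ?leq_maxr//=.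
have h1 : \sum_(0 <= k < N) cmod ((phase t' k - phase t k) * d k) ^+ 2 <= 4 * (A t' - A t) ^+ 2 * C.
  by rewrite /C mulr_sumr; apply: ler_sum => k _; exact: lowb.
have h2 : \sum_(N <= k < maxn n N) cmod ((phase t' k - phase t k) * d k) ^+ 2 <= 4 * (e / 8).
  apply: (@le_trans _ _ (4 * \sum_(N <= k < maxn n N) x k)).
    by rewrite mulr_sumr; apply: ler_sum => k _; exact: highb.
  by rewrite ler_wpM2l// NP.
have h3 : 4 * (A t' - A t) ^+ 2 * C <= e / 2.
  have h := clock_sq_le aM t t'.
  apply: (@le_trans _ _ (4 * ((Ma ^+ 2 + 1) * (e / (8 * (Ma ^+ 2 + 1) * (C + 1)))) * (C + 1))).
    apply: ler_pM => //; last by rewrite lerDl.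
      by apply: mulr_ge0 => //; exact: sqr_ge0.
    rewrite ler_pM2l// (le_trans h)//; apply: ler_pM => //; try exact: sqr_ge0.
    by rewrite lerDl.
  rewrite le_eqVlt; apply/orP; left; apply/eqP; field.
  by rewrite !gt_eqF// ltr_wpDl// sqr_ge0.
rewrite (le_trans (lerD h1 h2))// (le_trans (lerD h3 (lexx _)))//; lra.
Unshelve. all: by end_near. Qed.

Section orbit.
Variables (k : R) (u0 : distr R).
Hypothesis du0 : isdistr q u0.
Local Notation c := (distr_coefs phi u0).
Local Notation u := (evolve lam phi T s a u0).

Lemma Wnorm_S2 v b e r : 0 <= e -> growth e r b ->
  (forall F, testL q F -> v F = u0 (multiplier b F)) ->
  Wnorm q lam phi k v = esqrt (S2 (fun n => b n * ((lam n `^ (k / 2))%:C * c n))).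
Proof.
move=> e0 be vE; have [r' sr'] := growth_powR sys (k / 2).
rewrite /Wnorm (distrL2norm_multiplier sys du0 (mulr_ge0 e0 ler01) (growthM e0 be sr')).
  by congr (esqrt (S2 _)); apply/funext => n; rewrite mulrA.
move=> F tF; rewrite /distr_powL powL_multiplier vE; last exact: multiplier_test sys _ _ _ _ sr' tF.
by rewrite (distr_multiplier_comp sys du0 tF e0 be sr').
Qed.

Lemma growth1 : growth 1 0 (fun=> 1).
Proof. by move=> n; rewrite mul1r expr0 cmodR normr1. Qed.

Lemma distr_multiplier1 v F : isdistr q v -> testL q F -> v (multiplier (fun=> 1) F) = v F.
Proof.
move=> dv tF; apply: (distr_coef sys dv (multiplier_test sys growth1 tF) tF) => n.
by have [_ ->] := multiplier_spec sys growth1 tF; rewrite mul1r.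
Qed.

Lemma Wnorm_u0 : Wnorm q lam phi k u0 = esqrt (S2 (fun n => (lam n `^ (k / 2))%:C * c n)).
Proof.
rewrite (@Wnorm_S2 _ (fun=> 1) 1 0 ler01 growth1) => [|F tF]; last by rewrite distr_multiplier1.
by congr (esqrt (S2 _)); apply/funext => n; rewrite mul1r.
Qed.

Lemma Wnorm_evolve t : Wnorm q lam phi k (u t) = Wnorm q lam phi k u0.
Proof.
rewrite (@Wnorm_S2 _ (phase t) 1 0 ler01 (growth_phase _ _ _ _ t))// Wnorm_u0.
by apply: eq_esqrt_S2 => n; rewrite cmodM cmod_expi mul1r.
Qed.

Hypothesis Wu0 : inW q lam phi k u0.

Lemma inW_S2 : (S2 (fun n => ((lam n `^ (k / 2))%:C * c n)%R) < +oo)%E.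
Proof.
have [_ [psi [Lpsi psiE]]] := Wu0; have [r sr] := growth_powR sys (k / 2).
rewrite (_ : (fun n => _) = (fun n => coef phi n psi)).
  by rewrite (parsevalC (orthonormal_phi sys))// ltry.
apply/funext => n; rewrite -distr_of_coef -psiE; last exact: testL_phi sys n.
by rewrite /distr_powL powL_multiplier (distr_multiplier_phi sys n du0 sr).
Qed.

(** The W^k norm of u(t') - u(t) is the l^2 norm of a fixed square summable sequence
    multiplied by the differences of the phases. *)
Lemma contW_evolve : contW q lam phi T k u.
Proof.
move=> t _; have [r sr] := growth_powR sys (k / 2); split.
  split; first exact: (isdistr_evolve sys T s a du0 t).
  have gp := growth_phase lam T s a t.
  have uE F : testL q F -> distr_powL lam phi (k / 2) (u t) F =
      u0 (multiplier (fun n => phase t n * (lam n `^ (k / 2))%:C) F).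
    by move=> tF; rewrite /distr_powL powL_multiplier /evolve (distr_multiplier_comp sys du0 tF ler01 gp sr).
  have gg := growthM ler01 gp sr.
  have du : isdistr q (distr_powL lam phi (k / 2) (u t)).
    have h := isdistr_multiplier sys du0 (mulr_ge0 ler01 ler01) gg.
    by apply: (distr_eq_isdistr sys h) => F tF; exact: uE.
  have [|psi Lpsi psiE] := distr_repr sys du; last by exists psi.
  apply: le_lt_trans inW_S2.
  rewrite -[leRHS]mul1e -[X in (X%:E * _)%E](expr1n _ 2%N); apply: le_S2 => n.
  rewrite /distr_coefs uE; last exact: testL_phi sys n.
  by rewrite (distr_multiplier_phi sys n du0 gg) !cmodM cmod_expi !mul1r.
have g2 t' : growth (2 * `|A t' - A t|) (projT1 (cid (growth_powR sys s))) (fun n => phase t' n - phase t n).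
  exact: growth_phaseB (projT2 (cid (growth_powR sys s))) t t'.
have uE t' F : testL q F -> u t' F - u t F = u0 (multiplier (fun n => phase t' n - phase t n) F).
  by move=> tF; rewrite (distr_multiplierB sys du0 tF ler01 ler01 (growth_phase _ _ _ _ t') (growth_phase _ _ _ _ t)).
have e0 t' : 0 <= 2 * `|A t' - A t| by rewrite mulr_ge0.
under eq_cvg => t' do rewrite (Wnorm_S2 (e0 t') (g2 t') (uE t')).
apply: cvg_within_filter; apply: esqrt_cvg0.
- by move=> t'; exact: S2_ge0.
- move=> t'; apply: (@le_lt_trans _ _ ((2 ^+ 2)%:E * S2 (fun n => ((lam n `^ (k / 2))%:C * c n)%R))%E).
    apply: le_S2 => n; rewrite cmodM ler_wpM2r ?cmod_ge0//.
    by rewrite (le_trans (cmodD _ _))// cmodN !cmod_expi.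
  have := inW_S2; have := S2_ge0 (fun n => ((lam n `^ (k / 2))%:C * c n)%R).
  by case: (S2 _) => // x _ _; rewrite -EFinM ltry.
- by move=> e e1; exact: S2_phase_small inW_S2 e1.
Qed.

Lemma evolve_sol : 0 < T -> schrodinger_sol q lam phi T s k a u0 u.
Proof.
move=> T0; split.
- exact: contW_evolve.
- move=> F tF; exists (fun t => (rate T a t)%:C * ((0 +i* 1) * velocity_of lam phi T s a u0 t F)).
  exact: (evolve_AC sys s aM du0 (ltW T0) tF).
- have neq := aeI (fun t (h0 : t != 0) (hT : t != T) => conj h0 hT) (ae_neq 0) (ae_neq T).
  apply: aeI (evolve_derivative sys s aM du0) neq => t dt [t0 tT].
  rewrite /I0T/= in_itv/= => /andP[tge0 tleT].
  exists (evolve_dt lam phi T s a u0 t); split; last exact: evolve_equation sys _ _ _ _ du0 t.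
  by apply: dt; rewrite lt_neqAle ?tge0 ?tleT ?andbT// eq_sym.
- exact: (evolve0 sys s aM du0).
Qed.

End orbit.

(** Let z be a coefficient of v - u.  It is an indefinite integral and its derivative is
    i lam_n^s a z almost everywhere, so (|z|^2)' = 2 Re (conj(z) z') = 0 and |z|^2
    keeps its initial value 0. *)
Lemma sol_unique (k : R) (u0 : distr R) (u v : R -> distr R) : 0 < T -> schrodinger_sol q lam phi T s k a u0 u ->
  schrodinger_sol q lam phi T s k a u0 v -> forall t, I0T T t -> distr_eq q (v t) (u t).
Proof.
move=> T0 [cu ACu eu u0E] [cv ACv ev v0E] t tI.
have [[[dut _] _] [[dvt _] _]] := (cu t tI, cv t tI).
apply: (distr_ext sys dvt dut) => n.
have tp := testL_phi sys n.
have [gu gAC] := ACu _ tp; have [gv gvAC] := ACv _ tp.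
pose m := lam n `^ s.
have T0' := ltW T0.
have [ur ui] := (AC_derivP _ _ T0').1 gAC; have [vr vi] := (AC_derivP _ _ T0').1 gvAC.
(* almost everywhere the integrand g is the limit of the difference quotients, and so is
   the time derivative w in the equation *)
have D (z : R -> distr R) (g : R -> R[i]) : contW q lam phi T k z ->
  {ae leb, forall t, I0T T t -> exists w, distr_dt q z t w /\
     distr_eq q (fun f => (0 +i* 1) * w f + (a t)%:C * distr_powL lam phi s (z t) f) (fun=> 0)} ->
  ACr 0 T (fun t => complex.Re (z t (cfun (phi n)))) (fun t => complex.Re (g t)) ->
  ACr 0 T (fun t => complex.Im (z t (cfun (phi n)))) (fun t => complex.Im (g t)) ->
  {ae mu, forall t, 0 < t -> t < T ->
     complex.Re (g t) = - (a t * m * complex.Im (z t (cfun (phi n)))) /\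
     complex.Im (g t) = a t * m * complex.Re (z t (cfun (phi n)))}.
  move=> cz ez zr zi.
  apply: aeI ez (aeI (fun t h1 h2 => conj h1 h2) (ACr_derivative zr) (ACr_derivative zi)).
  move=> y zy [yr yi] y0 yT; have [yr' yi'] := (yr y0 yT, yi y0 yT).
  have yI : I0T T y by rewrite /I0T/= in_itv/= !ltW.
  have [w [[dw /(_ _ tp) wd] /(_ _ tp) wE]] := zy yI.
  have [[dz _] _] := cz y yI; have [r sr] := growth_powR sys s.
  move: wE; rewrite /distr_powL powL_multiplier (distr_multiplier_phi sys n dz sr) -/m => wE.
  have wr : h^-1 * (complex.Re (z (y + h) (cfun (phi n))) - complex.Re (z y (cfun (phi n)))) @[h --> 0^'] --> complex.Re (w (cfun (phi n))).
    apply/cvgrPdist_le => /= e e0; move/cvgrPdist_le : wd => /(_ e e0); apply: filterS => h.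
    rewrite sub0r normrN ger0_norm ?cmod_ge0//; apply: le_trans.
    rewrite distrC; apply: le_trans (cmod_Re _).
    by case: (z (y + h) _) (z y _) (w _) => a1 b1 [a2 b2] [a3 b3] /=; rewrite !mul0r subr0.
  have wi : h^-1 * (complex.Im (z (y + h) (cfun (phi n))) - complex.Im (z y (cfun (phi n)))) @[h --> 0^'] --> complex.Im (w (cfun (phi n))).
    apply/cvgrPdist_le => /= e e0; move/cvgrPdist_le : wd => /(_ e e0); apply: filterS => h.
    rewrite sub0r normrN ger0_norm ?cmod_ge0//; apply: le_trans.
    rewrite distrC; apply: le_trans (cmod_Im _).
    by case: (z (y + h) _) (z y _) (w _) => a1 b1 [a2 b2] [a3 b3] /=; rewrite !mul0r addr0.
  have -> : complex.Re (g y) = complex.Re (w (cfun (phi n))) by exact: (cvg_unique _ yr' wr).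
  have -> : complex.Im (g y) = complex.Im (w (cfun (phi n))) by exact: (cvg_unique _ yi' wi).
  move: wE; case: (w _) (z y _) => a1 b1 [a2 b2] /eqP; rewrite eq_complex /= => /andP[/eqP h1 /eqP h2].
  by split; lra.
have Du := D u gu cu eu ur ui; have Dv := D v gv cv ev vr vi.
move: tI; rewrite /I0T/= in_itv/= => /andP[t0 tT].
pose p x := complex.Re (v x (cfun (phi n))) - complex.Re (u x (cfun (phi n))).
pose g x := complex.Im (v x (cfun (phi n))) - complex.Im (u x (cfun (phi n))).
have ACB (f1 f2 h1 h2 : R -> R) : ACr 0 T f1 h1 -> ACr 0 T f2 h2 ->
    ACr 0 t (fun x => f1 x - f2 x) (fun x => h1 x - h2 x).
  move=> [i1 E1] [i2 E2]; have j1 := integr_sub (lexx 0) tT i1; have j2 := integr_sub (lexx 0) tT i2.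
  split; first exact: integrB.
  move=> x x0 xt; rewrite E1 ?(le_trans xt)// E2 ?(le_trans xt)// RintegralB//.
  - ring.
  - exact: integr_sub j1.
  - exact: integr_sub j2.
have pA := ACB _ _ _ _ vr ur; have gA := ACB _ _ _ _ vi ui.
have pp := ACr_parts t0 pA pA; have gg := ACr_parts t0 gA gA.
have z0 : v 0 (cfun (phi n)) = u 0 (cfun (phi n)) by rewrite v0E ?u0E.
have ip1 := ACr_mul_integrable t0 pA pA; have ip2 := ACr_mul_integrable t0 gA gA.
have sum0 : p t * p t + g t * g t = 0.
  move: pp gg; rewrite z0 !subrr !mulr0 !subr0 -/(p t) -/(g t) => <- <-.
  have fix1 (f h : R -> R) : mu.-integrable `[0, t] (EFin \o (fun x => h x * f x)) ->
     mu.-integrable `[0, t] (EFin \o (fun x => h x * f x + f x * h x)).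
    move=> hf; apply: integrD => //.
    by rewrite (_ : (fun x => f x * h x) = (fun x => h x * f x))//; apply/funext => x; rewrite mulrC.
  rewrite -RintegralD//; [|exact: fix1..].
  transitivity (\int[mu]_(x in `[0, t]) (0 : R)); last by rewrite Rintegral_cst// mul0r.
  apply: ae_eq_Rintegral_itv.
  - apply: integrD => //; exact: fix1.
  - apply/integrableP; split; first exact/measurable_EFinP.
    by under eq_integral do rewrite /= normr0; rewrite integral0 ltry.
  - have neq := aeI (fun t (h0 : t != 0) (hT : t != T) => conj h0 hT) (ae_neq 0) (ae_neq T).
    apply: aeI neq (aeI (fun t h1 h2 => conj h1 h2) Du Dv) => x [xn0 xnT] [dux dvx] x0 xt.
    have x0' : 0 < x by rewrite lt_neqAle x0 eq_sym xn0.
    have xT' : x < T by rewrite lt_neqAle xnT (le_trans xt).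
    have [-> ->] := dux x0' xT'; have [-> ->] := dvx x0' xT'.
    ring.
have p0 := sqr_ge0 (p t); have g0 := sqr_ge0 (g t).
have : p t ^+ 2 == 0 by rewrite !expr2 in p0 g0 *; apply/eqP; lra.
have : g t ^+ 2 == 0 by rewrite !expr2 in p0 g0 *; apply/eqP; lra.
rewrite !sqrf_eq0 !subr_eq0 => /eqP hi /eqP hr.
by apply/eqP; rewrite eq_complex hi hr !eqxx.
Qed.

End well_posedness.

(** * Weak derivatives in space *)

Section space_derivatives.
Context {R : realType}.
Local Notation mu := (@lebesgue_measure R).
Local Notation integr D f := (mu.-integrable D (EFin \o f)).
Local Notation L2 f := (inLp I01 2%:E f).
Local Notation re F := (fun x => complex.Re (F x)).
Local Notation im F := (fun x => complex.Im (F x)).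
Implicit Types (f g h w : R -> R).

Lemma ACr_derive1 f : (forall x, derivable f x 1) -> (forall x, derivable (derive1 f) x 1) ->
  ACr 0 1 f (derive1 f).
Proof.
move=> df ddf.
have cont (k : R -> R) : (forall x, derivable k x 1) -> continuous k.
  by move=> dk x; apply: differentiable_continuous; apply/derivable1_diffP.
have cf := cont _ df; have cdf := cont _ ddf.
split.
  apply: continuous_compact_integrable; first exact: segment_compact.
  exact: continuous_subspaceT.
move=> x x0 x1; move: x0; rewrite le_eqVlt => /predU1P[<-|x0].
  by rewrite set_itv1 Rintegral_set1 addr0.
have := @continuous_FTC2 R (derive1 f) f 0 x x0.
rewrite /Rintegral => ->; first by rewrite -EFinB /= addrC subrK.
- exact: continuous_subspaceT.
- split; first by move=> y _; exact: df.
  + by apply: cvg_at_right_filter; exact: cf.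
  + by apply: cvg_at_left_filter; exact: cf.
- by [].
Qed.

Lemma Ccinfty_AC w n : Ccinfty w -> ACr 0 1 (derive1n n w) (derive1n n.+1 w).
Proof.
move=> [dw _]; rewrite derive1nS; apply: ACr_derive1; first exact: dw.
by have := dw n.+1; rewrite derive1nS.
Qed.

Lemma Ccinfty_end w : Ccinfty w -> w 0 = 0 /\ w 1 = 0.
Proof.
move=> [_ [a [b [a0 b1 wab]]]]; split; apply/eqP/negPn/negP => /wab /andP[].
  by rewrite leNgt a0.
by move=> _; rewrite leNgt b1.
Qed.

Lemma Ccinfty_L2 w n : Ccinfty w -> L2 (derive1n n w).
Proof. by move=> /(Ccinfty_AC n)/ACr_L2. Qed.

Lemma parts01 (F f G g : R -> R) : ACr 0 1 F f -> ACr 0 1 G g ->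
  F 0 * G 0 = 0 -> F 1 * G 1 = 0 -> ip f G = - ip F g.
Proof.
move=> Ff Gg e0 e1; have := ACr_parts ler01 Ff Gg; rewrite e0 e1 subrr.
have i1 := ACr_mul_integrable ler01 Ff Gg.
have i2 : integr `[0, 1] (fun t => F t * g t).
  have := ACr_mul_integrable ler01 Gg Ff.
  by rewrite (_ : (fun t => g t * F t) = (fun t => F t * g t))//; apply/funext => t; rewrite mulrC.
rewrite RintegralD// -!Rintegral_I01// => /eqP; rewrite addr_eq0 => /eqP.
by rewrite /ip.
Qed.

Variables (q : R -> R) (M : R) (lam : nat -> R) (phi : nat -> R -> R).
Hypothesis sys : eigensystem q M lam phi.
Let qM : essbounded I01 q M. Proof. by case: sys. Qed.
Let q0 : {ae mu, forall x, I01 x -> 0 <= q x}. Proof. by case: sys. Qed.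

Lemma isLr_weak1 f g w : isLr q f g -> Ccinfty w ->
  ip f (derive1n 1 w) = - ip (dgreen (source q f g)) w.
Proof.
move=> fg cw; have [Lf Lg fE] := fg.
have hi := L2_integrable (L2_source qM Lf Lg).
rewrite (ip_ae_eq Lf (L2_green (L2_source qM Lf Lg)) (Ccinfty_L2 1 cw) fE).
have gA := ACr_green hi; have wA := Ccinfty_AC 0 cw.
rewrite (parts01 gA wA) ?opprK//; first by rewrite green0 mul0r.
by rewrite green1// mul0r.
Qed.

Lemma isLr_weak2 f g w : isLr q f g -> Ccinfty w ->
  ip f (derive1n 2 w) = ip (fun x => q x * f x - g x) w.
Proof.
move=> fg cw; have [Lf Lg fE] := fg; have Ls := L2_source qM Lf Lg.
have hi := L2_integrable Ls.
rewrite (ip_ae_eq Lf (L2_green Ls) (Ccinfty_L2 2 cw) fE).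
have gA := ACr_green hi; have dA := ACr_dgreen hi.
have wA := Ccinfty_AC 0 cw; have wA' := Ccinfty_AC 1 cw.
have [w0 w1] := Ccinfty_end cw.
have := parts01 gA wA'; rewrite green0 green1// !mul0r => /(_ erefl erefl) h1.
have := parts01 dA wA; rewrite /= w0 w1 !mulr0 => /(_ erefl erefl) h2.
rewrite -[LHS]opprK -h1 -h2.
apply: eq_ip => x xI; rewrite patchE mem_set// /source; ring.
Qed.

(** The energy of a block of the expansion of f is at most the corresponding block of the
    series on the right, so the derivatives d_N of the partial sums are Cauchy.  The
    factor 2 comes from h = d_N - (d_N - h) and (x + y)^2 <= 2 (x^2 + y^2). *)
Lemma weak_derivative f : L2 f ->
  (\sum_(0 <= n <oo) (lam n * ip f (phi n) ^+ 2)%:E < +oo)%E ->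
  exists2 h, L2 h /\ ((ip h h)%:E <= 2%:E * \sum_(0 <= n <oo) (lam n * ip f (phi n) ^+ 2)%:E)%E &
   forall w, Ccinfty w -> ip f (derive1n 1 w) = - ip h w.
Proof.
move=> Lf Eoo; pose c n := ip f (phi n).
pose x n := lam n * c n ^+ 2.
have x0 n : 0 <= x n by rewrite mulr_ge0 ?sqr_ge0// (lam_ge0 sys).
pose f_ N := combination phi c 0 N; pose g_ N := combination phi (fun n => lam n * c n) 0 N.
have fg N : isLr q (f_ N) (g_ N) := isLr_combination sys c N.
pose d_ N := dgreen (source q (f_ N) (g_ N)).
have Lphi n : L2 (phi n) := L2_phi sys n.
have onb := orthonormal_phi sys.
have Lf_ N : L2 (f_ N) by exact: (L2_combination onb).
have Lg_ N : L2 (g_ N) by exact: (L2_combination onb).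
have Ls N : L2 (source q (f_ N) (g_ N)) by exact: (L2_source qM).
have Ld N : L2 (d_ N) by exact: L2_dgreen.
have energy m n : (m <= n)%N -> ip (fun t => d_ n t - d_ m t) (fun t => d_ n t - d_ m t) <=
    \sum_(m <= k < n) x k.
  move=> mn; have fgmn := isLr_lin qM 1 (-1) (fg n) (fg m).
  have := isLr_energy qM q0 fgmn.
  have E t : I01 t -> dgreen (source q (fun x => 1 * f_ n x + -1 * f_ m x) (fun x => 1 * g_ n x + -1 * g_ m x)) t = d_ n t - d_ m t.
    move=> /I01_itv/=; rewrite in_itv/= => /andP[_ t1].
    rewrite (_ : source _ _ _ = (fun t => 1 * source q (f_ n) (g_ n) t + (-1) * source q (f_ m) (g_ m) t)).
      by rewrite (dgreenZD _ _ (L2_integrable (Ls n)) (L2_integrable (Ls m)) t1) mul1r mulN1r.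
    by apply/funext => y; rewrite /source; ring.
  rewrite (@eq_ip _ _ (fun t => d_ n t - d_ m t) _ (fun t => d_ n t - d_ m t)); last first.
    by move=> t tI; rewrite E.
  move=> h; apply: (le_trans h).
  rewrite (@eq_ip _ _ (combination phi (fun k => lam k * c k) m n) _ (combination phi c m n)).
    rewrite (ip_combination_combination onb) le_eqVlt; apply/orP; left; apply/eqP.
    by apply: eq_bigr => k _; rewrite /x; ring.
  by move=> t _; rewrite !mul1r !mulN1r /g_ /f_ !combinationB.
have E0 N : ip (d_ N) (d_ N) <= \sum_(0 <= k < N) x k.
  apply: (le_trans (isLr_energy qM q0 (fg N))).
  rewrite (ip_combination_combination onb) le_eqVlt; apply/orP; left; apply/eqP.
  by apply: eq_bigr => k _; rewrite /x; ring.
have cd e : 0 < e -> exists N, forall m n, (N <= m)%N -> (N <= n)%N ->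
     ip (fun x => d_ m x - d_ n x) (fun x => d_ m x - d_ n x) <= e.
  move=> e0; have [N NP] := nneseries_tail_small x0 Eoo e0; exists N => m n Nm Nn.
  have [mn|/ltnW nm] := leqP m n; last by apply: (le_trans (energy _ _ nm)); exact: NP.
  rewrite (_ : ip _ _ = ip (fun x => d_ n x - d_ m x) (fun x => d_ n x - d_ m x)).
    by apply: (le_trans (energy _ _ mn)); exact: NP.
  by apply: eq_ip => t _; ring.
have [h Lh hd] := L2_complete Ld cd.
exists h.
  split => //.
  set S := (\sum_(0 <= n <oo) _)%E in Eoo *.
  have S0 : (0 <= S)%E by apply: nneseries_ge0 => n _ _; rewrite lee_fin x0.
  have SE : S = (fine S)%:E by rewrite fineK// ge0_fin_numE.
  rewrite SE -EFinM lee_fin; apply/ler_addgt0Pl => e e0.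
  have [N NP] := hd (e / 2) (divr_gt0 e0 (ltr0n R 2)).
  have Ldh : L2 (fun t => d_ N t - h t) by exact: L2B.
  have LN : L2 (fun t => - (d_ N t - h t)) by exact: L2N.
  rewrite (@eq_ip _ h (fun t => d_ N t + - (d_ N t - h t)) h (fun t => d_ N t + - (d_ N t - h t))); last first.
    by move=> t _; ring.
  apply: (le_trans (ipD_le (Ld N) LN)).
  have h1 : ip (d_ N) (d_ N) <= fine S.
    rewrite (le_trans (E0 N))// -lee_fin -SE -sumEFin.
    by apply: nneseries_lim_ge => k _ _; rewrite lee_fin x0.
  have h2 : ip (fun t => - (d_ N t - h t)) (fun t => - (d_ N t - h t)) <= e / 2.
    by rewrite ipNl// ipNr// opprK NP.
  lra.
move=> w cw; have Lw := Ccinfty_L2 0 cw; have Lw1 := Ccinfty_L2 1 cw.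
apply/eqP; rewrite -subr_eq0 -normr_le0; apply/ler_addgt0Pl => e e0; rewrite addr0.
pose K := ip (derive1n 1 w) (derive1n 1 w) + ip w w + 1.
have K0 : 0 < K by rewrite ltr_wpDl// addr_ge0 ?ip_ge0.
have e1 : 0 < e ^+ 2 / (4 * K) by rewrite divr_gt0 ?exprn_gt0// mulr_gt0.
have [N1 H1] := residual_small sys Lf e1; have [N2 H2] := hd _ e1.
pose N := maxn N1 N2; have {}H1 := H1 N (leq_maxl _ _); have {}H2 := H2 N (leq_maxr _ _).
have -> : ip f (derive1n 1 w) - - ip h w =
   - ip (fun t => f_ N t - f t) (derive1n 1 w) - ip (fun t => d_ N t - h t) w.
  by rewrite (ipBl (Lf_ N) Lf Lw1) (ipBl (Ld N) Lh Lw) (isLr_weak1 (fg N) cw); ring.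
have B k v : L2 k -> L2 v -> ip k k <= e ^+ 2 / (4 * K) -> ip v v <= K -> `|ip k v| <= e / 2.
  move=> Lk Lv ke vK; rewrite -[leRHS]ger0_norm ?divr_ge0 ?(ltW e0)// -!sqrtr_sqr ler_wsqrtr//.
  apply: (le_trans (ip_CS Lk Lv)); apply: (@le_trans _ _ (e ^+ 2 / (4 * K) * K)).
    by apply: ler_pM; rewrite ?ip_ge0.
  by rewrite le_eqVlt; apply/orP; left; apply/eqP; field; rewrite gt_eqF.
rewrite -opprD normrN (le_trans (ler_normD _ _))// [leRHS]splitr lerD//.
  apply: B => //; first exact: L2B.
  by rewrite /K -addrA lerDl addr_ge0 ?ip_ge0.
apply: B => //; first exact: L2B.
by rewrite /K -addrA addrCA lerDl addr_ge0 ?ip_ge0.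
Qed.

Lemma distr_derivP n (F G : R -> R[i]) : (forall w, Ccinfty w ->
    ip (re F) (derive1n n w) = (-1) ^+ n * ip (re G) w /\
    ip (im F) (derive1n n w) = (-1) ^+ n * ip (im G) w) -> distr_deriv n F G.
Proof.
move=> H w /H[h1 h2].
have P (X : R -> R[i]) (y : R -> R) : pairing X (cfun y) = ip (re X) y +i* ip (im X) y.
  exact: (coefE (fun=> y) 0%N X).
rewrite !P h1 h2 -(rmorph1 (real_complex R)) -rmorphN -rmorphXn.
by apply/eqP; rewrite eq_complex /= !mul0r subr0 addr0 !eqxx.
Qed.

Lemma distr_dx_le n v (F G : R -> R[i]) : inL2 F -> inL2 G -> distr_eq q v (distr_of F) ->
  distr_deriv n F G -> (distr_dx_L2norm q n v <= (Num.sqrt (normsq G))%:E)%E.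
Proof.
move=> LF LG vF FG; rewrite -L2normE//; apply: ereal_inf_lbound.
by exists G => //; split => //; exists F.
Qed.

(** This absorbs the factors 2 of the quadratic estimates into the constant of the
    theorem. *)
Lemma sqrt_sum_le (x y z : R) : 0 <= x -> 0 <= y -> z <= 2 * (x ^+ 2 + y ^+ 2) ->
  Num.sqrt z <= 2 * (x + y).
Proof.
move=> x0 y0 zxy; rewrite -[leRHS]ger0_norm ?mulr_ge0 ?addr_ge0// -sqrtr_sqr ler_wsqrtr//.
apply: (le_trans zxy); nra.
Qed.

(** The weights of the W^1 norm are the square roots of the lam_n. *)
Lemma dx_bound v : isdistr q v ->
  (distr_dx_L2norm q 1 v <= 2%:E * esqrt (S2 (fun n => ((lam n `^ (1 / 2))%:C * distr_coefs phi v n)%R)))%E.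
Proof.
move=> dv; set S := S2 _.
have S0 : (0 <= S)%E by exact: S2_ge0.
case SE : S => [r| |]; last by move: S0; rewrite SE.
  2: by rewrite /= gt0_muley ?lte_fin// leey.
have lam12 n : (lam n `^ (1 / 2)) ^+ 2 = lam n.
  by rewrite div1r powR12_sqrt ?(lam_ge0 sys)// sqr_sqrtr// (lam_ge0 sys).
have SE' : S = (\sum_(0 <= n <oo) (lam n * complex.Re (distr_coefs phi v n) ^+ 2)%:E +
  \sum_(0 <= n <oo) (lam n * complex.Im (distr_coefs phi v n) ^+ 2)%:E)%E.
  rewrite /S S2_split; congr (_ + _)%E; apply: eq_eseriesr => n _; congr (_%:E);
    by case: (distr_coefs phi v n) => c d /=; rewrite -[in RHS]lam12 mul0r ?subr0 ?addr0 exprMn.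
(* as lam >= 1, the L^2 norm is finite if the weighted norm is *)
have voo : (S2 (distr_coefs phi v) < +oo)%E.
  apply: (@le_lt_trans _ _ S); last by rewrite SE ltry.
  rewrite -[leRHS]mul1e -[X in (X%:E * _)%E](expr1n _ 2%N); apply: le_S2 => n.
  rewrite [leRHS]mul1r cmodM -[leLHS]mul1r; apply: ler_wpM2r; first exact: cmod_ge0.
  rewrite cmodR ger0_norm ?powR_ge0//.
  by rewrite -[leLHS](powRr0 (lam n)) ler_powR ?(lam_ge1 sys)// divr_ge0.
have [F LF vF] := distr_repr sys dv voo.
have coefs n : distr_coefs phi v n = ip (re F) (phi n) +i* ip (im F) (phi n).
  by rewrite /distr_coefs vF ?distr_of_coef ?coefE//; exact: testL_phi sys n.
have [Fr Fi] := LF.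
pose Sr := (\sum_(0 <= n <oo) (lam n * ip (re F) (phi n) ^+ 2)%:E)%E.
pose Si := (\sum_(0 <= n <oo) (lam n * ip (im F) (phi n) ^+ 2)%:E)%E.
have nn (k : nat -> R) : (0 <= \sum_(0 <= n <oo) (lam n * k n ^+ 2)%:E)%E.
  by apply: nneseries_ge0 => n _ _; rewrite lee_fin mulr_ge0 ?sqr_ge0// (lam_ge0 sys).
have SrSi : (Sr + Si = r%:E)%E.
  rewrite -SE SE'; congr (_ + _)%E; apply: eq_eseriesr => n _; by rewrite coefs.
have [Sr0 Si0] : (0 <= Sr)%E /\ (0 <= Si)%E by split; exact: nn.
have Sroo : (Sr < +oo)%E by apply: le_lt_trans (ltry r); rewrite -SrSi leeDl.
have Sioo : (Si < +oo)%E by apply: le_lt_trans (ltry r); rewrite -SrSi leeDr.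
have [hr [Lhr hrS] hrw] := weak_derivative Fr Sroo.
have [hi [Lhi hiS] hiw] := weak_derivative Fi Sioo.
pose G x := hr x +i* hi x.
have LG : inL2 G by [].
apply: (@le_trans _ _ (Num.sqrt (normsq G))%:E).
  apply: (@distr_dx_le _ _ F) => //; apply: distr_derivP => w cw.
  by rewrite (hrw _ cw) (hiw _ cw) expr1 !mulN1r.
have nG : normsq G <= 2 * r.
  rewrite -lee_fin /normsq EFinD EFinM -SrSi.
  rewrite ge0_muleDr//; exact: leeD.
have r0 : 0 <= r by rewrite -lee_fin -SE.
rewrite /= -EFinM lee_fin -[Num.sqrt r]addr0; apply: sqrt_sum_le; [exact: sqrtr_ge0|exact: lexx|].
by rewrite sqr_sqrtr// expr0n /= addr0.
Qed.

(** If the W^2 norm is finite, v is a function F in the domain of L and its second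
    derivative is q F - L F. *)
Lemma d2x_bound v : isdistr q v ->
  (distr_dx_L2norm q 2 v <= 2%:E * (M%:E * esqrt (S2 (distr_coefs phi v)) +
     esqrt (S2 (fun n => (lam n)%:C * distr_coefs phi v n)%R)))%E.
Proof.
move=> dv; set S := (X in (_ + esqrt X)%E).
have S0 : (0 <= S)%E by exact: S2_ge0.
have M0 : 0 <= M by case: qM.
have eq0 (x : \bar R) : (0 <= esqrt x)%E by case: x => //= x; rewrite lee_fin sqrtr_ge0.
case SE : S => [r| |]; last by move: S0; rewrite SE.
  2: by rewrite [esqrt +oo%E]/= addey ?gt0_muley ?lte_fin ?leey// gt_eqF// (lt_le_trans ltNy0)// mule_ge0// lee_fin.
have voo : (S2 (distr_coefs phi v) < +oo)%E.
  apply: (@le_lt_trans _ _ S); last by rewrite SE ltry.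
  rewrite -[leRHS]mul1e -[X in (X%:E * _)%E](expr1n _ 2%N); apply: le_S2 => n.
  rewrite mul1r cmodM -[leLHS]mul1r; apply: ler_wpM2r; first exact: cmod_ge0.
  by rewrite cmodR ger0_norm ?(lam_ge0 sys)// (lam_ge1 sys).
have [F LF vF] := distr_repr sys dv voo.
have coefs n : distr_coefs phi v n = coef phi n F.
  by rewrite /distr_coefs vF ?distr_of_coef ?coefE//; exact: testL_phi sys n.
have [|G0 FG] := DomL_coef sys LF.
  by under [X in S2 X]eq_fun do rewrite -coefs; rewrite -/S SE ltry.
have [_ LG0 G0E] := (isL_coefP sys _ _).1 FG.
have [FGr FGi] := (isLP qM _ _).1 FG.
have nG0 : normsq G0 = r.
  apply/EFin_inj; rewrite -SE -(parsevalC (orthonormal_phi sys))//; congr S2.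
  by apply/funext => n; rewrite G0E coefs.
have [[Fr Fi] [Gr Gi]] := (LF, LG0).
have Lqr := L2q qM Fr; have Lqi := L2q qM Fi.
pose H x := (q x * complex.Re (F x) - complex.Re (G0 x)) +i* (q x * complex.Im (F x) - complex.Im (G0 x)).
have LH : inL2 H by split; exact: L2B.
apply: (@le_trans _ _ (Num.sqrt (normsq H))%:E).
  apply: (@distr_dx_le _ _ F) => //; apply: distr_derivP => w cw.
  by rewrite (isLr_weak2 FGr cw) (isLr_weak2 FGi cw) expr2 mulN1r opprK !mul1r.
rewrite (distr_repr_normsq sys LF vF).
change ((Num.sqrt (normsq H))%:E <= (2 * (M * Num.sqrt (normsq F) + Num.sqrt r))%:E)%E; rewrite lee_fin.
have nF0 := normsq_ge0 F; have nG := normsq_ge0 G0.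
apply: sqrt_sum_le; [by rewrite mulr_ge0// sqrtr_ge0|exact: sqrtr_ge0|].
rewrite exprMn !sqr_sqrtr//; last by rewrite -nG0.
have h1 := ipD_le Lqr (L2N Gr); have h2 := ipD_le Lqi (L2N Gi).
have h3 := ip_qq qM Fr; have h4 := ip_qq qM Fi.
rewrite !ipNl ?ipNr ?opprK// in h1 h2; try exact: L2N.
rewrite -nG0 /normsq [X in X <= _](_ : _ = ip (re H) (re H) + ip (im H) (im H))//.
rewrite /H /=; lra.
Qed.

End space_derivatives.

(** * Norms along the solution and the theorem *)

Section norms_along_orbit.
Context {R : realType}.
Variables (q : R -> R) (M : R) (lam : nat -> R) (phi : nat -> R -> R).
Hypothesis sys : eigensystem q M lam phi.
Variables (T s : R) (a : R -> R) (u0 : distr R).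
Hypothesis du0 : isdistr q u0.
Local Notation c := (distr_coefs phi u0).
Local Notation u := (evolve lam phi T s a u0).

Lemma esqrt_ge0 (x : \bar R) : (0 <= esqrt x)%E.
Proof. by case: x => //= x; rewrite lee_fin sqrtr_ge0. Qed.

Lemma lee_double (x : \bar R) : (0 <= x)%E -> (x <= 2%:E * x)%E.
Proof. by move=> x0; rewrite -[leLHS]mul1e lee_wpmul2r// lee_fin ler1n. Qed.

Lemma coefs_evolve t n : distr_coefs phi (u t) n = phase lam T s a t n * c n.
Proof. exact: (distr_multiplier_phi sys n du0 (growth_phase lam T s a t)). Qed.

Lemma distrL2norm_evolve t : distrL2norm q (u t) = distrL2norm q u0.
Proof.
rewrite (distrL2normE sys (isdistr_evolve sys T s a du0 t)) (distrL2normE sys du0).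
by apply: eq_esqrt_S2 => n; rewrite coefs_evolve cmodM cmod_expi mul1r.
Qed.

Lemma esqrt_S2_evolve (b : nat -> R) t :
  esqrt (S2 (fun n => (b n)%:C * distr_coefs phi (u t) n)) = esqrt (S2 (fun n => (b n)%:C * c n)).
Proof. by apply: eq_esqrt_S2 => n; rewrite coefs_evolve !cmodM cmod_expi mul1r. Qed.

Lemma distrL2norm_dt t (m : R) : 0 < m -> `|a t| <= m ->
  (distrL2norm q (evolve_dt lam phi T s a u0 t) <= m%:E * Wnorm q lam phi (2 * s)%R u0)%E.
Proof.
move=> m0 am; have [r sr] := growth_powR sys s.
have E F : testL q F -> evolve_dt lam phi T s a u0 t F =
    u0 (multiplier phi (fun n => (0 +i* a t) * velocity lam T s a t n) F).
  by move=> tF; rewrite (evolve_dtE sys T s a du0 t tF).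
rewrite (distrL2norm_multiplier sys du0 (normr_ge0 _) (growth_dt T a t sr) E).
rewrite (Wnorm_u0 sys _ du0) mulrAC mulfV// mul1r.
apply: esqrt_le => //; try exact: S2_ge0.
apply: le_S2 => n; rewrite !cmodM cmod_expi mulr1 mulrA ler_wpM2r ?cmod_ge0//.
rewrite ler_wpM2r ?cmod_ge0// (le_trans _ am)// (le_trans (cmod_le _))//=.
by rewrite normr0 add0r.
Qed.

End norms_along_orbit.

Theorem theorem2p1 (R : realType) (T s k : R) (hT : 0 < T) :
  exists C : R, 0 < C /\
  forall (nu q a : R -> R) (a0 : R) (lam : nat -> R) (phi : nat -> R -> R)
    (u0 : distr R),
    inLp I01 2%:E nu ->
    distr_deriv 1 (cfun nu) (cfun q) ->
    inLp I01 +oo%E q ->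
    {ae leb, forall x, I01 x -> 0 <= q x} ->
    inLp (I0T T) +oo%E a ->
    0 < a0 ->
    (forall t, I0T T t -> a0 <= a t) ->
    eigenbasis q lam phi ->
    inW q lam phi k u0 ->
    exists u : R -> distr R,
      [/\ schrodinger_sol q lam phi T s k a u0 u,
          forall v, schrodinger_sol q lam phi T s k a u0 v ->
            forall t, I0T T t -> distr_eq q (v t) (u t),
          forall t, I0T T t ->
            (distrL2norm q (u t) <= C%:E * distrL2norm q u0)%E,
          {ae leb, forall t, I0T T t -> exists w,
            distr_dt q u t w /\
            (distrL2norm q w <=
              C%:E * (Lpnorm (I0T T) +oo a * Wnorm q lam phi (2 * s)%R u0))%E} &
          s = 1 -> forall t, I0T T t ->
            [/\ (distr_dx_L2norm q 1%N (u t) <=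
                  C%:E * (Wnorm q lam phi 1%R u0 * (1 + Lpnorm I01 2%:E nu)
                          + distrL2norm q u0 * Lpnorm I01 +oo nu))%E,
                (distr_dx_L2norm q 2%N (u t) <=
                  C%:E * (Lpnorm I01 +oo q * distrL2norm q u0
                          + Wnorm q lam phi 2%R u0))%E &
                (Wnorm q lam phi k (u t) <= C%:E * Wnorm q lam phi k u0)%E]].
Proof.
exists 2; split=> // nu q a a0 lam phi u0 _ _ qoo q0 aoo a00 aa0 eb Wu0.
have [M qM qE] := inLoo_essbounded measurable_I01 qoo.
have [Ma aM aE] := inLoo_essbounded (measurable_itv `[0, T] : measurable (I0T T : set (measurableTypeR R))) aoo.
have sys : eigensystem q M lam phi by [].
have du0 : isdistr q u0 := Wu0.1.
have sol := evolve_sol sys s aM du0 Wu0 hT.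
have Wnorm0 m : Wnorm q lam phi m u0 = esqrt (S2 (fun n => (lam n `^ (m / 2))%:C * distr_coefs phi u0 n)).
  exact: (Wnorm_u0 sys m du0).
have W0 m : (0 <= Wnorm q lam phi m u0)%E by rewrite Wnorm0 esqrt_ge0.
have L0 : (0 <= distrL2norm q u0)%E by rewrite (distrL2normE sys du0) esqrt_ge0.
exists (evolve lam phi T s a u0); split => //.
- by move=> v solv t tI; exact: (sol_unique sys hT sol solv tI).
- by move=> t _; rewrite (distrL2norm_evolve sys)// lee_double.
- have [_ Ma0 aMae] := aM.
  have neq := aeI (fun t (h0 : t != 0) (h1 : t != T) => conj h0 h1) (ae_neq 0) (ae_neq T).
  apply: aeI (evolve_derivative sys s aM du0) (aeI (fun t h1 h2 => conj h1 h2) neq aMae).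
  move=> t dt [[t0 tT] aMt] tI; have := tI; rewrite /I0T/= in_itv/= => /andP[tge0 tleT].
  exists (evolve_dt lam phi T s a u0 t); split.
    by apply: dt; rewrite lt_neqAle ?tge0 ?tleT ?andbT// eq_sym.
  have am := aMt tI.
  have m0 : 0 < Ma.
    by rewrite (lt_le_trans a00)// (le_trans (aa0 t tI))// (le_trans (ler_norm _)).
  rewrite aE; apply: le_trans (distrL2norm_dt sys _ _ du0 m0 am) _.
  by apply: lee_double; rewrite mule_ge0// lee_fin.
- move=> _ t _; have dut := isdistr_evolve sys T s a du0 t.
  split.
  + apply: (le_trans (dx_bound sys dut)).
    rewrite (esqrt_S2_evolve sys T s a du0) -Wnorm0 lee_pmul2l ?lte_fin//.
    have n0 : (0 <= Lpnorm I01 2%:E nu)%E by exact: Lnorm_ge0.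
    have n1 : (0 <= Lpnorm I01 +oo%E nu)%E by exact: Lnorm_ge0.
    apply: (@le_trans _ _ (Wnorm q lam phi 1%R u0 * (1 + Lpnorm I01 2%:E nu))%E).
      by rewrite -[leLHS]mule1 lee_wpmul2l// leeDl.
    by rewrite leeDl// mule_ge0.
  + apply: (le_trans (d2x_bound sys dut)).
    rewrite qE Wnorm0 (esqrt_S2_evolve sys T s a du0) (distrL2normE sys du0).
    have -> : esqrt (S2 (distr_coefs phi (evolve lam phi T s a u0 t))) = esqrt (S2 (distr_coefs phi u0)).
      by apply: eq_esqrt_S2 => n; rewrite (coefs_evolve sys)// cmodM cmod_expi mul1r.
    rewrite (_ : (fun n => (lam n `^ (2 / 2))%:C * _) = (fun n => (lam n)%:C * distr_coefs phi u0 n))//.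
    by apply/funext => n; rewrite mulfV// powRr1// (lam_ge0 sys).
  + by rewrite (Wnorm_evolve sys)// lee_double.
Qed.
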